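(* Let $(u,\rho)$ be a global solution of the prescribed curvature flow concentrating along $t_l\to\infty$ at $z_0\in\partial B$ (as described in the context), and let $R=R(z_0)$. Then, with error $o(1)\to0$ as $t=t_l\to\infty$, there holds $$2\Xi_i=\alpha\int_{S^2_R}\xi_i\cdot df_{\Phi_R}\,d\mu_{\bar h}+2\beta\int_{\partial S^2_R}\xi_i\cdot dj_{\Phi_R}\,ds_{\bar h}+o(1)F(t)^{1/2},\qquad i=1,2,$$ where $\xi_i\cdot d\varphi$ denotes the derivative of $\varphi$ in direction of the vector field $\xi_i$.
   Context: $B\subset\mathbb R^2\cong\mathbb C$ is the open unit disc, $\nu_0$ the outward unit normal, $ds_0$ arc length on $\partial B$. $f\in C^\infty(\bar B)$, $j\in C^\infty(\partial B)$ are strictly positive and $j$ is extended harmonically to $B$. It is assumed that the problem $-\Delta u=fe^{2u}$ in $B$, $\partial u/\partial\nu_0+1=je^u$ on $\partial B$ has no solution. Flow. For a function $u$ set $g=e^{2u}g_{\mathbb R^2}$, $d\mu_g=e^{2u}dz$, $ds_g=e^uds_0$, $K=K_g=-e^{-2u}\Delta u$ in $B$, $k=k_g=e^{-u}(\partial u/\partial\nu_0+1)$ on $\partial B$. The prescribed curvature flow with smooth initial data $(u_0,\rho_0)$, $0<\rho_0<\pi$, is the system $u_t=\alpha f-K$ in $B$, $u_t=\beta j-k$ on $\partial B$, $\rho_t=\log(\beta^2/\alpha)$, with $0<\rho(t)<\pi$ and $\alpha(t)=\frac{2\rho}{\int_Bfe^{2u}dz}$, $\beta(t)=\frac{2(\pi-\rho)}{\int_{\partial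 B}je^uds_0}$; $u$ is continuous on $\bar B\times[0,\infty)$ and smooth for $t>0$. Let $F(t)=\int_B|\alpha f-K|^2d\mu_g+\int_{\partial B}|\beta j-k|^2ds_g+\rho_t^2$; one has $F(t)\to0$ as $t\to\infty$. Normalization. $M=\{z\mapsto e^{\mathrm i\theta}\frac{z+a}{1+\bar az}:\ |a|<1,\theta\in\mathbb R\}$. For $z\in\bar B$ let $R(z)=\sqrt{1+j(z)^2/f(z)}-j(z)/\sqrt{f(z)}\in(0,1)$. Let $\Psi(z)=\big(\frac{2z}{1+|z|^2},\frac{1-|z|^2}{1+|z|^2}\big)\in S^2$, $\Psi_R(z)=\Psi(Rz)$, $\psi_R(z)=\frac{2Rz}{1+R^2|z|^2}$. For each $t$, $\Phi=\Phi(t)\in M$ (normalized with respect to rotations so that it is of the form $\Phi(z)=\frac{z+p}{1+\bar pz}$, $p=p(t)\in B$) is such that $v=v(t)=u(t)\circ\Phi+\frac12\log\det d\Phi$ satisfies $\frac12\int_B\psi_Re^{2v}dz+\int_{\partial B}\psi_Re^vds_0=0$; $h=\Phi^*g=e^{2v}g_{\mathbb R^2}$. Concentration at $z_0$ along $t_l\to\infty$ means: $\Phi(t_l)\to z_0$ weakly in $H^1(B)$, $\alpha(t_l)\to\alpha_\infty>0$, $\beta(t_l)\to\beta_\infty>0$ with $\alpha_\infty=\beta_\infty^2$, and for $R=R(z_0)$, $v(t_l)\to v_\infty(z)=\log\frac{2R/\sqrt{\alpha_\infty f(z_0)}}{1+R^2|z|^2}$ in $H^{3/2}(B)\cap H^1(\partial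 B)\cap L^\infty(B)$. Lift to the sphere. $S^2_R=\Psi_R(B)\subset S^2\subset\mathbb R^3$, $\pi_R=\Psi_R^{-1}$, $\Phi_R=\Phi\circ\pi_R$, $\bar h=\pi_R^*h$ with area element $d\mu_{\bar h}$ and boundary line element $ds_{\bar h}$; $f_{\Phi_R}=f\circ\Phi_R$, $K_{\Phi_R}=K\circ\Phi_R$, and similarly $j_{\Phi_R}$, $k_{\Phi_R}$. $X_1,X_2,X_3$ are the restrictions of the coordinate functions to $S^2$, $e_1,e_2,e_3$ is the standard basis, $X=(X_1,X_2,X_3)$, $\sigma=\frac{1-R^2}{1+R^2}$ (the value of $X_3$ on $\partial S^2_R$), $\wedge$ is the cross product in $\mathbb R^3$, $\nabla X_i=e_i-X_iX$, and $$\xi_1=\nabla X_1+\sigma X\wedge e_2,\qquad \xi_2=\nabla X_2-\sigma X\wedge e_1,$$ which are tangent to $\partial S^2_R$ along $\partial S^2_R$. Finally $$\Xi_i=\int_{S^2_R}X_i(\alpha f_{\Phi_R}-K_{\Phi_R})\,d\mu_{\bar h}+\int_{\partial S^2_R}X_i(\beta j_{\Phi_R}-k_{\Phi_R})\,ds_{\bar h},\quad i=1,2.$$ *)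

(* Defs.v *)
From HB Require Import structures.
From mathcomp Require Import all_boot all_order all_algebra.
From mathcomp Require Import complex ring.
From mathcomp Require Import all_classical all_reals all_analysis.

Set Implicit Arguments.
Unset Strict Implicit.
Unset Printing Implicit Defensive.

Import Order.TTheory GRing.Theory Num.Theory.
Import numFieldNormedType.Exports.

Local Open Scope classical_set_scope.
Local Open Scope ring_scope.

Section Smooth.
Context {R : realType} {V : normedModType R}.

Definition iter_derive (s : seq V) (w : V -> R) : V -> R :=
  foldr (fun e g x => 'D_e g x) w s.

Definition smooth_open (U : set V) (w : V -> R) : Prop :=
  forall (s : seq V) (x : V), U x -> differentiable (iter_derive s w) x.

(* C^oo on a set A that need not be open: w is the restriction to A of a
   smooth function on an open neighbourhood of A.  The values of w off A are
   irrelevant.  This gives C^oo of the closed disc, of the circle, and of the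
   closed disc times an open time interval. *)
Definition smooth_on (A : set V) (w : V -> R) : Prop :=
  exists (U : set V) (w' : V -> R),
    [/\ open U, A `<=` U, smooth_open U w' & {in A, w =1 w'}].

End Smooth.

Section Flow.
Context {R : realType}.

Local Notation plane := (R * R)%type.
Local Notation leb1 := (@lebesgue_measure R).
Local Notation leb2 := (@lebesgue_measure R \x @lebesgue_measure R)%E.

(* The library norm on [R * R] is the sup norm. *)
Definition enorm (z : plane) : R := Num.sqrt (z.1 ^+ 2 + z.2 ^+ 2).

Definition disc : set plane := [set z | enorm z < 1].
Definition cdisc : set plane := [set z | enorm z <= 1].
Definition circle : set plane := [set z | enorm z = 1].

Definition circle_pt (th : R) : plane := (cos th, sin th).

Definition d1 (w : plane -> R) (z : plane) : R := 'D_((1, 0) : plane) w z.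
Definition d2 (w : plane -> R) (z : plane) : R := 'D_((0, 1) : plane) w z.
Definition laplacian (w : plane -> R) (z : plane) : R :=
  d1 (d1 w) z + d2 (d2 w) z.

(* Outward normal derivative at a point of the unit circle, taken from inside
   the disc: only values on the closed disc enter. *)
Definition dnormal (w : plane -> R) (z : plane) : R :=
  lim ((w (s *: z) - w z) / (s - 1) @[s --> 1^'-]).

Definition int_disc (w : plane -> R) : R := \int[leb2]_(z in disc) w z.
Definition int_circle (w : plane -> R) : R :=
  \int[leb1]_(th in `[0, 2 * pi]) w (circle_pt th).

Definition gauss_curv (u : plane -> R) (z : plane) : R :=
  - expR (- (2 * u z)) * laplacian u z.
Definition geod_curv (u : plane -> R) (z : plane) : R :=
  expR (- u z) * (dnormal u z + 1).

Definition harmonic_extension (j : plane -> R) : Prop :=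
  [/\ {within cdisc, continuous j}, smooth_open disc j
    & forall z, disc z -> laplacian j z = 0].

Definition solves_prescribed (f j u : plane -> R) : Prop :=
  [/\ smooth_on cdisc u,
      forall z, disc z -> - laplacian u z = f z * expR (2 * u z)
    & forall z, circle z -> dnormal u z + 1 = j z * expR (u z)].

(* Time-dependent functions are written [u t z]: time first. *)

Variables (f j : plane -> R).

Definition alpha (u : R -> plane -> R) (rho : R -> R) (t : R) : R :=
  2 * rho t / int_disc (fun z => f z * expR (2 * u t z)).
Definition beta (u : R -> plane -> R) (rho : R -> R) (t : R) : R :=
  2 * (pi - rho t) / int_circle (fun z => j z * expR (u t z)).

Definition curvature_flow (u : R -> plane -> R) (rho : R -> R) : Prop :=
  [/\ [/\ smooth_on cdisc (u 0),
          {within [set x : R * plane | 0 <= x.1 /\ cdisc x.2],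
            continuous (fun x : R * plane => u x.1 x.2)}
        & smooth_on [set x : R * plane | 0 < x.1 /\ cdisc x.2]
            (fun x => u x.1 x.2)],
      [/\ {within `[0, +oo[, continuous rho},
          forall t : R, 0 <= t -> 0 < rho t < pi
        & forall t : R, 0 < t -> derivable rho t 1],
      forall (t : R) (z : plane), 0 < t -> disc z ->
        derive1 (u ^~ z) t = alpha u rho t * f z - gauss_curv (u t) z,
      forall (t : R) (z : plane), 0 < t -> circle z ->
        derive1 (u ^~ z) t = beta u rho t * j z - geod_curv (u t) z
    & forall t : R, 0 < t ->
        derive1 rho t = ln (beta u rho t ^+ 2 / alpha u rho t)].

Definition defect (u : R -> plane -> R) (rho : R -> R) (t : R) : R :=
  int_disc (fun z => (alpha u rho t * f z - gauss_curv (u t) z) ^+ 2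
                     * expR (2 * u t z))
  + int_circle (fun z => (beta u rho t * j z - geod_curv (u t) z) ^+ 2
                         * expR (u t z))
  + (derive1 rho t) ^+ 2.

Definition mobius (p z : plane) : plane :=
  let P := (p.1 +i* p.2)%C in
  let Z := (z.1 +i* z.2)%C in
  let W := (Z + P) / (1 + conjc P * Z) in
  (complex.Re W, complex.Im W).

Definition jacobian_det (G : plane -> plane) (z : plane) : R :=
  let G1 := fun x => (G x).1 in
  let G2 := fun x => (G x).2 in
  d1 G1 z * d2 G2 z - d2 G1 z * d1 G2 z.

(* G^* (e^{2u} g_euc) = e^{2 (pull u G)} g_euc *)
Definition pull (u : plane -> R) (G : plane -> plane) (z : plane) : R :=
  u (G z) + 2^-1 * ln (jacobian_det G z).

Definition cap_radius (z : plane) : R :=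
  Num.sqrt (1 + j z ^+ 2 / f z) - j z / Num.sqrt (f z).

(* The two components of the balancing condition
   1/2 int_B psi_r e^{2v} dz + int_{dB} psi_r e^v ds_0 = 0. *)
Definition balanced (r : R) (v : plane -> R) : Prop :=
  let psi (z : plane) : plane :=
    (2 * r / (1 + r ^+ 2 * enorm z ^+ 2)) *: z in
  2^-1 * int_disc (fun z => (psi z).1 * expR (2 * v z))
    + int_circle (fun z => (psi z).1 * expR (v z)) = 0 /\
  2^-1 * int_disc (fun z => (psi z).2 * expR (2 * v z))
    + int_circle (fun z => (psi z).2 * expR (v z)) = 0.

Definition test_function (eta : plane -> R) : Prop :=
  smooth_open setT eta /\
  exists2 c : R, c < 1 & forall z, c <= enorm z -> eta z = 0.

Definition square_integrable (w : plane -> R) : Prop :=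
  measurable_fun disc w /\
  (\int[leb2]_(z in disc) ((w z) ^+ 2)%:E < +oo)%E.

(* w belongs to H^1(B) and (g1, g2) is its weak gradient. *)
Definition H1_with_gradient (w g1 g2 : plane -> R) : Prop :=
  [/\ square_integrable w, square_integrable g1, square_integrable g2
    & forall eta, test_function eta ->
      int_disc (fun z => w z * d1 eta z) = - int_disc (fun z => g1 z * eta z)
   /\ int_disc (fun z => w z * d2 eta z) = - int_disc (fun z => g2 z * eta z)].

(* Weak convergence in the Hilbert space H^1(B): convergence of the H^1 inner
   products with every element of H^1(B).  It is used for w_ l and w smooth on
   the closed disc only, so their weak gradients are the classical ones. *)
Definition weak_H1_cvg (w_ : nat -> plane -> R) (w : plane -> R) : Prop :=
  let H1_dot (a b g1 g2 : plane -> R) :=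
    int_disc (fun z => a z * b z + d1 a z * g1 z + d2 a z * g2 z) in
  forall b g1 g2, H1_with_gradient b g1 g2 ->
    H1_dot (w_ l) b g1 g2 @[l --> \oo] --> H1_dot w b g1 g2.

(* Squared norms of H^{3/2}(B) (Sobolev--Slobodeckij, n + 2 s = 3 for the
   order-1/2 seminorm of the gradient in dimension n = 2) and of H^1(dB), in
   the extended reals, for functions smooth on the closed disc. *)
Definition H32_sqnorm (w : plane -> R) : \bar R :=
  (\int[leb2]_(z in disc) ((w z) ^+ 2 + (d1 w z) ^+ 2 + (d2 w z) ^+ 2)%:E
   + \int[leb2]_(x in disc) \int[leb2]_(y in disc)
       (((d1 w x - d1 w y) ^+ 2 + (d2 w x - d2 w y) ^+ 2)
        / enorm (x - y) ^+ 3)%:E)%E.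

Definition H1_circle_sqnorm (w : plane -> R) : \bar R :=
  (\int[leb1]_(th in `[0%R, (2 * pi)%R])
     ((w (circle_pt th)) ^+ 2 + (derive1 (w \o circle_pt) th) ^+ 2)%:E)%E.

Definition Linfty_norm (w : plane -> R) : \bar R :=
  Lnorm leb2 +oo%E (EFin \o (w \_ disc)).

Definition v_limit (r ainf fz0 : R) (z : plane) : R :=
  ln ((2 * r / Num.sqrt (ainf * fz0)) / (1 + r ^+ 2 * enorm z ^+ 2)).

(* [p t] is the parameter of Phi(t). *)
Definition concentrates (u : R -> plane -> R) (rho : R -> R) (p : R -> plane)
    (z0 : plane) (tl : nat -> R) : Prop :=
  [/\ tl l @[l --> \oo] --> +oo,
      weak_H1_cvg (fun l z => (mobius (p (tl l)) z).1) (fun=> z0.1),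
      weak_H1_cvg (fun l z => (mobius (p (tl l)) z).2) (fun=> z0.2)
    & exists ainf binf : R,
      [/\ 0 < ainf, 0 < binf, ainf = binf ^+ 2,
          alpha u rho (tl l) @[l --> \oo] --> ainf
          /\ beta u rho (tl l) @[l --> \oo] --> binf
        & let w_ l z := pull (u (tl l)) (mobius (p (tl l))) z
                        - v_limit (cap_radius z0) ainf (f z0) z in
          [/\ H32_sqnorm (w_ l) @[l --> \oo] --> 0%E,
              H1_circle_sqnorm (w_ l) @[l --> \oo] --> 0%E
            & Linfty_norm (w_ l) @[l --> \oo] --> 0%E]]].

End Flow.

Section Sphere.
Context {R : realType}.

Local Notation plane := (R * R)%type.
Local Notation space := 'rV[R]_3.

Definition vec3 (a b c : R) : space := \row_(k < 3) [:: a; b; c]`_k.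
Definition dot3 (X Y : space) : R := \sum_(k < 3) X 0 k * Y 0 k.
Definition cross3 (X Y : space) : space :=
  vec3 (X 0 1 * Y 0 2 - X 0 2 * Y 0 1)
       (X 0 2 * Y 0 0 - X 0 0 * Y 0 2)
       (X 0 0 * Y 0 1 - X 0 1 * Y 0 0).
Definition basis3 (k : 'I_3) : space := delta_mx 0 k.

Definition Psi (z : plane) : space :=
  (1 + enorm z ^+ 2)^-1 *: vec3 (2 * z.1) (2 * z.2) (1 - enorm z ^+ 2).
Definition Psi_ (r : R) (z : plane) : space := Psi (r *: z).

(* Inverse of Psi_r: stereographic projection from the south pole, over r
   (see [pi_K]). *)
Definition pi_ (r : R) (X : space) : plane :=
  r^-1 *: ((X 0 0 / (1 + X 0 2), X 0 1 / (1 + X 0 2)) : plane).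

Lemma pi_K (r : R) (z : plane) : r != 0 -> pi_ r (Psi_ r z) = z.
Proof.
move=> r0; rewrite /pi_ /Psi_ /Psi !mxE /=.
set N := enorm _ ^+ 2; have N0 : 0 <= N by exact: sqr_ge0.
have N1 : 1 + N != 0 by rewrite gt_eqF// ltr_wpDr.
have -> : 1 + (1 + N)^-1 * (1 - N) = 2 / (1 + N) by field.
case: z @N N0 N1 => x y N N0 N1; rewrite /GRing.scale /=.
by congr pair; rewrite /GRing.scale/=; field; rewrite r0 N1.
Qed.

Definition sigma (r : R) : R := (1 - r ^+ 2) / (1 + r ^+ 2).

(* Gradient on the sphere of the k-th coordinate function. *)
Definition gradX (k : 'I_3) (X : space) : space := basis3 k - X 0 k *: X.

Definition xi (r : R) (i : 'I_2) (X : space) : space :=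
  if i == 0 then gradX 0 X + sigma r *: cross3 X (basis3 1)
  else gradX 1 X - sigma r *: cross3 X (basis3 0).

(* Nearest-point projections onto the sphere and onto the boundary circle
   {X_3 = sigma} of the cap. *)
Definition proj_sphere (X : space) : space := (Num.sqrt (dot3 X X))^-1 *: X.
Definition proj_rim (r : R) (X : space) : space :=
  let c := 2 * r / (1 + r ^+ 2) / Num.sqrt (X 0 0 ^+ 2 + X 0 1 ^+ 2) in
  vec3 (c * X 0 0) (c * X 0 1) (sigma r).

(* Derivative of phi at X in the direction of a tangent vector e of a
   submanifold S of R^3: the derivative in R^3 of the extension phi \o P,
   P being the nearest-point projection onto S.  Only the values of phi on S
   (near X) matter. *)
Definition tangent_derive (P : space -> space) (phi : space -> R)
  (e X : space) : R := 'D_e (phi \o P) X.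

(* Psi_r is by definition an isometry from (B, e^{2v} g_euc) onto the cap with
   the metric h_bar = pi_r^* (e^{2v} g_euc), so that integrals against the
   area and boundary line elements of h_bar are computed on B and dB. *)
Definition int_cap (r : R) (v : plane -> R) (G : space -> R) : R :=
  int_disc (fun z => G (Psi_ r z) * expR (2 * v z)).
Definition int_rim (r : R) (v : plane -> R) (G : space -> R) : R :=
  int_circle (fun z => G (Psi_ r z) * expR (v z)).

Definition lift_cap (r : R) (p : plane) (w : plane -> R) (X : space) : R :=
  w (mobius p (pi_ r X)).

Section Moments.
Variables (f j : plane -> R) (u : R -> plane -> R) (rho : R -> R).
Variables (p : R -> plane) (r t : R).

Let v : plane -> R := pull (u t) (mobius (p t)).

Definition Xi (i : 'I_2) : R :=
  let k : 'I_3 := widen_ord (leqnSn 2) i in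
  int_cap r v (fun X => X 0 k *
    (alpha f u rho t * lift_cap r (p t) f X
     - lift_cap r (p t) (gauss_curv (u t)) X))
  + int_rim r v (fun X => X 0 k *
    (beta j u rho t * lift_cap r (p t) j X
     - lift_cap r (p t) (geod_curv (u t)) X)).

Definition int_xi_df (i : 'I_2) : R :=
  int_cap r v (fun X =>
    tangent_derive proj_sphere (lift_cap r (p t) f) (xi r i X) X).

Definition int_xi_dj (i : 'I_2) : R :=
  int_rim r v (fun X =>
    tangent_derive (proj_rim r) (lift_cap r (p t) j) (xi r i X) X).

End Moments.
End Sphere.

(* Main.v *)
(** Pulled back to the disc, [xi i] is a conformal field [eta], and its
    push-forward under [Phi] is again one.  Put
    [D = eta . grad v + div eta / 2].  The divergence theorem, through a Pohozaev
    identity, shows that [int D K + int D k = 0] for the curvatures of any metric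
    [exp (2 v) g_euc] (Kazdan-Warner).  Integrating [f] and [j] by parts as well,
    [alpha int eta . grad f + 2 beta int eta . grad j
     = - 2 int D (alpha f - K) - 2 int D (beta j - k)], so the error is twice the
    moment of the defects against [X_i + D].  The spherical limit profile is
    critical for this: [X_i + D = eta . grad (v - v_limit)] pointwise.  By
    Cauchy-Schwarz and conformal invariance of the defect, the error is at most
    [F^(1/2)] times the [L^2] norms of the gradient of [v - v_limit] on the disc
    and of its tangential derivative on the circle. *)
Require Import Defs.
From mathcomp Require Import all_boot all_order all_algebra.
From mathcomp Require Import all_classical all_reals all_analysis.
From mathcomp Require Import measurable_realfun complex ring lra.
Set Implicit Arguments.
Unset Strict Implicit.
Unset Printing Implicit Defensive.
Import Order.TTheory GRing.Theory Num.Theory.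
Import numFieldNormedType.Exports.
Local Open Scope classical_set_scope.
Local Open Scope ring_scope.

(** Kazdan-Warner is applied to [u] itself on the target disc, with the pushed-forward field, and
    only the resulting integral identity is pulled back by [Phi]; no second derivative of [v] is
    ever computed. The price is the invariance of disc and circle integrals under [Phi]. It is
    obtained by deformation: the maps of parameter [s p] join the identity to [Phi], and the
    [s]-derivative of the pulled-back density is the divergence of a field tangent to the circle.
    One divergence theorem, proved by Fubini on chords, thus serves both purposes.

    The data are smooth only as restrictions to the closed disc or the circle. Each is replaced by a
    representative smooth on a neighbourhood; interior derivatives agree by locality, the normal
    derivative because its one-sided quotient stays in the closed disc.

    Besides the two [L^2] norms, the error bound uses the sup norm of [v - v_limit]: once it is
    below 1, [expR v] is at most [e] times the limit profile, which fixes all constants. *)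

(** * Elementary topology of the disc and the circle *)

Lemma discP {R : realType} (z : R * R) :
  disc z <-> z.1 ^+ 2 + z.2 ^+ 2 < 1.
Proof.
by rewrite /disc /enorm /= -[X in _ < X]sqrtr1 ltr_sqrt.
Qed.

Lemma cdiscP {R : realType} (z : R * R) :
  cdisc z <-> z.1 ^+ 2 + z.2 ^+ 2 <= 1.
Proof.
by rewrite /cdisc /enorm /= -[X in _ <= X]sqrtr1 ler_sqrt.
Qed.

Lemma circleP {R : realType} (z : R * R) :
  circle z <-> z.1 ^+ 2 + z.2 ^+ 2 = 1.
Proof.
rewrite /circle /enorm /=; split=> [|->]; last by rewrite sqrtr1.
move=> h; rewrite -[LHS]sqr_sqrtr ?h ?expr1n//.
by rewrite addr_ge0 ?sqr_ge0.
Qed.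

Lemma disc_cdisc {R : realType} (z : R * R) : disc z -> cdisc z.
Proof. by move=> /ltW. Qed.

Lemma circle_cdisc {R : realType} (z : R * R) : circle z -> cdisc z.
Proof. by rewrite /circle /cdisc /= => ->. Qed.

Lemma circle_ptP {R : realType} (t : R) : circle (circle_pt t).
Proof. by apply/circleP; rewrite /= cos2Dsin2. Qed.

Lemma continuous_sqnorm {R : realType} :
  continuous (fun z : R * R => z.1 ^+ 2 + z.2 ^+ 2).
Proof.
move=> z; rewrite /continuous_at; apply: cvgD; rewrite expr2.
  by apply: cvgM; exact: cvg_fst.
by apply: cvgM; exact: cvg_snd.
Qed.

Lemma open_disc {R : realType} : open (@disc R).
Proof.
rewrite (_ : disc = (fun z : R * R => z.1 ^+ 2 + z.2 ^+ 2) @^-1` `]-oo, 1[).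
  by apply: open_comp => [z _|]; [exact: continuous_sqnorm|exact: interval_open].
by apply/seteqP; split=> z /=; rewrite in_itv/= => /discP.
Qed.

Lemma compact_cdisc {R : realType} : compact (@cdisc R).
Proof.
have -> : cdisc = (fun z : R * R => z.1 ^+ 2 + z.2 ^+ 2) @^-1` `]-oo, 1]
    `&` (`[-1, 1] `*` `[-1, 1]).
  apply/seteqP; split=> z /=; rewrite !in_itv/=; last by case=> /cdiscP.
  move=> /cdiscP z1; split=> //.
  by split; rewrite -ler_norml -[X in _ <= X]sqrtr1 -sqrtr_sqr ler_sqrt//;
    apply: le_trans z1; rewrite ?lerDl ?lerDr sqr_ge0.
rewrite setIC; apply: compact_closedI.
  by apply: compact_setX; exact: segment_compact.
apply: preimage_closed; first by move=> z _; exact: continuous_sqnorm.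
exact: interval_closed.
Qed.

(** * Measurability of open sets and continuous functions in the plane *)

Section PlaneMeasurability.
Context {R : realType}.

(** A countable base of the plane made of measurable boxes, which puts the open sets into the
    product sigma-algebra. It serves again for the sup norm, since every non-empty member has
    positive measure. *)
Definition rat_rectangle (q : (rat * rat) * (rat * rat)) : set (R * R) :=
  `]ratr q.1.1, ratr q.1.2[ `*` `]ratr q.2.1, ratr q.2.2[.

Lemma rat_rectangle_nbhs (A : set (R * R)) (z : R * R) : nbhs z A ->
  exists2 q, rat_rectangle q z & rat_rectangle q `<=` A.
Proof.
move=> /nbhs_ballP[e /= e0 eA].
have rat_near (x : R) : exists q : rat * rat,
    x - e < ratr q.1 < x /\ x < ratr q.2 < x + e.
  have /rat_in_itvoo[a] : x - e < x by rewrite ltrBlDr ltrDl.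
  rewrite in_itv => /= ax.
  have /rat_in_itvoo[b] : x < x + e by rewrite ltrDl.
  by rewrite in_itv => /= bx; exists (a, b).
have [a [/andP[a1 a2] /andP[a3 a4]]] := rat_near z.1.
have [b [/andP[b1 b2] /andP[b3 b4]]] := rat_near z.2.
exists (a, b); first by split; rewrite /= in_itv/= ?a2 ?a3 ?b2 ?b3.
move=> w [/=]; rewrite !in_itv/= => /andP[? ?] /andP[? ?]; apply: eA.
by split; rewrite /ball_ /ball/= ltr_distlC; apply/andP; split; lra.
Qed.

Lemma measurable_rat_rectangle q : measurable (rat_rectangle q).
Proof. by apply: measurableX; exact: measurable_itv. Qed.

Lemma open_measurable_plane (A : set (R * R)) : open A -> measurable A.
Proof.
move=> oA; have -> : A = \bigcup_q
    (if `[<rat_rectangle q `<=` A>] then rat_rectangle q else set0).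
  apply/seteqP; split=> z.
    move=> Az; have [q qz qA] := rat_rectangle_nbhs (open_nbhs_nbhs (conj oA Az)).
    by exists q => //; case: asboolP.
  by case=> q _; case: asboolP => // qA /qA.
apply: countable_bigcupT_measurable => // q.
by case: ifP => // _; exact: measurable_rat_rectangle.
Qed.

Lemma continuous_measurable_plane (D : set (R * R)) (w : R * R -> R) :
  open D -> (forall z, D z -> {for z, continuous w}) -> measurable_fun D w.
Proof.
move=> oD cw; apply: (measurability _ (RGenOpens.measurableE R)).
move=> _ [_ [a [b ->] <-]]; apply: open_measurable_plane.
rewrite openE => z [Dz wz]; apply: filterI.
  exact: open_nbhs_nbhs.
apply: (cw z Dz); exact: open_nbhs_nbhs.
Qed.

End PlaneMeasurability.

Lemma measurable_disc {R : realType} : measurable (@disc R).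
Proof. apply: open_measurable_plane; exact: open_disc. Qed.

Lemma compact_continuous_bounded {R : realType} {T : topologicalType}
    (K : set T) (w : T -> R) :
  compact K -> (forall z, K z -> {for z, continuous w}) ->
  exists M : R, forall z, K z -> `|w z| <= M.
Proof.
move=> cK cw; have cw' : {within K, continuous w}.
  apply: continuous_in_subspaceT => z; rewrite inE; exact: cw.
have [M [_ Mw]] := compact_bounded (continuous_compact cw' cK).
exists (M + 1) => z Kz; apply: (Mw (M + 1)); first by rewrite ltrDl.
by exists z.
Qed.

(** * Partial derivatives in the plane *)

(* Unlike [is_derive], this is not a class, so that [apply] leaves the
   premises of the rules below to the caller. *)
Definition has_derive1 {R : realType} (x : R) (g : R -> R) (dg : R) : Prop :=
  is_derive x 1 g dg.

Lemma is_derive_is_diff {R : realType} (g : R -> R) (x dg : R) :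
  has_derive1 x g dg -> is_diff x g (fun h => h * dg).
Proof.
case=> /derivable1_diffP dgx dgE; apply: DiffDef => //.
apply/funext => h; rewrite -[h in LHS]mulr1 -[_ * 1]/(h *: (1 : R)) linearZ.
by rewrite -deriveE// dgE.
Qed.

Lemma has_derive1_inv {R : realType} (x : R) : x != 0 ->
  has_derive1 x GRing.inv (- (x ^+ 2)^-1).
Proof.
move=> x0; have dx : differentiable (GRing.inv : R -> R) x.
  exact: differentiable_Rinv.
apply: DeriveDef; first exact/derivable1_diffP.
by rewrite deriveE// diff_Rinv// /GRing.scale/= mulr1.
Qed.

Section PlaneGradient.
Context {R : realType}.
Implicit Types (w f g : R * R -> R) (z : R * R) (a b : R).

(** Total differentiability with gradient [(a, b)], not mere existence of partial derivatives: the
    chain rules along curves and under maps of the plane depend on it. The explicit [a] and [b] let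
    gradients be computed by syntax and normalised by [ring] or [field]. *)
Definition pgrad w z a b : Prop :=
  is_diff z w (fun h : R * R => h.1 * a + h.2 * b).

Lemma pgrad_eq w z a b a' b' :
  pgrad w z a b -> a = a' -> b = b' -> pgrad w z a' b'.
Proof. by move=> h <- <-. Qed.

Lemma pgrad_diff w z (dw : R * R -> R) a b :
  is_diff z w dw -> dw =1 (fun h => h.1 * a + h.2 * b) -> pgrad w z a b.
Proof. by move=> h /funext; exact: is_diff_eq. Qed.

Lemma pgrad_differentiable w z a b : pgrad w z a b -> differentiable w z.
Proof. by case. Qed.

Lemma pgrad_continuous w z a b : pgrad w z a b -> {for z, continuous w}.
Proof. by move=> /pgrad_differentiable /differentiable_continuous. Qed.

Lemma pgrad_derive w z a b (e : R * R) : pgrad w z a b ->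
  is_derive z e w (e.1 * a + e.2 * b).
Proof.
case=> dw E; apply: DeriveDef; first exact: diff_derivable.
by rewrite deriveE// E.
Qed.

Lemma pgrad_d1 w z a b : pgrad w z a b -> d1 w z = a.
Proof.
by move=> /pgrad_derive-/(_ (1, 0))[_]; rewrite /d1 => ->; rewrite mul1r mul0r addr0.
Qed.

Lemma pgrad_d2 w z a b : pgrad w z a b -> d2 w z = b.
Proof.
by move=> /pgrad_derive-/(_ (0, 1))[_]; rewrite /d2 => ->; rewrite mul1r mul0r add0r.
Qed.

Lemma differentiable_pgrad w z :
  differentiable w z -> pgrad w z (d1 w z) (d2 w z).
Proof.
move=> dw; apply: (pgrad_diff (differentiableP dw)) => h.
rewrite /d1 /d2 !deriveE//.
have -> : h = h.1 *: ((1, 0) : R * R) + h.2 *: ((0, 1) : R * R).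
  by case: h => x y; congr pair; rewrite /= /GRing.scale/= !mulr1 !mulr0 ?addr0 ?add0r.
by rewrite linearD !linearZ /= /GRing.scale/= !mulr1 !mulr0 addr0 add0r.
Qed.

Lemma pgrad_cst c z : pgrad (fun=> c) z 0 0.
Proof.
by apply: (pgrad_diff (is_diff_cst c z)) => h; rewrite !mulr0 addr0.
Qed.

Lemma pgrad_fst z : pgrad (fun y => y.1) z 1 0.
Proof.
have dl : is_diff z (fst : R * R -> R) fst.
  have := @linear_differentiable _ _ _ (@fst R R) z.
  move=> H; apply: DiffDef; first by apply: H => ?; exact: cvg_fst.
  by rewrite diff_lin// => ?; exact: cvg_fst.
by apply: (pgrad_diff dl) => h; rewrite mulr1 mulr0 addr0.
Qed.

Lemma pgrad_snd z : pgrad (fun y => y.2) z 0 1.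
Proof.
have dl : is_diff z (snd : R * R -> R) snd.
  have := @linear_differentiable _ _ _ (@snd R R) z.
  move=> H; apply: DiffDef; first by apply: H => ?; exact: cvg_snd.
  by rewrite diff_lin// => ?; exact: cvg_snd.
by apply: (pgrad_diff dl) => h; rewrite mulr1 mulr0 add0r.
Qed.

Lemma pgradD f g z a b a' b' : pgrad f z a b -> pgrad g z a' b' ->
  pgrad (fun y => f y + g y) z (a + a') (b + b').
Proof.
move=> df dg; apply: (pgrad_diff (is_diffD df dg)) => h.
rewrite !fctE; ring.
Qed.

Lemma pgradN f z a b : pgrad f z a b -> pgrad (fun y => - f y) z (- a) (- b).
Proof.
move=> df; apply: (pgrad_diff (is_diffN df)) => h.
rewrite !fctE; ring.
Qed.

Lemma pgradM f g z a b a' b' : pgrad f z a b -> pgrad g z a' b' ->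
  pgrad (fun y => f y * g y) z (a * g z + f z * a') (b * g z + f z * b').
Proof.
move=> df dg; apply: (pgrad_diff (is_diffM df dg)) => h.
rewrite !fctE /GRing.scale/=; ring.
Qed.

Lemma pgrad_comp1 (g : R -> R) f z a b dg :
  pgrad f z a b -> has_derive1 (f z) g dg ->
  pgrad (fun y => g (f y)) z (a * dg) (b * dg).
Proof.
move=> df /is_derive_is_diff dgz.
apply: (pgrad_diff (is_diff_comp df dgz)) => h; rewrite /=; ring.
Qed.

Lemma pgradX f z a b : pgrad f z a b ->
  pgrad (fun y => f y ^+ 2) z (2 * f z * a) (2 * f z * b).
Proof. by move=> df; apply: (pgrad_eq (pgradM df df)); ring. Qed.

Lemma pgradV f z a b : f z != 0 -> pgrad f z a b ->
  pgrad (fun y => (f y)^-1) z (- a / f z ^+ 2) (- b / f z ^+ 2).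
Proof.
move=> f0 df; apply: pgrad_eq.
  apply: (@pgrad_comp1 (fun x => x^-1) _ _ _ _ _ df).
  exact: has_derive1_inv.
all: by rewrite mulrN mulNr.
Qed.

Lemma pgrad_exp f z a b : pgrad f z a b ->
  pgrad (fun y => expR (f y)) z (a * expR (f z)) (b * expR (f z)).
Proof. by move=> df; apply: (pgrad_comp1 df); exact: is_derive_expR. Qed.

Lemma pgrad_ln f z a b : 0 < f z -> pgrad f z a b ->
  pgrad (fun y => ln (f y)) z (a / f z) (b / f z).
Proof. by move=> f0 df; apply: (pgrad_comp1 df); exact: is_derive1_ln. Qed.

Lemma pgrad_comp w (P Q : R * R -> R) z a b a1 b1 a2 b2 :
  pgrad w (P z, Q z) a b -> pgrad P z a1 b1 -> pgrad Q z a2 b2 ->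
  pgrad (fun y => w (P y, Q y)) z (a1 * a + a2 * b) (b1 * a + b2 * b).
Proof.
move=> dw dP dQ.
apply: (pgrad_diff (@is_diff_comp _ _ _ _ (fun y => (P y, Q y)) _ w _ z
  (is_diff_pair dP dQ) dw)) => h /=; ring.
Qed.

Lemma pgrad_curve w (P Q : R -> R) (t a b p q : R) :
  pgrad w (P t, Q t) a b -> has_derive1 t P p -> has_derive1 t Q q ->
  has_derive1 t (fun t => w (P t, Q t)) (p * a + q * b).
Proof.
move=> dw /is_derive_is_diff dP /is_derive_is_diff dQ.
have := @is_diff_comp _ _ _ _ (fun y => (P y, Q y)) _ w _ t
  (is_diff_pair dP dQ) dw.
case=> dd E; apply: DeriveDef; first by apply/derivable1_diffP.
by rewrite deriveE// E /= !mul1r.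
Qed.

End PlaneGradient.

Section DeriveRules.
Context {R : realType}.
Implicit Types (f g : R -> R) (t a b : R).

Lemma has_derive1_eq f t a b : has_derive1 t f a -> a = b -> has_derive1 t f b.
Proof. by move=> ? <-. Qed.

Lemma has_derive1_id t : has_derive1 t (fun t => t) 1.
Proof. exact: is_derive_id. Qed.

Lemma has_derive1_cst c t : has_derive1 t (fun=> c) 0.
Proof. exact: is_derive_cst. Qed.

Lemma has_derive1D f g t a b : has_derive1 t f a -> has_derive1 t g b ->
  has_derive1 t (fun t => f t + g t) (a + b).
Proof. by move=> df dg; exact: (is_deriveD df dg). Qed.

Lemma has_derive1N f t a : has_derive1 t f a ->
  has_derive1 t (fun t => - f t) (- a).
Proof. by move=> df; exact: (is_deriveN df). Qed.

Lemma has_derive1M f g t a b : has_derive1 t f a -> has_derive1 t g b ->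
  has_derive1 t (fun t => f t * g t) (a * g t + f t * b).
Proof.
move=> df dg; apply: (has_derive1_eq (is_deriveM df dg)).
by rewrite /GRing.scale/=; ring.
Qed.

Lemma has_derive1X f t a : has_derive1 t f a ->
  has_derive1 t (fun t => f t ^+ 2) (2 * f t * a).
Proof. by move=> df; apply: (has_derive1_eq (has_derive1M df df)); ring. Qed.

Lemma has_derive1_comp (h : R -> R) f t a dh :
  has_derive1 t f a -> has_derive1 (f t) h dh ->
  has_derive1 t (fun t => h (f t)) (a * dh).
Proof.
move=> df dg; apply: (has_derive1_eq (@is_derive1_comp _ h f t _ _ dg df)).
by rewrite mulrC.
Qed.

Lemma has_derive1V f t a : f t != 0 -> has_derive1 t f a ->
  has_derive1 t (fun t => (f t)^-1) (- a / f t ^+ 2).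
Proof.
move=> f0 df; apply: (has_derive1_eq (has_derive1_comp df (has_derive1_inv f0))).
by rewrite mulrN mulNr.
Qed.

Lemma has_derive1_exp f t a : has_derive1 t f a ->
  has_derive1 t (fun t => expR (f t)) (a * expR (f t)).
Proof. by move=> df; apply: (has_derive1_comp df); exact: is_derive_expR. Qed.

Lemma has_derive1_cos f t a : has_derive1 t f a ->
  has_derive1 t (fun t => cos (f t)) (a * - sin (f t)).
Proof. by move=> df; apply: (has_derive1_comp df); exact: is_derive_cos. Qed.

Lemma has_derive1_sin f t a : has_derive1 t f a ->
  has_derive1 t (fun t => sin (f t)) (a * cos (f t)).
Proof. by move=> df; apply: (has_derive1_comp df); exact: is_derive_sin. Qed.

Lemma has_derive1_sqrt f t a : 0 < f t -> has_derive1 t f a ->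
  has_derive1 t (fun t => Num.sqrt (f t)) (a * (2 * Num.sqrt (f t))^-1).
Proof.
by move=> f0 df; apply: (has_derive1_comp df); exact: is_derive1_sqrt.
Qed.

End DeriveRules.

Section ContinuityRules.
Context {R : realType} {T : topologicalType}.
Implicit Types (f g : T -> R) (z : T).

Lemma cont_cst (c : R) z : continuous_at z (fun=> c).
Proof. exact: cst_continuous. Qed.

Lemma contD f g z : continuous_at z f -> continuous_at z g ->
  continuous_at z (fun y => f y + g y).
Proof. by move=> cf cg; exact: cvgD. Qed.

Lemma contN f z : continuous_at z f -> continuous_at z (fun y => - f y).
Proof. by move=> cf; exact: cvgN. Qed.

Lemma contM f g z : continuous_at z f -> continuous_at z g ->
  continuous_at z (fun y => f y * g y).
Proof. by move=> cf cg; exact: cvgM. Qed.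

Lemma contX f z : continuous_at z f ->
  continuous_at z (fun y => f y ^+ 2).
Proof. by move=> cf; exact: (contM cf cf). Qed.

Lemma contV f z : f z != 0 -> continuous_at z f ->
  continuous_at z (fun y => (f y)^-1).
Proof. by move=> f0 cf; exact: cvgV. Qed.

Lemma cont_comp1 (g : R -> R) f z :
  continuous_at z f -> continuous_at (f z) g ->
  continuous_at z (fun y => g (f y)).
Proof. by move=> cf cg; exact: continuous_comp. Qed.

Lemma cont_exp f z : continuous_at z f ->
  continuous_at z (fun y => expR (f y)).
Proof. by move=> cf; apply: cont_comp1 => //; exact: continuous_expR. Qed.

Lemma cont_comp2 (w : R * R -> R) (f g : T -> R) z :
  continuous_at z f -> continuous_at z g ->
  continuous_at (f z, g z) w ->
  continuous_at z (fun y => w (f y, g y)).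
Proof.
move=> cf cg cw; apply: (@continuous_comp _ _ _ (fun y => (f y, g y)) w) => //.
exact: (cvg_pair cf cg).
Qed.

End ContinuityRules.

Lemma cont_snd_fst {R : realType} (y : R * (R * R)) :
  continuous_at y (fun y : R * (R * R) => y.2.1).
Proof.
by apply: (@continuous_comp _ _ _ snd fst); [exact: cvg_snd|exact: cvg_fst].
Qed.

Lemma cont_snd_snd {R : realType} (y : R * (R * R)) :
  continuous_at y (fun y : R * (R * R) => y.2.2).
Proof.
by apply: (@continuous_comp _ _ _ snd snd); [exact: cvg_snd|exact: cvg_snd].
Qed.

(** * Syntax-directed computation of gradients, derivatives and continuity *)

Ltac pgrad_tac :=
  lazymatch goal with
  | |- pgrad (fun y => @?F y + @?G y) ?z _ _ =>
      apply: (@pgradD _ F G z); pgrad_tac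
  | |- pgrad (fun y => - @?F y) ?z _ _ => apply: (@pgradN _ F z); pgrad_tac
  | |- pgrad (fun y => @?F y * @?G y) ?z _ _ =>
      apply: (@pgradM _ F G z); pgrad_tac
  | |- pgrad (fun y => @?F y ^+ 2) ?z _ _ => apply: (@pgradX _ F z); pgrad_tac
  | |- pgrad (fun y => (@?F y)^-1) ?z _ _ =>
      apply: (@pgradV _ F z); [try eassumption|pgrad_tac]
  | |- pgrad (fun y => expR (@?F y)) ?z _ _ =>
      apply: (@pgrad_exp _ F z); pgrad_tac
  | |- pgrad (fun y => ln (@?F y)) ?z _ _ =>
      apply: (@pgrad_ln _ F z); [try eassumption|pgrad_tac]
  | |- pgrad (fun y => ?w (@?F y, @?G y)) ?z _ _ =>
      apply: (@pgrad_comp _ w F G z); [try eassumption|pgrad_tac|pgrad_tac]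
  | |- pgrad _ _ _ _ => first [
        match goal with
        | H : pgrad ?f ?z _ _ |- pgrad ?f ?z _ _ => exact: H
        | H : pgrad ?f ?z _ _ |- pgrad (fun y => ?f y) ?z _ _ => exact: H
        end
      | apply: pgrad_fst | apply: pgrad_snd | apply: pgrad_cst
      | eassumption | idtac]
  end.

Ltac der_tac :=
  lazymatch goal with
  | |- has_derive1 ?z (fun y => @?F y + @?G y) _ =>
      apply: (@has_derive1D _ F G z); der_tac
  | |- has_derive1 ?z (fun y => - @?F y) _ =>
      apply: (@has_derive1N _ F z); der_tac
  | |- has_derive1 ?z (fun y => @?F y * @?G y) _ =>
      apply: (@has_derive1M _ F G z); der_tac
  | |- has_derive1 ?z (fun y => @?F y ^+ 2) _ =>
      apply: (@has_derive1X _ F z); der_tac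
  | |- has_derive1 ?z (fun y => (@?F y)^-1) _ =>
      apply: (@has_derive1V _ F z); [try eassumption|der_tac]
  | |- has_derive1 ?z (fun y => expR (@?F y)) _ =>
      apply: (@has_derive1_exp _ F z); der_tac
  | |- has_derive1 ?z (fun y => cos (@?F y)) _ =>
      apply: (@has_derive1_cos _ F z); der_tac
  | |- has_derive1 ?z (fun y => sin (@?F y)) _ =>
      apply: (@has_derive1_sin _ F z); der_tac
  | |- has_derive1 ?z (fun y => Num.sqrt (@?F y)) _ =>
      apply: (@has_derive1_sqrt _ F z); [try eassumption|der_tac]
  | |- has_derive1 ?z (fun y => ?w (@?F y, @?G y)) _ =>
      apply: (@pgrad_curve _ w F G z); [try eassumption|der_tac|der_tac]
  | |- has_derive1 _ _ _ => first [
        match goal with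
        | H : has_derive1 ?z ?f _ |- has_derive1 ?z ?f _ => exact: H
        | H : has_derive1 ?z ?f _ |- has_derive1 ?z (fun y => ?f y) _ => exact: H
        end
      | eassumption | apply: has_derive1_id
      | apply: has_derive1_cst | apply: is_derive_cos | apply: is_derive_sin | idtac]
  end.

(** Hypotheses are tried before the syntactic rules, so a compound function whose continuity is in
    the context is not taken apart. *)
Ltac cont_rec :=
  first [
    match goal with
    | H : continuous_at ?z ?f |- continuous_at ?z ?f => exact: H
    | H : continuous_at ?z ?f |- continuous_at ?z (fun y => ?f y) => exact: H
    end |
  lazymatch goal with
  | |- continuous_at ?z (fun y => @?F y + @?G y) =>
      apply: (@contD _ _ F G z); cont_rec
  | |- continuous_at ?z (fun y => - @?F y) =>
      apply: (@contN _ _ F z); cont_rec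
  | |- continuous_at ?z (fun y => @?F y * @?G y) =>
      apply: (@contM _ _ F G z); cont_rec
  | |- continuous_at ?z (fun y => @?F y ^+ 2) =>
      apply: (@contX _ _ F z); cont_rec
  | |- continuous_at ?z (fun y => (@?F y)^-1) =>
      apply: (@contV _ _ F z); [try eassumption|cont_rec]
  | |- continuous_at ?z (fun y => expR (@?F y)) =>
      apply: (@cont_exp _ _ F z); cont_rec
  | |- continuous_at ?z (fun y => cos (@?F y)) =>
      apply: (@cont_comp1 _ _ cos F z); [cont_rec|exact: continuous_cos]
  | |- continuous_at ?z (fun y => sin (@?F y)) =>
      apply: (@cont_comp1 _ _ sin F z); [cont_rec|exact: continuous_sin]
  | |- continuous_at ?z (fun y => ?w (@?F y, @?G y)) =>
      apply: (@cont_comp2 _ _ w F G z); [cont_rec|cont_rec|try eassumption]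
  | |- continuous_at _ _ => first [exact: cont_cst
      | exact: cvg_id | exact: cvg_fst | exact: cvg_snd
      | exact: cont_snd_fst | exact: cont_snd_snd
      | exact: continuous_cos | exact: continuous_sin | eassumption | idtac]
  end].

Ltac cont_tac := rewrite ?/prop_for; cont_rec.

(** * Integrals over the disc and the circle, and Cauchy-Schwarz *)

Section Integrals.
Context {R : realType}.
Implicit Types (w f g : R * R -> R).

Local Notation leb1 := (@lebesgue_measure R).
Local Notation leb2 := (@lebesgue_measure R \x @lebesgue_measure R)%E.

(** Continuity in the plane at each point of the closed disc, stronger than relative continuity; it
    suits integrands that extend regularly across the circle. *)
Definition cont_cdisc w : Prop := forall z, cdisc z -> {for z, continuous w}.
Definition cont_circle w : Prop := continuous (fun t : R => w (circle_pt t)).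

Lemma cont_cdisc_circle w : cont_cdisc w -> cont_circle w.
Proof.
move=> cw t; have := cw _ (circle_cdisc (circle_ptP t)); rewrite /circle_pt => ct.
change (continuous_at t (fun t => w (cos t, sin t))).
by cont_tac.
Qed.

Lemma measure_disc_lty : (leb2 (@disc R) < +oo)%E.
Proof.
have sub : @disc R `<=` `[-1, 1] `*` `[-1, 1].
  move=> z /disc_cdisc /cdiscP z1.
  by split; rewrite /= in_itv/= -ler_norml -[X in _ <= X]sqrtr1 -sqrtr_sqr ler_sqrt//;
    apply: le_trans z1; rewrite ?lerDl ?lerDr sqr_ge0.
pose Q : set (R * R) := `[-1, 1] `*` `[-1, 1].
have le : (leb2 disc <= leb2 Q)%E.
  apply: (@le_measure _ _ _ leb2 _ _ _ _ sub); rewrite inE.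
  - exact: measurable_disc.
  - by apply: measurableX; exact: measurable_itv.
apply: le_lt_trans le _.
by rewrite /Q product_measure1E//= lebesgue_measure_itv /= lte_fin; case: ifP => _;
  rewrite -?EFinD -?EFinM ?mul0e ltry.
Qed.

Lemma integrable_bounded_disc (w : R * R -> R) (M : R) :
  measurable_fun disc w -> (forall z, disc z -> `|w z| <= M) ->
  leb2.-integrable disc (EFin \o w).
Proof.
move=> mw wM; apply: measurable_bounded_integrable => //.
- exact: measurable_disc.
- exact: measure_disc_lty.
exists M; split; first exact: num_real.
by move=> x Mx y /wM wy; apply: le_trans wy (ltW _).
Qed.

Lemma integrable_disc w : cont_cdisc w -> leb2.-integrable disc (EFin \o w).
Proof.
move=> cw; have [M wM] := compact_continuous_bounded compact_cdisc cw.
apply: (@integrable_bounded_disc _ M).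
  apply: continuous_measurable_plane; first exact: open_disc.
  by move=> z /disc_cdisc; exact: cw.
by move=> z /disc_cdisc; exact: wM.
Qed.

Lemma integrable_circle w : cont_circle w ->
  leb1.-integrable `[0, 2 * pi] (EFin \o (fun t => w (circle_pt t))).
Proof.
move=> cw; apply: continuous_compact_integrable; first exact: segment_compact.
exact: continuous_subspaceT.
Qed.

Lemma eq_int_disc f g : (forall z, disc z -> f z = g z) ->
  int_disc f = int_disc g.
Proof. by move=> fg; apply: eq_Rintegral => z; rewrite inE; exact: fg. Qed.

Lemma eq_int_circle f g : (forall z, circle z -> f z = g z) ->
  int_circle f = int_circle g.
Proof. by move=> fg; apply: eq_Rintegral => t _; exact/fg/circle_ptP. Qed.

Lemma int_discD f g : cont_cdisc f -> cont_cdisc g ->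
  int_disc (fun z => f z + g z) = int_disc f + int_disc g.
Proof.
move=> cf cg; apply: RintegralD; first exact: measurable_disc.
  exact: integrable_disc.
exact: integrable_disc.
Qed.

Lemma int_discZ (c : R) f : cont_cdisc f ->
  int_disc (fun z => c * f z) = c * int_disc f.
Proof.
move=> cf; apply: RintegralZl; first exact: measurable_disc.
exact: integrable_disc.
Qed.

Lemma le_int_disc f g : cont_cdisc f -> cont_cdisc g ->
  (forall z, disc z -> f z <= g z) -> int_disc f <= int_disc g.
Proof.
move=> cf cg fg; apply: le_Rintegral => //; first exact: measurable_disc.
  exact: integrable_disc.
exact: integrable_disc.
Qed.

Lemma int_disc_ge0 f : (forall z, disc z -> 0 <= f z) -> 0 <= int_disc f.
Proof. by move=> f0; apply: Rintegral_ge0. Qed.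

Lemma int_circleD f g : cont_circle f -> cont_circle g ->
  int_circle (fun z => f z + g z) = int_circle f + int_circle g.
Proof.
by move=> cf cg; apply: RintegralD => //; exact: integrable_circle.
Qed.

Lemma int_circleB f g : cont_circle f -> cont_circle g ->
  int_circle (fun z => f z - g z) = int_circle f - int_circle g.
Proof.
by move=> cf cg; apply: RintegralB => //; exact: integrable_circle.
Qed.

Lemma int_circleZ (c : R) f : cont_circle f ->
  int_circle (fun z => c * f z) = c * int_circle f.
Proof.
by move=> cf; apply: RintegralZl => //; exact: integrable_circle.
Qed.

Lemma le_int_circle f g : cont_circle f -> cont_circle g ->
  (forall z, circle z -> f z <= g z) -> int_circle f <= int_circle g.
Proof.
move=> cf cg fg; apply: le_Rintegral => //; do 1? exact: integrable_circle.
by move=> t _; exact/fg/circle_ptP.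
Qed.

Lemma int_circle_ge0 f : (forall z, circle z -> 0 <= f z) -> 0 <= int_circle f.
Proof. by move=> f0; apply: Rintegral_ge0 => t _; exact/f0/circle_ptP. Qed.

(** The discriminant step of Cauchy-Schwarz, applied below to the integral of [(f + s g) ^ 2]. *)
Lemma quadratic_ge0_discriminant (a b c : R) : 0 <= c ->
  (forall s, 0 <= a + s * (2 * b) + s ^+ 2 * c) -> b ^+ 2 <= a * c.
Proof.
move=> c0 q; have [cz|cn0] := eqVneq c 0.
  have [->|bn0] := eqVneq b 0; first by rewrite cz expr2 !mulr0.
  (* At this [s] the affine function [a + 2 b s] takes the value [- 1]. *)
  have := q (- (a + 1) / (2 * b)); rewrite cz mulr0 addr0.
  rewrite divfK ?mulf_neq0// opprD addrA subrr add0r.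
  by rewrite oppr_ge0 ler10.
have cp : 0 < c by rewrite lt_def cn0.
(* The minimiser of the quadratic. *)
have := q (- b / c); rewrite -(pmulr_lge0 _ cp).
have -> : (a + - b / c * (2 * b) + (- b / c) ^+ 2 * c) * c = a * c - b ^+ 2.
  by field.
by rewrite subr_ge0.
Qed.

Lemma int_disc_CauchySchwarz f g : cont_cdisc f -> cont_cdisc g ->
  int_disc (fun z => f z * g z) ^+ 2
  <= int_disc (fun z => f z ^+ 2) * int_disc (fun z => g z ^+ 2).
Proof.
move=> cf cg; apply: quadratic_ge0_discriminant.
  by apply: int_disc_ge0 => z _; exact: sqr_ge0.
move=> s.
have E : int_disc (fun z => f z ^+ 2) + s * (2 * int_disc (fun z => f z * g z))
    + s ^+ 2 * int_disc (fun z => g z ^+ 2)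
    = int_disc (fun z => (f z + s * g z) ^+ 2).
{ rewrite mulrA -!int_discZ -?int_discD.
    by apply: eq_int_disc => z _; ring.
  all: by move=> z cz; have := cf z cz; have := cg z cz; move=> ? ?; cont_tac. }
by rewrite E; apply: int_disc_ge0 => z _; exact: sqr_ge0.
Qed.

Lemma int_circle_CauchySchwarz f g : cont_circle f -> cont_circle g ->
  int_circle (fun z => f z * g z) ^+ 2
  <= int_circle (fun z => f z ^+ 2) * int_circle (fun z => g z ^+ 2).
Proof.
move=> cf cg; apply: quadratic_ge0_discriminant.
  by apply: int_circle_ge0 => z _; exact: sqr_ge0.
move=> s.
have E : int_circle (fun z => f z ^+ 2) + s * (2 * int_circle (fun z => f z * g z))
    + s ^+ 2 * int_circle (fun z => g z ^+ 2)
    = int_circle (fun z => (f z + s * g z) ^+ 2).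
{ rewrite mulrA -!int_circleZ -?int_circleD.
    by apply: eq_int_circle => z _; ring.
  all: by move=> z; have := cf z; have := cg z; move=> ? ?; cont_tac. }
by rewrite E; apply: int_circle_ge0 => z _; exact: sqr_ge0.
Qed.

End Integrals.

(** * The divergence theorem on the disc *)

Section Divergence.
Context {R : realType}.
Implicit Types (w A B G : R * R -> R) (g P : R -> R).

Local Notation leb1 := (@lebesgue_measure R).
Local Notation leb2 := (@lebesgue_measure R \x @lebesgue_measure R)%E.

Lemma has_derive1_continuous g (x a : R) : has_derive1 x g a ->
  continuous_at x g.
Proof.
by case=> /derivable1_diffP dg _; exact: differentiable_continuous.
Qed.

Lemma continuous_at_within g (c d : R) :
  (forall x, c <= x <= d -> continuous_at x g) ->
  {within `[c, d], continuous g}.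
Proof.
move=> cg; apply: continuous_in_subspaceT => x; rewrite inE /= in_itv/=.
exact: cg.
Qed.

Lemma continuous_measurable_itvoo g (c d : R) :
  (forall x, c < x < d -> continuous_at x g) ->
  measurable_fun `]c, d[ (EFin \o g).
Proof.
move=> cg; apply/measurable_EFinP; apply: open_continuous_measurable_fun.
  exact: interval_open.
by move=> x; rewrite inE/= in_itv/=; exact: cg.
Qed.

Lemma Rintegral_FTC g P (c d : R) : c <= d ->
  (forall x, c <= x <= d -> has_derive1 x P (g x)) ->
  (forall x, c <= x <= d -> continuous_at x g) ->
  \int[leb1]_(x in `[c, d]) g x = P d - P c.
Proof.
rewrite le_eqVlt => /predU1P[<- _ _|cd dP cg].
  by rewrite set_itv1 Rintegral_set1 subrr.
have cP x : c <= x <= d -> continuous_at x P.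
  by move=> /dP; exact: has_derive1_continuous.
rewrite /Rintegral (@continuous_FTC2 _ g P c d)//.
- exact: continuous_at_within.
- split.
  + move=> x; rewrite in_itv/= => /andP[cx xd].
    by have [] := dP x; rewrite ?(ltW cx) ?(ltW xd).
  + by apply: cvg_at_right_filter; apply: cP; rewrite lexx ltW.
  + by apply: cvg_at_left_filter; apply: cP; rewrite lexx ltW.
- move=> x; rewrite in_itv/= => /andP[cx xd].
  have xcd : c <= x <= d by rewrite (ltW cx) (ltW xd).
  by have [_] := dP x xcd; rewrite derive1E.
Qed.

(** The derivative is two-sided, hence available only beyond the base point. Later uses take
    [a = - (2 * pi)], to the left of every interval of integration. *)
Lemma primitive_exists g (a : R) : continuous g ->
  exists P, forall x, a < x -> has_derive1 x P (g x).
Proof.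
move=> cg; exists (fun x => \int[leb1]_(t in `[a, x]) g t) => x ax.
have ig : leb1.-integrable `[a, x + 1] (EFin \o g).
  apply: continuous_compact_integrable; first exact: segment_compact.
  exact: continuous_subspaceT.
have xx1 : x < x + 1 by rewrite ltrDl.
have [dP PE] := continuous_FTC1_closed xx1 ig ax (cg x).
by apply: DeriveDef; [exact: dP|rewrite -derive1E].
Qed.

(** [P (t + T) - P t] has derivative zero by periodicity. This allows a full turn of the circle to
    start at any angle. *)
Lemma primitive_period g P (T a x y : R) : 0 <= T -> continuous g ->
  (forall t, g (t + T) = g t) -> (forall t, a < t -> has_derive1 t P (g t)) ->
  a < x -> a < y -> P (x + T) - P x = P (y + T) - P y.
Proof.
move=> T0 cg gT dP; wlog xy : x y / x <= y.
  by move=> H ax ay; have [/H->//|/ltW/H->//] := leP x y.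
move=> ax ay; have := @Rintegral_FTC (fun=> 0) (fun t => P (t + T) - P t) _ _ xy.
rewrite Rintegral_cst// mul0r => /(_ _ _)/esym/eqP; rewrite subr_eq0 => H.
apply/esym/eqP; apply: H => t /andP[xt ty]; last exact: cst_continuous.
have at_ : a < t := lt_le_trans ax xt.
have d1 := dP t at_.
have d2 : has_derive1 (t + T) P (g t).
  by rewrite -(gT t); apply: dP; apply: (lt_le_trans at_); rewrite lerDl.
rewrite (_ : 0 = (1 + 0) * g t + - g t); last by ring.
apply: has_derive1D; last exact: has_derive1N.
by apply: (@has_derive1_comp _ P (fun t => t + T)); [der_tac|exact: d2].
Qed.

Lemma circle_pt_2pi : @circle_pt R (2 * pi) = circle_pt 0.
Proof. by rewrite /circle_pt mulr_natl cos2pi sin2pi cos0 sin0. Qed.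

Lemma circle_ptD2pi (t : R) : circle_pt (t + 2 * pi) = circle_pt t.
Proof. by rewrite /circle_pt mulr_natl cosD2pi sinD2pi. Qed.

Lemma two_pi_ge0 : 0 <= 2 * pi :> R.
Proof. by rewrite mulr_ge0// pi_ge0. Qed.

Lemma int_circle_primitive w P : cont_circle w ->
  (forall t, 0 <= t <= 2 * pi -> has_derive1 t P (w (circle_pt t))) ->
  int_circle w = P (2 * pi) - P 0.
Proof.
by move=> cw dP; apply: Rintegral_FTC => //; exact: two_pi_ge0.
Qed.

(** Plays the role of integration by parts on the circle: later boundary identities are settled by
    exhibiting the function [G] whose angular derivative is the integrand. *)
Lemma int_circle_derive w G : cont_circle w ->
  (forall t : R, has_derive1 t (fun t : R => G (circle_pt t)) (w (circle_pt t))) ->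
  int_circle w = 0.
Proof.
move=> cw dG; rewrite (@int_circle_primitive _ (fun t => G (circle_pt t)))//.
by rewrite circle_pt_2pi subrr.
Qed.

(** Reflection in the diagonal is [t |-> pi / 2 - t] on angles. It moves the interval to
    [[- 3 pi / 2, pi / 2]], and periodicity of the integral moves it back. *)
Lemma int_circle_swap w : cont_circle w ->
  int_circle (fun z => w (z.2, z.1)) = int_circle w.
Proof.
move=> cw; have [P dP] := primitive_exists (- (2 * pi)) cw.
have p0 : 0 < pi :> R := pi_gt0 R.
have swapE (t : R) : ((circle_pt t).2, (circle_pt t).1) = circle_pt (pi / 2 - t).
  rewrite /circle_pt /=; congr pair; last by rewrite sinB sin_pihalf cos_pihalf; ring.
  by rewrite cosB sin_pihalf cos_pihalf; ring.
rewrite (@int_circle_primitive w P)//; last first.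
  by move=> t /andP[t0 _]; apply: dP; lra.
rewrite (@int_circle_primitive _ (fun t => - P (pi / 2 - t))).
- have := @primitive_period _ _ (2 * pi) (- (2 * pi)) (pi / 2 - 2 * pi) 0
    two_pi_ge0 cw _ dP.
  rewrite add0r subrK subr0 => <-; [ring| |lra|lra].
  by move=> t; rewrite circle_ptD2pi.
- move=> t; rewrite /continuous_at swapE.
  under eq_fun do rewrite swapE.
  apply: (@continuous_comp _ _ _ (fun t : R => pi / 2 - t) (fun t => w (circle_pt t))).
    by change (continuous_at t (fun t : R => pi / 2 - t)); cont_tac.
  exact: cw.
- move=> t /andP[t0 t1]; rewrite swapE.
  have dt : has_derive1 (pi / 2 - t) P (w (circle_pt (pi / 2 - t))).
    by apply: dP; lra.
  apply: has_derive1_eq.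
    apply: has_derive1N; apply: (@has_derive1_comp _ P (fun t : R => pi / 2 - t)); last exact: dt.
    by der_tac.
  by ring.
Qed.

Lemma sqrt_oneB_sqr_sin (t : R) : - (pi / 2) <= t <= pi / 2 ->
  Num.sqrt (1 - sin t ^+ 2) = cos t.
Proof.
by move=> h; rewrite -cos2sin2 sqrtr_sqr ger0_norm// cos_ge0_pihalf.
Qed.

Lemma continuous_sqrt_oneB_sqr (y : R) :
  continuous_at y (fun y : R => Num.sqrt (1 - y ^+ 2)).
Proof.
apply: (@cont_comp1 R R Num.sqrt (fun y : R => 1 - y ^+ 2)); last exact: sqrt_continuous.
by change (continuous_at y (fun y : R => 1 - y ^+ 2)); cont_tac.
Qed.

Lemma chord_cdisc (x y : R) : `|y| <= 1 -> `|x| <= Num.sqrt (1 - y ^+ 2) ->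
  cdisc (x, y).
Proof.
move=> y1 xs; apply/cdiscP => /=; rewrite -lerBrDr -real_normK ?num_real//.
rewrite -[leRHS]sqr_sqrtr ?ler_sqr ?nnegrE ?sqrtr_ge0//.
by rewrite subr_ge0 -real_normK ?num_real// expr_le1.
Qed.

Lemma disc_chord (x y : R) :
  disc (x, y) <-> `|y| < 1 /\ `|x| < Num.sqrt (1 - y ^+ 2).
Proof.
split=> [/discP/= xy|[y1 xs]].
  have y1 : `|y| < 1.
    rewrite -[X in _ < X]sqrtr1 -sqrtr_sqr ltr_sqrt//.
    by apply: le_lt_trans xy; rewrite lerDr sqr_ge0.
  by split=> //; rewrite -sqrtr_sqr ltr_sqrt; [lra|have := sqr_ge0 x; lra].
apply/discP => /=; rewrite -ltrBrDr -real_normK ?num_real//.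
rewrite -[ltRHS]sqr_sqrtr ?ltr_sqr ?nnegrE ?sqrtr_ge0//.
by rewrite subr_ge0 -real_normK ?num_real// expr_le1// ltW.
Qed.

(** The inner integral of Fubini: the slice of the disc at height [y] is an open chord, on which
    [A1] has the primitive [A]. *)
Lemma int_chord A1 A A2 (y : R) : `|y| < 1 ->
  (forall z, cdisc z -> pgrad A z (A1 z) (A2 z)) -> cont_cdisc A1 ->
  (\int[leb1]_x ((EFin \o A1) \_ disc) (x, y))%E
  = (A (Num.sqrt (1 - y ^+ 2), y) - A (- Num.sqrt (1 - y ^+ 2), y))%:E.
Proof.
move=> y1 dA cA1; set s := Num.sqrt _.
have s0 : 0 <= s by exact: sqrtr_ge0.
have cdy (x : R) : - s <= x <= s -> cdisc (x, y).
  by rewrite -ler_norml => /chord_cdisc; apply; exact: ltW.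
have cA (x : R) : - s <= x <= s -> continuous_at x (fun x : R => A1 (x, y)).
  by move=> /cdy /cA1 cx; cont_tac.
transitivity (\int[leb1]_(x in `](- s)%R, s[) (A1 (x, y))%:E)%E.
  rewrite [RHS]integral_mkcond; apply: eq_integral => x _.
  rewrite /patch; congr (if _ then _ else _).
  apply/idP/idP; rewrite !inE /= in_itv/= -ltr_norml.
    by case/disc_chord.
  by move=> xs; apply/disc_chord.
have cw : {within `[- s, s], continuous (fun x : R => A1 (x, y))}.
  exact: continuous_at_within.
rewrite -(@integral_itv_bndoo _ _ _ _ true false); last first.
  apply: continuous_measurable_itvoo.
  by move=> x /andP[/ltW a /ltW b]; apply: cA; rewrite a b.
have -> : A (s, y) - A (- s, y) = \int[leb1]_(x in `[- s, s]) A1 (x, y).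
  rewrite (@Rintegral_FTC _ (fun x => A (x, y)))//; first by rewrite ge0_cp.
  move=> x xs; have d := dA _ (cdy x xs).
  apply: has_derive1_eq; first by der_tac.
  by rewrite mul1r mul0r addr0.
rewrite /Rintegral fineK//; apply: integrable_fin_num => //.
by apply: continuous_compact_integrable => //; exact: segment_compact.
Qed.

(** Fubini leaves the integral over [y] of [h], the increment of [A] along the chord. The
    substitution [y = sin t] turns the ends of the chord into points of the circle and [dy] into
    [cos t dt], which is the weight [z.1]. *)
Lemma int_disc_d1 A A1 A2 :
  (forall z, cdisc z -> pgrad A z (A1 z) (A2 z)) -> cont_cdisc A1 ->
  int_disc A1 = int_circle (fun z => A z * z.1).
Proof.
move=> dA cA1; have p0 : 0 < pi :> R := pi_gt0 R.
pose h (y : R) := A (Num.sqrt (1 - y ^+ 2), y) - A (- Num.sqrt (1 - y ^+ 2), y).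
pose w z := A z * z.1.
have cA : cont_cdisc A by move=> z /dA/pgrad_continuous.
have cw : cont_circle w.
  by apply: cont_cdisc_circle => z /cA cz; rewrite /w; cont_tac.
have ch y : `|y| <= 1 -> continuous_at y h.
  move=> y1; have cs := @continuous_sqrt_oneB_sqr y.
  have c1 := cA _ (@chord_cdisc (Num.sqrt (1 - y ^+ 2)) _ y1 _).
  have c2 := cA _ (@chord_cdisc (- Num.sqrt (1 - y ^+ 2)) _ y1 _).
  rewrite /h; cont_tac; [apply: c1|apply: c2];
    by rewrite ?normrN ger0_norm// sqrtr_ge0.
have iA1 : leb2.-integrable setT ((EFin \o A1) \_ disc).
  apply/integrable_restrict => //; first exact: measurable_disc.
  by rewrite setTI; exact: integrable_disc.
have -> : int_disc A1 = \int[leb1]_(y in `[-1, 1]) h y.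
  rewrite /int_disc /Rintegral; congr fine.
  rewrite integral_mkcond -integral21_prod_meas1//.
  rewrite (@integral_itv_bndoo _ _ _ _ true false); last first.
    apply: continuous_measurable_itvoo => y /andP[a b]; apply: ch.
    by rewrite ler_norml !ltW.
  rewrite [RHS]integral_mkcond; apply: eq_integral => y _.
  rewrite [RHS]patchE; case: ifPn; rewrite ?notin_setE ?inE/= in_itv/= -ltr_norml => y1.
    by rewrite /fubini_G (int_chord y1 dA).
  rewrite /fubini_G integral0_eq// => x _; rewrite patchE.
  by case: ifPn => //; rewrite inE => /disc_chord[].
have sub : \int[leb1]_(y in `[-1, 1]) h y
    = \int[leb1]_(t in `[- (pi / 2), pi / 2]) (h (sin t) * cos t).
  have := @integration_by_substitution_increasing _ sin h (- (pi / 2)) (pi / 2).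
  rewrite sinN sin_pihalf /Rintegral => ->.
  - by congr fine; apply: eq_integral => t _ /=; rewrite !fctE derive1E derive_val.
  - lra.
  - by move=> x y xI yI xy; rewrite ltr_sin.
  - have -> : derive1 (@sin R) = cos by apply/funext => t; rewrite derive1E derive_val.
    by move=> t _; exact: continuous_cos.
  - have -> : derive1 (@sin R) = cos by apply/funext => t; rewrite derive1E derive_val.
    by apply: cvgP; apply: cvg_at_right_filter; exact: continuous_cos.
  - have -> : derive1 (@sin R) = cos by apply/funext => t; rewrite derive1E derive_val.
    by apply: cvgP; apply: cvg_at_left_filter; exact: continuous_cos.
  - split; first by move=> t _.
      by apply: cvg_at_right_filter; exact: continuous_sin.
    by apply: cvg_at_left_filter; exact: continuous_sin.
  - by apply: continuous_at_within => y y1; apply: ch; rewrite ler_norml.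
rewrite sub.
have [P dP] := primitive_exists (- (2 * pi)) cw.
(* The right end of the chord has angle [t], the left one [pi - t]; there [z.1 = - cos t], which
   absorbs the minus sign in [h]. *)
have hE (t : R) : - (pi / 2) <= t <= pi / 2 ->
    h (sin t) * cos t = w (circle_pt t) + w (circle_pt (pi - t)).
  move=> tI; rewrite /h sqrt_oneB_sqr_sin// /w /circle_pt /=.
  have -> : cos (pi - t) = - cos t.
    by rewrite -cosN opprB -[in LHS](opprK (cos _)) -cosDpi subrK.
  have -> : sin (pi - t) = sin t.
    by rewrite -[LHS]opprK -sinN opprB -sinDpi subrK.
  by ring.
rewrite (@int_circle_primitive w P)//; last first.
  by move=> t /andP[t0 _]; apply: dP; lra.
transitivity (\int[leb1]_(t in `[- (pi / 2), pi / 2])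
    (w (circle_pt t) + w (circle_pt (pi - t)))).
  by apply: eq_Rintegral => t; rewrite inE /= in_itv/=; exact: hE.
(* The boundary values add up to [P (- pi / 2 + 2 pi) - P (- pi / 2)], one full turn. *)
rewrite (@Rintegral_FTC _ (fun t => P t - P (pi - t))).
- have := @primitive_period _ _ (2 * pi) (- (2 * pi)) (- (pi / 2)) 0
    two_pi_ge0 cw _ dP.
  rewrite add0r => <-; [|by move=> t; rewrite circle_ptD2pi|lra|lra].
  have -> : pi - pi / 2 = pi / 2 :> R by field.
  have -> : pi - - (pi / 2) = - (pi / 2) + 2 * pi :> R by field.
  by ring.
- lra.
- move=> t tI.
  have d0 : has_derive1 t P (w (circle_pt t)) by apply: dP; lra.
  have d2 : has_derive1 (pi - t) P (w (circle_pt (pi - t))) by apply: dP; lra.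
  apply: has_derive1_eq.
    apply: has_derive1D; first exact: d0.
    apply: has_derive1N; apply: (@has_derive1_comp _ P (fun t : R => pi - t)); last exact: d2.
    by der_tac.
  by ring.
- move=> t _; apply: contD; first exact: cw.
  apply: (@cont_comp1 _ _ (fun t => w (circle_pt t)) (fun t : R => pi - t)); last exact: cw.
  by cont_tac.
Qed.

(** Exchanging the coordinates turns one order of iterated integration into the other, and Fubini
    identifies the two. With [int_circle_swap] this yields the [z.2] half of the divergence theorem
    from the [z.1] half. *)
Lemma int_disc_swap w : cont_cdisc w ->
  int_disc (fun z => w (z.2, z.1)) = int_disc w.
Proof.
move=> cw.
have iw : leb2.-integrable setT ((EFin \o w) \_ disc).
  apply/integrable_restrict => //; first exact: measurable_disc.
  by rewrite setTI; exact: integrable_disc.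
have swapd (z : R * R) : disc (z.2, z.1) <-> disc z.
  by split=> /discP /= h; apply/discP; rewrite /= addrC.
have cw' : cont_cdisc (fun z => w (z.2, z.1)).
  move=> z /cdiscP cz; have c : {for (z.2, z.1), continuous w}.
    by apply: cw; apply/cdiscP; rewrite /= addrC.
  by cont_tac.
have iw' : leb2.-integrable setT ((EFin \o (fun z => w (z.2, z.1))) \_ disc).
  apply/integrable_restrict => //; first exact: measurable_disc.
  by rewrite setTI; exact: integrable_disc.
rewrite /int_disc /Rintegral; congr fine.
rewrite integral_mkcond [RHS]integral_mkcond.
apply: etrans (esym (@integral21_prod_meas1 _ _ _ _ _ leb1 leb1 _ iw')) _.
apply: etrans _ (@integral12_prod_meas1 _ _ _ _ _ leb1 leb1 _ iw).
apply: eq_integral => y _; apply: eq_integral => x _.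
rewrite !patchE /=; congr (if _ then _ else _).
by apply/idP/idP; rewrite !inE; have /= := swapd (x, y); tauto.
Qed.

Lemma int_disc_d2 B B1 B2 :
  (forall z, cdisc z -> pgrad B z (B1 z) (B2 z)) -> cont_cdisc B2 ->
  int_disc B2 = int_circle (fun z => B z * z.2).
Proof.
move=> dB cB2.
have swapd (z : R * R) : cdisc z -> cdisc (z.2, z.1).
  by move=> /cdiscP /= h; apply/cdiscP; rewrite /= addrC.
rewrite -int_disc_swap// (@int_disc_d1 (fun z => B (z.2, z.1)) _
  (fun z => B1 (z.2, z.1))).
- rewrite (@int_circle_swap (fun z => B z * z.2))//.
  by apply: cont_cdisc_circle => z /dB/pgrad_continuous cz; cont_tac.
- move=> z /swapd /dB d; apply: pgrad_eq; [by pgrad_tac|ring|ring].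
- by move=> z /swapd /cB2 cz; cont_tac.
Qed.

Lemma divergence_disc A A1 A2 B B1 B2 :
  (forall z, cdisc z -> pgrad A z (A1 z) (A2 z)) ->
  (forall z, cdisc z -> pgrad B z (B1 z) (B2 z)) ->
  cont_cdisc A1 -> cont_cdisc B2 ->
  int_disc (fun z => A1 z + B2 z) = int_circle (fun z => A z * z.1 + B z * z.2).
Proof.
move=> dA dB cA1 cB2; rewrite int_discD// int_circleD.
- by rewrite (int_disc_d1 dA)// (int_disc_d2 dB).
- by apply: cont_cdisc_circle => z /dA/pgrad_continuous cz; cont_tac.
- by apply: cont_cdisc_circle => z /dB/pgrad_continuous cz; cont_tac.
Qed.

End Divergence.

(** * Symmetry of second derivatives *)

Section Schwarz.
Context {R : realType}.
Implicit Types (w : R * R -> R) (g : R -> R).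

Lemma mean_value g (dg : R -> R) (a b : R) : a < b ->
  (forall x, a <= x <= b -> has_derive1 x g (dg x)) ->
  exists2 c, a <= c <= b & g b - g a = dg c * (b - a).
Proof.
move=> ab dgE.
have [||c] := @MVT _ g dg a b ab.
- by move=> x; rewrite in_itv/= => /andP[ax xb]; apply: dgE; rewrite !ltW.
- apply: continuous_at_within => x /dgE; exact: has_derive1_continuous.
- by rewrite in_itv/= => /andP[ac cb] E; exists c => //; rewrite !ltW.
Qed.

(** Two mean value theorems: in the first variable for the increment [w (s, y + h) - w (s, y)], then
    in the second variable for [w1]. *)
Lemma second_difference w w1 w2 w11 w12 (x y h : R) : 0 < h ->
  (forall z : R * R, x <= z.1 <= x + h -> y <= z.2 <= y + h ->
     pgrad w z (w1 z) (w2 z)) ->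
  (forall z : R * R, x <= z.1 <= x + h -> y <= z.2 <= y + h ->
     pgrad w1 z (w11 z) (w12 z)) ->
  exists2 c : R * R, x <= c.1 <= x + h /\ y <= c.2 <= y + h &
    w (x + h, y + h) - w (x + h, y) - (w (x, y + h) - w (x, y)) = w12 c * h * h.
Proof.
move=> h0 dw dw1.
have hx : x < x + h by rewrite ltrDl.
have hy : y < y + h by rewrite ltrDl.
have [|s sI E1] := @mean_value (fun s : R => w (s, y + h) - w (s, y))
    (fun s : R => w1 (s, y + h) - w1 (s, y)) _ _ hx.
  move=> s sI; have d1 := dw (s, y + h); have d2 := dw (s, y).
  have {d1} d1 : pgrad w (s, y + h) (w1 (s, y + h)) (w2 (s, y + h)).
    by apply: d1 => //=; rewrite lexx ltW.
  have {d2} d2 : pgrad w (s, y) (w1 (s, y)) (w2 (s, y)).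
    by apply: d2 => //=; rewrite lexx ltW.
  by apply: has_derive1_eq; [by der_tac|ring].
have [|r rI E2] := @mean_value (fun r : R => w1 (s, r)) (fun r : R => w12 (s, r)) _ _ hy.
  move=> r rI; have d1 := dw1 (s, r) sI rI.
  by apply: has_derive1_eq; [der_tac|ring].
exists (s, r) => //; apply: etrans (etrans E1 _); first by ring.
by rewrite E2; ring.
Qed.

(** The second difference over a small square is symmetric in the variables, so it equals [h ^ 2]
    times [w12] at one point and [h ^ 2] times [w21] at another; continuity lets both points tend to
    [z]. *)
Lemma mixed_partials_eq w w1 w2 w11 w12 w21 w22 (z : R * R) :
  (\forall z' \near z, pgrad w z' (w1 z') (w2 z')) ->
  (\forall z' \near z, pgrad w1 z' (w11 z') (w12 z')) ->
  (\forall z' \near z, pgrad w2 z' (w21 z') (w22 z')) ->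
  {for z, continuous w12} -> {for z, continuous w21} -> w12 z = w21 z.
Proof.
move=> dw dw1 dw2 c12 c21.
apply/eqP; rewrite -subr_eq0 -normr_le0; apply/ler_addgt0Pr => e e0.
have e2 : 0 < e / 2 by rewrite divr_gt0.
have n12 : \forall z' \near z, `|w12 z - w12 z'| <= e / 2.
  by move/cvgrPdist_le : c12; exact.
have n21 : \forall z' \near z, `|w21 z - w21 z'| <= e / 2.
  by move/cvgrPdist_le : c21; exact.
have /nbhs_ballP[d /= d0 H] : \forall z' \near z,
    [/\ pgrad w z' (w1 z') (w2 z'), pgrad w1 z' (w11 z') (w12 z'),
        pgrad w2 z' (w21 z') (w22 z'), `|w12 z - w12 z'| <= e / 2
      & `|w21 z - w21 z'| <= e / 2].
  by near=> z'; split; near: z'.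
(* Halving keeps the closed square of side [h] inside the open ball of radius [d]. *)
pose h := d / 2; have h0 : 0 < h by rewrite divr_gt0.
have hd : h < d by rewrite /h ltr_pdivrMr// mulr_natr mulr2n ltrDl.
clearbody h; case: z {dw dw1 dw2 c12 c21 n12 n21} H => x y H.
have box (c : R * R) : x <= c.1 <= x + h -> y <= c.2 <= y + h ->
    ball (x, y) d c.
  move=> /andP[a1 a2] /andP[b1 b2]; split; rewrite /ball/= /ball_/= ltr_norml;
    apply/andP; split; lra.
have [||c [c1 c2] E1] := @second_difference w w1 w2 w11 w12 x y h h0.
- by move=> c c1 c2; have [] := H c (box c c1 c2).
- by move=> c c1 c2; have [] := H c (box c c1 c2).
have [||c' [c1' c2'] E2] := @second_difference (fun z => w (z.2, z.1))
    (fun z => w2 (z.2, z.1)) (fun z => w1 (z.2, z.1)) (fun z => w22 (z.2, z.1))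
    (fun z => w21 (z.2, z.1)) y x h h0.
- move=> c' a b; have [D _ _ _ _] := H (c'.2, c'.1) (box (c'.2, c'.1) b a).
  by apply: pgrad_eq; [by pgrad_tac|ring|ring].
- move=> c' a b; have [_ _ D _ _] := H (c'.2, c'.1) (box (c'.2, c'.1) b a).
  by apply: pgrad_eq; [by pgrad_tac|ring|ring].
have E : w12 c = w21 (c'.2, c'.1).
  apply: (mulIf (lt0r_neq0 h0)); apply: (mulIf (lt0r_neq0 h0)).
  by rewrite -E1 -E2 /=; ring.
have [_ _ _ A _] := H c (box c c1 c2).
have [_ _ _ _ B] := H (c'.2, c'.1) (box (c'.2, c'.1) c2' c1').
rewrite add0r (splitr e).
have -> : w12 (x, y) - w21 (x, y)
    = (w12 (x, y) - w12 c) - (w21 (x, y) - w21 (c'.2, c'.1)) by rewrite E; ring.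
by apply: (le_trans (ler_normB _ _)); exact: lerD.
Unshelve. all: by end_near. Qed.

End Schwarz.

(** * Smooth representatives near a closed set *)

Section Smoothness.
Context {R : realType}.

(** Unlike [smooth_on], which constrains [w] on [A] only, this concerns [w] itself on a
    neighbourhood, so that two-sided derivatives at boundary points of [A] make sense. *)
Definition smooth_near {V : normedModType R} (A : set V) (w : V -> R) : Prop :=
  exists U : set V, [/\ open U, A `<=` U & smooth_open U w].

Lemma smooth_on_near {V : normedModType R} (A : set V) (w : V -> R) :
  smooth_on A w -> exists2 w', smooth_near A w' & forall z, A z -> w z = w' z.
Proof.
case=> U [w' [oU AU sw ww']]; exists w'; first by exists U.
by move=> z Az; apply: ww'; rewrite inE.
Qed.

Lemma smooth_near_derive {V : normedModType R} (A : set V) (w : V -> R) (e : V) :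
  smooth_near A w -> smooth_near A (fun z => 'D_e w z).
Proof.
case=> U [oU AU sw]; exists U; split => // s z Uz.
by have := sw (rcons s e) z Uz; rewrite /iter_derive foldr_rcons.
Qed.

Lemma smooth_near_pgrad (A : set (R * R)) (w : R * R -> R) z :
  smooth_near A w -> A z -> \forall y \near z, pgrad w y (d1 w y) (d2 w y).
Proof.
case=> U [oU AU sw] Az; have Uz := AU z Az.
apply: filterS (open_nbhs_nbhs (conj oU Uz)) => y Uy.
exact: (differentiable_pgrad (sw [::] y Uy)).
Qed.

Lemma smooth_near_d12 (A : set (R * R)) (w : R * R -> R) z :
  smooth_near A w -> A z -> d2 (d1 w) z = d1 (d2 w) z.
Proof.
move=> sw Az; have s1 := smooth_near_derive ((1, 0) : R * R) sw.
have s2 := smooth_near_derive ((0, 1) : R * R) sw.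
have s12 := smooth_near_derive ((0, 1) : R * R) s1.
have s21 := smooth_near_derive ((1, 0) : R * R) s2.
apply: (@mixed_partials_eq _ w (d1 w) (d2 w) (d1 (d1 w)) _ _ (d2 (d2 w))).
- exact: smooth_near_pgrad sw Az.
- exact: smooth_near_pgrad s1 Az.
- exact: smooth_near_pgrad s2 Az.
- exact: (pgrad_continuous (nbhs_singleton (smooth_near_pgrad s12 Az))).
- exact: (pgrad_continuous (nbhs_singleton (smooth_near_pgrad s21 Az))).
Qed.

(** At a fixed time the iterated derivatives in directions [e] are the space-time ones in directions
    [(0, e)], since their difference quotients coincide. *)
Lemma smooth_near_slice (w : R * (R * R) -> R) (t : R) (A : set (R * R)) :
  smooth_near [set x : R * (R * R) | 0 < x.1 /\ A x.2] w -> 0 < t ->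
  smooth_near A (fun z => w (t, z)).
Proof.
case=> U [oU AU sw] t0; exists (fun z => U (t, z)); split.
- have ct : continuous (fun z : R * R => (t, z)).
    by move=> z; apply: differentiable_continuous; exact: differentiable_pair.
  by apply: (@open_comp _ _ (fun z => (t, z)) U) => // z _; exact: ct.
- by move=> z Az; apply: AU.
have iterE (s : seq (R * R)) z : iter_derive s (fun z => w (t, z)) z
    = iter_derive [seq ((0, e) : R * (R * R)) | e <- s] w (t, z).
  elim: s z => [//|e s ih] z /=.
  rewrite /derive; set F := (X in lim (X @ _) = _); set G := (X in _ = lim (X @ _)).
  suff -> : F = G by [].
  apply/funext => h; rewrite /F /G /= !ih; congr (_ *: (iter_derive _ _ _ - _)).
  by congr pair; rewrite /= scaler0 add0r.
move=> s z Uz.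
rewrite (_ : iter_derive s _ = (iter_derive [seq ((0, e) : R * (R * R)) | e <- s] w)
    \o (fun z => (t, z))); last by apply/funext => y; rewrite iterE.
apply: differentiable_comp; last exact: sw.
by apply: differentiable_pair.
Qed.

End Smoothness.

(** * Conformal fields and the Kazdan-Warner identity *)

Section ConformalField.
Context {R : realType}.
Variables A1 A2 om : R.

(* The real form of [w |-> A + i om w - conj A w^2], the general infinitesimal
   automorphism of the disc; [cf_g] is its angular speed on the circle and
   [cf_q] half its divergence. *)
Definition cf1 (z : R * R) : R :=
  A1 - om * z.2 - A1 * (z.1 ^+ 2 - z.2 ^+ 2) - 2 * A2 * (z.1 * z.2).
Definition cf2 (z : R * R) : R :=
  A2 + om * z.1 - 2 * A1 * (z.1 * z.2) + A2 * (z.1 ^+ 2 - z.2 ^+ 2).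
Definition cf_q (z : R * R) : R := - 2 * (A1 * z.1 + A2 * z.2).
Definition cf_g (z : R * R) : R := om - 2 * A1 * z.2 + 2 * A2 * z.1.

Lemma cf1_circle z : circle z -> cf1 z = - z.2 * cf_g z.
Proof.
move=> /circleP zc; have x2 : z.1 ^+ 2 = 1 - z.2 ^+ 2 by rewrite -zc addrK.
by rewrite /cf1 /cf_g x2; ring.
Qed.

Lemma cf2_circle z : circle z -> cf2 z = z.1 * cf_g z.
Proof.
move=> /circleP zc; have y2 : z.2 ^+ 2 = 1 - z.1 ^+ 2 by rewrite -zc addrC addKr.
by rewrite /cf2 /cf_g y2; ring.
Qed.

Lemma cf1_pgrad z : pgrad cf1 z (cf_q z) (- om + 2 * A1 * z.2 - 2 * A2 * z.1).
Proof. by rewrite /cf1; apply: pgrad_eq; [pgrad_tac|rewrite /cf_q; ring|cbv beta; ring]. Qed.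

Lemma cf2_pgrad z : pgrad cf2 z (om - 2 * A1 * z.2 + 2 * A2 * z.1) (cf_q z).
Proof. by rewrite /cf2; apply: pgrad_eq; [pgrad_tac|cbv beta; ring|rewrite /cf_q; ring]. Qed.

Lemma cf_q_pgrad z : pgrad cf_q z (- 2 * A1) (- 2 * A2).
Proof. by rewrite /cf_q; apply: pgrad_eq; [pgrad_tac|cbv beta; ring|cbv beta; ring]. Qed.

Lemma cf_g_pgrad z : pgrad cf_g z (2 * A2) (- 2 * A1).
Proof. by rewrite /cf_g; apply: pgrad_eq; [pgrad_tac|cbv beta; ring|cbv beta; ring]. Qed.

Lemma has_derive1_circle_pt (G : R * R -> R) (a b t : R) :
  pgrad G (circle_pt t) a b ->
  has_derive1 t (fun t => G (circle_pt t))
    (- (circle_pt t).2 * a + (circle_pt t).1 * b).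
Proof.
rewrite /circle_pt => dG.
by apply: has_derive1_eq; [apply: (pgrad_curve dG); der_tac|rewrite /=; ring].
Qed.

(** The integrand is the divergence of [f expR (2 u)] times the field, whose own divergence is
    [2 cf_q]. The field is tangent to the circle, so there is no flux. *)
Lemma int_disc_cf_f (f f1 f2 u u1 u2 : R * R -> R) :
  (forall z, cdisc z -> pgrad f z (f1 z) (f2 z)) ->
  (forall z, cdisc z -> pgrad u z (u1 z) (u2 z)) ->
  cont_cdisc f1 -> cont_cdisc f2 -> cont_cdisc u1 -> cont_cdisc u2 ->
  int_disc (fun z => (cf1 z * f1 z + cf2 z * f2 z
    + 2 * f z * (cf1 z * u1 z + cf2 z * u2 z + cf_q z)) * expR (2 * u z)) = 0.
Proof.
move=> df du cf1' cf2' cu1 cu2.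
pose E z := expR (2 * u z).
have dE z : cdisc z -> pgrad E z (2 * u1 z * E z) (2 * u2 z * E z).
  by move=> /du d; rewrite /E; apply: pgrad_eq; [pgrad_tac|cbv beta; ring|cbv beta; ring].
have cE z : cdisc z -> continuous_at z E by move=> /dE/pgrad_continuous.
have cf z : cdisc z -> continuous_at z f by move=> /df/pgrad_continuous.
have c1 z : continuous_at z cf1 := pgrad_continuous (cf1_pgrad z).
have c2 z : continuous_at z cf2 := pgrad_continuous (cf2_pgrad z).
have cq z : continuous_at z cf_q := pgrad_continuous (cf_q_pgrad z).
have := @divergence_disc R (fun z => f z * E z * cf1 z)
  (fun z => (f1 z * E z + f z * (2 * u1 z * E z)) * cf1 z + f z * E z * cf_q z)
  (fun z => (f2 z * E z + f z * (2 * u2 z * E z)) * cf1 z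
      + f z * E z * (- om + 2 * A1 * z.2 - 2 * A2 * z.1))
  (fun z => f z * E z * cf2 z)
  (fun z => (f1 z * E z + f z * (2 * u1 z * E z)) * cf2 z
      + f z * E z * (om - 2 * A1 * z.2 + 2 * A2 * z.1))
  (fun z => (f2 z * E z + f z * (2 * u2 z * E z)) * cf2 z + f z * E z * cf_q z).
move=> H; transitivity (int_circle (fun z : R * R => (0 : R) * z.1)).
  transitivity (int_circle (fun z => f z * E z * cf1 z * z.1 + f z * E z * cf2 z * z.2)).
    rewrite -H.
    - by apply: eq_int_disc => z _; rewrite /E; ring.
    - move=> z cz; have d := df z cz; have e := dE z cz; have c := cf1_pgrad z.
      by pgrad_tac.
    - move=> z cz; have d := df z cz; have e := dE z cz; have c := cf2_pgrad z.
      by pgrad_tac.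
    - move=> z cz; have a1 := cf1' z cz; have a2 := cE z cz; have a3 := cf z cz.
      by have a4 := cu1 z cz; have a5 := c1 z; have a6 := cq z; cont_tac.
    - move=> z cz; have a1 := cf2' z cz; have a2 := cE z cz; have a3 := cf z cz.
      by have a4 := cu2 z cz; have a5 := c2 z; have a6 := cq z; cont_tac.
  by apply: eq_int_circle => z cz; rewrite cf1_circle// cf2_circle//; ring.
transitivity (int_circle (fun=> (0 : R))).
  by apply: eq_int_circle => z _; rewrite mul0r.
by rewrite /int_circle Rintegral_cst// mul0r.
Qed.

(** The integrand is the angular derivative of [cf_g j expR u], because that of [cf_g] on the circle
    is [cf_q]. *)
Lemma int_circle_cf_j (j j1 j2 u u1 u2 : R * R -> R) :
  (forall z, circle z -> pgrad j z (j1 z) (j2 z)) ->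
  (forall z, circle z -> pgrad u z (u1 z) (u2 z)) ->
  cont_circle j1 -> cont_circle j2 -> cont_circle u1 -> cont_circle u2 ->
  int_circle (fun z => (cf1 z * j1 z + cf2 z * j2 z
    + j z * (cf1 z * u1 z + cf2 z * u2 z + cf_q z)) * expR (u z)) = 0.
Proof.
move=> dj du cj1 cj2 cu1 cu2.
apply: (@int_circle_derive _ _ (fun z => cf_g z * j z * expR (u z))).
- have cc (w w1 w2 : R * R -> R) :
      (forall z, circle z -> pgrad w z (w1 z) (w2 z)) -> cont_circle w.
    move=> dw t; have := dw _ (circle_ptP t) => /has_derive1_circle_pt.
    exact: has_derive1_continuous.
  move=> t; have a1 := cc _ _ _ dj t; have a2 := cc _ _ _ du t.
  have a3 := cj1 t; have a4 := cj2 t; have a5 := cu1 t; have a6 := cu2 t.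
  have a7 := cc _ _ _ (fun z _ => cf1_pgrad z) t.
  have a8 := cc _ _ _ (fun z _ => cf2_pgrad z) t.
  have a9 := cc _ _ _ (fun z _ => cf_q_pgrad z) t.
  by cont_tac.
- move=> t; have cz := circle_ptP t; have d1 := dj _ cz; have d2 := du _ cz.
  have d3 := cf_g_pgrad (circle_pt t).
  apply: has_derive1_eq.
    by apply: (@has_derive1_circle_pt (fun z => cf_g z * j z * expR (u z))); pgrad_tac.
  by rewrite cf1_circle// cf2_circle// /cf_q /cf_g; ring.
Qed.

(* Pohozaev: the flux of [D grad u - |grad u|^2 e / 2 - u grad q], with [e] the
   field, [q] half its divergence and [D = e . grad u + q].  Its divergence is
   [D laplacian u] because [e] is conformal and [q] harmonic. *)
Lemma int_disc_pohozaev (u u1 u2 u11 u12 u22 : R * R -> R) :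
  (forall z, cdisc z -> pgrad u z (u1 z) (u2 z)) ->
  (forall z, cdisc z -> pgrad u1 z (u11 z) (u12 z)) ->
  (forall z, cdisc z -> pgrad u2 z (u12 z) (u22 z)) ->
  cont_cdisc u11 -> cont_cdisc u12 -> cont_cdisc u22 ->
  int_disc (fun z => (u11 z + u22 z) * (cf1 z * u1 z + cf2 z * u2 z + cf_q z))
  = int_circle (fun z => (z.1 * u1 z + z.2 * u2 z + 1)
      * (cf1 z * u1 z + cf2 z * u2 z + cf_q z)).
Proof.
move=> du du1 du2 c11 c12 c22.
pose D z := cf1 z * u1 z + cf2 z * u2 z + cf_q z.
pose D1 z := cf_q z * u1 z + cf1 z * u11 z
  + ((om - 2 * A1 * z.2 + 2 * A2 * z.1) * u2 z + cf2 z * u12 z) - 2 * A1.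
pose D2 z := (- om + 2 * A1 * z.2 - 2 * A2 * z.1) * u1 z + cf1 z * u12 z
  + (cf_q z * u2 z + cf2 z * u22 z) - 2 * A2.
have dD z : cdisc z -> pgrad D z (D1 z) (D2 z).
  move=> cz; have d1 := du1 z cz; have d2 := du2 z cz.
  have e1 := cf1_pgrad z; have e2 := cf2_pgrad z; have e3 := cf_q_pgrad z.
  by apply: pgrad_eq; [rewrite /D; pgrad_tac|rewrite /D1; ring|rewrite /D2; ring].
pose V1 z := D z * u1 z - 2^-1 * (u1 z ^+ 2 + u2 z ^+ 2) * cf1 z + u z * (2 * A1).
pose V2 z := D z * u2 z - 2^-1 * (u1 z ^+ 2 + u2 z ^+ 2) * cf2 z + u z * (2 * A2).
pose V11 z := D1 z * u1 z + D z * u11 z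
  - ((u1 z * u11 z + u2 z * u12 z) * cf1 z + 2^-1 * (u1 z ^+ 2 + u2 z ^+ 2) * cf_q z)
  + u1 z * (2 * A1).
pose V12 z := D2 z * u1 z + D z * u12 z
  - ((u1 z * u12 z + u2 z * u22 z) * cf1 z + 2^-1 * (u1 z ^+ 2 + u2 z ^+ 2)
      * (- om + 2 * A1 * z.2 - 2 * A2 * z.1)) + u2 z * (2 * A1).
pose V21 z := D1 z * u2 z + D z * u12 z
  - ((u1 z * u11 z + u2 z * u12 z) * cf2 z + 2^-1 * (u1 z ^+ 2 + u2 z ^+ 2)
      * (om - 2 * A1 * z.2 + 2 * A2 * z.1)) + u1 z * (2 * A2).
pose V22 z := D2 z * u2 z + D z * u22 z
  - ((u1 z * u12 z + u2 z * u22 z) * cf2 z + 2^-1 * (u1 z ^+ 2 + u2 z ^+ 2) * cf_q z)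
  + u2 z * (2 * A2).
have cD z : cdisc z -> continuous_at z D by move=> /dD/pgrad_continuous.
have cu1 z : cdisc z -> continuous_at z u1 by move=> /du1/pgrad_continuous.
have cu2 z : cdisc z -> continuous_at z u2 by move=> /du2/pgrad_continuous.
have cc1 z : continuous_at z cf1 := pgrad_continuous (cf1_pgrad z).
have cc2 z : continuous_at z cf2 := pgrad_continuous (cf2_pgrad z).
have ccq z : continuous_at z cf_q := pgrad_continuous (cf_q_pgrad z).
have cD1 z : cdisc z -> continuous_at z D1.
  move=> cz; have a1 := cu1 z cz; have a2 := cu2 z cz; have a3 := c11 z cz.
  have a4 := c12 z cz; have a5 := cc1 z; have a6 := cc2 z; have a7 := ccq z.
  by rewrite /D1; cont_tac.
have cD2 z : cdisc z -> continuous_at z D2.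
  move=> cz; have a1 := cu1 z cz; have a2 := cu2 z cz; have a3 := c22 z cz.
  have a4 := c12 z cz; have a5 := cc1 z; have a6 := cc2 z; have a7 := ccq z.
  by rewrite /D2; cont_tac.
have divV : int_disc (fun z => V11 z + V22 z)
    = int_circle (fun z => V1 z * z.1 + V2 z * z.2).
  apply: (@divergence_disc R V1 V11 V12 V2 V21 V22).
  - move=> z cz; have d0 := du z cz; have d1 := du1 z cz; have d2 := du2 z cz.
    have e1 := cf1_pgrad z; have e4 := dD z cz.
    by apply: pgrad_eq; [rewrite /V1; pgrad_tac|rewrite /V11; field|rewrite /V12; field].
  - move=> z cz; have d0 := du z cz; have d1 := du1 z cz; have d2 := du2 z cz.
    have e1 := cf2_pgrad z; have e4 := dD z cz.
    by apply: pgrad_eq; [rewrite /V2; pgrad_tac|rewrite /V21; field|rewrite /V22; field].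
  - move=> z cz; have a1 := cu1 z cz; have a2 := cu2 z cz; have a3 := c11 z cz.
    have a4 := c12 z cz; have a5 := cc1 z; have a6 := cc2 z; have a7 := ccq z.
    by have a8 := cD z cz; have a9 := cD1 z cz; rewrite /V11; cont_tac.
  - move=> z cz; have a1 := cu1 z cz; have a2 := cu2 z cz; have a3 := c22 z cz.
    have a4 := c12 z cz; have a5 := cc1 z; have a6 := cc2 z; have a7 := ccq z.
    by have a8 := cD z cz; have a9 := cD2 z cz; rewrite /V22; cont_tac.
transitivity (int_disc (fun z => V11 z + V22 z)).
  apply: eq_int_disc => z _; rewrite /V11 /V22 /D1 /D2 /D /cf_q; by field.
rewrite divV; apply/eqP; rewrite -subr_eq0 -int_circleB; last first.
- apply: cont_cdisc_circle => z cz; have a1 := cu1 z cz; have a2 := cu2 z cz.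
  have a3 := cD z cz; rewrite /D in a3.
  by change (continuous_at z (fun z => (z.1 * u1 z + z.2 * u2 z + 1) * D z)); cont_tac.
- apply: cont_cdisc_circle => z cz; have a1 := cu1 z cz; have a2 := cu2 z cz.
  have a0 := pgrad_continuous (du z cz); have a5 := cc1 z; have a6 := cc2 z.
  by have a3 := cD z cz; rewrite /V1 /V2; cont_tac.
(* On the circle the field has no normal component, and both the normal derivative of [q] and the
   angular derivative of [cf_g] equal [q]. With a prime for the angular derivative, the flux minus
   the right side is [- u q - cf_g u' - q], an exact derivative. *)
apply/eqP; apply: (@int_circle_derive _ _ (fun z => - (cf_g z * u z + cf_g z))).
- apply: cont_cdisc_circle => z cz; have a1 := cu1 z cz; have a2 := cu2 z cz.
  have a0 := pgrad_continuous (du z cz); have a5 := cc1 z; have a6 := cc2 z.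
  have a3 := cD z cz.
  change (continuous_at z (fun z => V1 z * z.1 + V2 z * z.2
    - (z.1 * u1 z + z.2 * u2 z + 1) * D z)).
  by rewrite /V1 /V2; cont_tac.
move=> t; have cz := circle_ptP t; have d := du _ (circle_cdisc cz).
have dg := cf_g_pgrad (circle_pt t).
apply: has_derive1_eq.
  apply: (@has_derive1_circle_pt (fun z => - (cf_g z * u z + cf_g z))); by pgrad_tac.
set z := circle_pt t in cz *; rewrite /V1 /V2 /D !cf1_circle// !cf2_circle//.
rewrite /cf_q; set g := cf_g z; rewrite /cf_g.
by field.
Qed.

(* [K] and [k] below are the Gauss and the geodesic curvature of
   [exp (2 u) g_euc], up to the conformal factors. *)
Lemma kazdan_warner_disc (al be : R) (f f1 f2 j j1 j2 u u1 u2 u11 u12 u22 : R * R -> R)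
    (K k : R * R -> R) :
  (forall z, cdisc z -> pgrad f z (f1 z) (f2 z)) ->
  cont_cdisc f1 -> cont_cdisc f2 ->
  (forall z, circle z -> pgrad j z (j1 z) (j2 z)) ->
  cont_circle j1 -> cont_circle j2 ->
  (forall z, cdisc z -> pgrad u z (u1 z) (u2 z)) ->
  (forall z, cdisc z -> pgrad u1 z (u11 z) (u12 z)) ->
  (forall z, cdisc z -> pgrad u2 z (u12 z) (u22 z)) ->
  cont_cdisc u11 -> cont_cdisc u12 -> cont_cdisc u22 ->
  (forall z, cdisc z -> K z * expR (2 * u z) = - (u11 z + u22 z)) ->
  (forall z, circle z -> k z * expR (u z) = z.1 * u1 z + z.2 * u2 z + 1) ->
  int_disc (fun z => (al * (cf1 z * f1 z + cf2 z * f2 z)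
      + 2 * (al * f z - K z) * (cf1 z * u1 z + cf2 z * u2 z + cf_q z))
      * expR (2 * u z))
  + int_circle (fun z => (2 * be * (cf1 z * j1 z + cf2 z * j2 z)
      + 2 * (be * j z - k z) * (cf1 z * u1 z + cf2 z * u2 z + cf_q z))
      * expR (u z)) = 0.
Proof.
move=> df cf1' cf2' dj cj1 cj2 du du1 du2 c11 c12 c22 KE kE.
have cu1 : cont_cdisc u1 by move=> z /du1/pgrad_continuous.
have cu2 : cont_cdisc u2 by move=> z /du2/pgrad_continuous.
have cu : cont_cdisc u by move=> z /du/pgrad_continuous.
have cf : cont_cdisc f by move=> z /df/pgrad_continuous.
have cc1 z : continuous_at z cf1 := pgrad_continuous (cf1_pgrad z).
have cc2 z : continuous_at z cf2 := pgrad_continuous (cf2_pgrad z).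
have ccq z : continuous_at z cf_q := pgrad_continuous (cf_q_pgrad z).
have I1 := int_disc_cf_f df du cf1' cf2' cu1 cu2.
have du' z : circle z -> pgrad u z (u1 z) (u2 z) by move=> /circle_cdisc /du.
have I2 := int_circle_cf_j dj du' cj1 cj2 (cont_cdisc_circle cu1) (cont_cdisc_circle cu2).
have I3 := int_disc_pohozaev du du1 du2 c11 c12 c22.
set P := int_disc _; set Q := int_circle _.
(* Since [- K expR (2 u)] is the Laplacian, the disc part reduces to twice the Pohozaev integral;
   the circle part [Q] reduces to its negative. *)
have EP : P = al * 0 + 2 * int_disc (fun z => (u11 z + u22 z)
    * (cf1 z * u1 z + cf2 z * u2 z + cf_q z)).
{ rewrite -I1 -!int_discZ -?int_discD.
  - apply: eq_int_disc => z /disc_cdisc cz.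
    rewrite -[u11 z + u22 z]opprK -KE//; ring.
  all: move=> z cz; have a1 := cu1 z cz; have a2 := cu2 z cz; have a0 := cu z cz;
    have a5 := cc1 z; have a6 := cc2 z; have a7 := ccq z; have a8 := cf z cz;
    have a9 := c11 z cz; have b1 := c22 z cz; have b2 := cf1' z cz;
    have b3 := cf2' z cz; cont_tac. }
have cj : cont_circle j.
  move=> t; exact: (has_derive1_continuous (has_derive1_circle_pt (dj _ (circle_ptP t)))).
have b4 : cont_circle (fun z : R * R => z.1) by exact: continuous_cos.
have b5 : cont_circle (fun z : R * R => z.2) by exact: continuous_sin.
have EQ : Q = 2 * be * 0 - 2 * int_circle (fun z => (z.1 * u1 z + z.2 * u2 z + 1)
    * (cf1 z * u1 z + cf2 z * u2 z + cf_q z)).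
{ rewrite -I2 -!int_circleZ -?int_circleB.
  - apply: eq_int_circle => z cz.
    rewrite -kE//; ring.
  all: move=> t;
    have a1 := @cont_cdisc_circle _ u1 cu1 t; have a2 := @cont_cdisc_circle _ u2 cu2 t;
    have a0 := @cont_cdisc_circle _ u cu t;
    have a5 := @cont_cdisc_circle _ cf1 (fun z _ => cc1 z) t;
    have a6 := @cont_cdisc_circle _ cf2 (fun z _ => cc2 z) t;
    have a7 := @cont_cdisc_circle _ cf_q (fun z _ => ccq z) t;
    have a8 := cj t; have b2 := cj1 t; have b3 := cj2 t;
    have b6 := b4 t; have b7 := b5 t; cont_tac. }
by rewrite EP EQ I3; ring.
Qed.

End ConformalField.

(** * Change of variables under disc automorphisms *)

Section MobiusMap.
Context {R : realType}.
Implicit Types p z : R * R.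

(* Real and imaginary part, and squared modulus, of [1 + conj p z]. *)
Definition mob_u p z : R := 1 + (p.1 * z.1 + p.2 * z.2).
Definition mob_v p z : R := p.1 * z.2 - p.2 * z.1.
Definition mob_d p z : R := mob_u p z ^+ 2 + mob_v p z ^+ 2.
Definition mob_c p : R := 1 - (p.1 ^+ 2 + p.2 ^+ 2).
Definition mob_re p z : R :=
  ((z.1 + p.1) * mob_u p z + (z.2 + p.2) * mob_v p z) / mob_d p z.
Definition mob_im p z : R :=
  ((z.2 + p.2) * mob_u p z - (z.1 + p.1) * mob_v p z) / mob_d p z.
(* The modulus of the derivative; its square is the Jacobian. *)
Definition mob_j p z : R := mob_c p / mob_d p z.
(* Real and imaginary part of the derivative. *)
Definition mob_dre p z : R :=
  mob_c p * (mob_u p z ^+ 2 - mob_v p z ^+ 2) / mob_d p z ^+ 2.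
Definition mob_dim p z : R :=
  - 2 * mob_c p * (mob_u p z * mob_v p z) / mob_d p z ^+ 2.

Lemma mobiusE p z : mobius p z = (mob_re p z, mob_im p z).
Proof.
rewrite /mobius /mob_re /mob_im; congr pair; rewrite /= /mob_d /mob_u /mob_v add0r;
    have -> : p.1 * z.1 - - p.2 * z.2 = p.1 * z.1 + p.2 * z.2 by ring.
  by rewrite mulNr; ring.
by rewrite mulNr; ring.
Qed.

(** Cauchy-Schwarz, through the Lagrange identity, gives [|p . z| < 1]; this keeps the denominator
    of the map from vanishing up to the circle. *)
Lemma mob_u_gt0 p z : disc p -> cdisc z -> 0 < mob_u p z.
Proof.
move=> /discP p1 /cdiscP z1; rewrite /mob_u.
have q : (p.1 * z.1 + p.2 * z.2) ^+ 2 < 1.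
  apply: (@le_lt_trans _ _ ((p.1 ^+ 2 + p.2 ^+ 2) * (z.1 ^+ 2 + z.2 ^+ 2))).
    rewrite -subr_ge0; have := sqr_ge0 (p.1 * z.2 - p.2 * z.1).
    by congr (0 <= _); ring.
  apply: le_lt_trans p1; apply: ler_piMr => //.
  by rewrite addr_ge0 ?sqr_ge0.
have : `|p.1 * z.1 + p.2 * z.2| < 1.
  by rewrite -[X in _ < X]sqrtr1 -sqrtr_sqr ltr_sqrt.
by rewrite ltr_norml => /andP[+ _]; lra.
Qed.

Lemma mob_d_gt0 p z : disc p -> cdisc z -> 0 < mob_d p z.
Proof.
move=> dp cz; rewrite /mob_d; apply: ltr_pwDl; last exact: sqr_ge0.
by rewrite exprn_gt0// mob_u_gt0.
Qed.

Lemma mob_d_neq0 p z : disc p -> cdisc z -> mob_d p z != 0.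
Proof. by move=> dp cz; rewrite gt_eqF// mob_d_gt0. Qed.

Lemma mob_c_gt0 p : disc p -> 0 < mob_c p.
Proof. by move=> /discP; rewrite subr_gt0. Qed.

Lemma mob_j_gt0 p z : disc p -> cdisc z -> 0 < mob_j p z.
Proof. by move=> dp cz; rewrite divr_gt0// ?mob_c_gt0// mob_d_gt0. Qed.

(** The map multiplies [1 - |z|^2] by a positive factor when [p] is in the disc, so this one
    identity shows that disc, closed disc and circle are each preserved. *)
Lemma mob_sqnorm p z : mob_d p z != 0 ->
  1 - (mob_re p z ^+ 2 + mob_im p z ^+ 2)
  = mob_c p * (1 - (z.1 ^+ 2 + z.2 ^+ 2)) / mob_d p z.
Proof.
rewrite /mob_re /mob_im /mob_c /mob_d /mob_u /mob_v => d0; by field.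
Qed.

Lemma mobius_disc p z : disc p -> disc z -> disc (mob_re p z, mob_im p z).
Proof.
move=> dp dz; have cz := disc_cdisc dz; apply/discP => /=.
rewrite -subr_gt0 mob_sqnorm ?mob_d_neq0// divr_gt0// ?mob_d_gt0// mulr_gt0//.
  exact: mob_c_gt0.
by rewrite subr_gt0; apply/discP.
Qed.

Lemma mobius_cdisc p z : disc p -> cdisc z -> cdisc (mob_re p z, mob_im p z).
Proof.
move=> dp cz; apply/cdiscP => /=.
rewrite -subr_ge0 mob_sqnorm ?mob_d_neq0//; apply: divr_ge0.
  by apply: mulr_ge0; [exact/ltW/mob_c_gt0|rewrite subr_ge0; apply/cdiscP].
by apply: ltW; exact: mob_d_gt0.
Qed.

Lemma mobius_circle p z : disc p -> circle z -> circle (mob_re p z, mob_im p z).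
Proof.
move=> dp zc; have cz := circle_cdisc zc; apply/circleP => /=; apply/esym/eqP.
rewrite -subr_eq0 mob_sqnorm ?mob_d_neq0//.
by move/circleP : zc => ->; rewrite subrr mulr0 mul0r.
Qed.

Lemma mob_d_pgrad p z : pgrad (mob_d p) z
  (2 * (mob_u p z * p.1 - mob_v p z * p.2))
  (2 * (mob_u p z * p.2 + mob_v p z * p.1)).
Proof.
rewrite /mob_d /mob_u /mob_v.
by apply: pgrad_eq; [pgrad_tac|cbv beta; ring|cbv beta; ring].
Qed.

Lemma mob_re_pgrad p z : mob_d p z != 0 ->
  pgrad (mob_re p) z (mob_dre p z) (- mob_dim p z).
Proof.
move=> d0; have dd := mob_d_pgrad p z.
rewrite /mob_re /mob_u /mob_v; apply: pgrad_eq; [pgrad_tac => //| |];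
  rewrite /mob_dre /mob_dim /mob_c /mob_d /mob_u /mob_v in d0 *; by field.
Qed.

Lemma mob_im_pgrad p z : mob_d p z != 0 ->
  pgrad (mob_im p) z (mob_dim p z) (mob_dre p z).
Proof.
move=> d0; have dd := mob_d_pgrad p z.
rewrite /mob_im /mob_u /mob_v; apply: pgrad_eq; [pgrad_tac => //| |];
  rewrite /mob_dre /mob_dim /mob_c /mob_d /mob_u /mob_v in d0 *; by field.
Qed.

Lemma mob_j_pgrad p z : mob_d p z != 0 ->
  pgrad (mob_j p) z
    (- mob_j p z * (2 * (mob_u p z * p.1 - mob_v p z * p.2)) / mob_d p z)
    (- mob_j p z * (2 * (mob_u p z * p.2 + mob_v p z * p.1)) / mob_d p z).
Proof.
move=> d0; have dd := mob_d_pgrad p z; rewrite /mob_j.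
by apply: pgrad_eq; [pgrad_tac => //|cbv beta; field|cbv beta; field].
Qed.

Lemma mob_jacobian p z : mob_d p z != 0 ->
  jacobian_det (mobius p) z = mob_j p z ^+ 2.
Proof.
move=> d0; rewrite /jacobian_det.
have -> : (fun x => (mobius p x).1) = mob_re p.
  by apply/funext => x; rewrite mobiusE.
have -> : (fun x => (mobius p x).2) = mob_im p.
  by apply/funext => x; rewrite mobiusE.
rewrite (pgrad_d1 (mob_re_pgrad d0)) (pgrad_d2 (mob_re_pgrad d0)).
rewrite (pgrad_d1 (mob_im_pgrad d0)) (pgrad_d2 (mob_im_pgrad d0)).
by rewrite /mob_j /mob_dre /mob_dim; rewrite /mob_d in d0 *; field.
Qed.

(* [p] replaced by [s p]: the derivatives with respect to [s]. *)
Definition mob_q1 p z : R := p.1 - p.1 * (z.1 ^+ 2 - z.2 ^+ 2) - 2 * p.2 * (z.1 * z.2).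
Definition mob_q2 p z : R := p.2 - 2 * p.1 * (z.1 * z.2) + p.2 * (z.1 ^+ 2 - z.2 ^+ 2).
Definition mob_js p s z : R :=
  let P := (s * p.1, s * p.2) in
  (- 2 * s * (p.1 ^+ 2 + p.2 ^+ 2) * mob_d P z
   - mob_c P * (2 * (mob_u P z * (p.1 * z.1 + p.2 * z.2)
       + mob_v P z * (p.1 * z.2 - p.2 * z.1)))) / mob_d P z ^+ 2.

(** In complex form the [s]-derivative of the map is [(p - conj p z^2) / (1 + s conj p z)^2];
    [mob_q1] and [mob_q2] are the real and imaginary parts of the numerator. *)
Lemma mob_re_scale p s z : mob_d (s * p.1, s * p.2) z != 0 ->
  has_derive1 s (fun s => mob_re (s * p.1, s * p.2) z)
    ((mob_q1 p z * (mob_u (s * p.1, s * p.2) z ^+ 2 - mob_v (s * p.1, s * p.2) z ^+ 2)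
      + mob_q2 p z * (2 * (mob_u (s * p.1, s * p.2) z * mob_v (s * p.1, s * p.2) z)))
     / mob_d (s * p.1, s * p.2) z ^+ 2).
Proof.
rewrite /mob_re /mob_q1 /mob_q2 /mob_d /mob_u /mob_v /= => d0.
by apply: has_derive1_eq; [der_tac => //|cbv beta; field].
Qed.

Lemma mob_im_scale p s z : mob_d (s * p.1, s * p.2) z != 0 ->
  has_derive1 s (fun s => mob_im (s * p.1, s * p.2) z)
    ((mob_q2 p z * (mob_u (s * p.1, s * p.2) z ^+ 2 - mob_v (s * p.1, s * p.2) z ^+ 2)
      - mob_q1 p z * (2 * (mob_u (s * p.1, s * p.2) z * mob_v (s * p.1, s * p.2) z)))
     / mob_d (s * p.1, s * p.2) z ^+ 2).
Proof.
rewrite /mob_im /mob_q1 /mob_q2 /mob_d /mob_u /mob_v /= => d0.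
by apply: has_derive1_eq; [der_tac => //|cbv beta; field].
Qed.

Lemma mob_j_scale p s z : mob_d (s * p.1, s * p.2) z != 0 ->
  has_derive1 s (fun s => mob_j (s * p.1, s * p.2) z) (mob_js p s z).
Proof.
rewrite /mob_j /mob_js /mob_c /mob_d /mob_u /mob_v /= => d0.
by apply: has_derive1_eq; [der_tac => //|cbv beta; field].
Qed.

End MobiusMap.

(** Differentiation under the integral sign: the integral of [H s] has derivative zero. The
    parameter interval extends beyond 0 and 1 so that two-sided derivatives exist there too. *)
Lemma parametric_integral_eq {d} {T : measurableType d} {R : realType}
    (mu : {measure set T -> \bar R}) (D : set T) (H H' : R -> T -> R) (v M : R) :
  measurable D -> (mu D < +oo)%E -> 1 < v ->
  (forall s, - v < s < v -> mu.-integrable D (EFin \o H s)) ->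
  (forall s y, - v < s < v -> D y -> has_derive1 s (H ^~ y) (H' s y)) ->
  (forall s y, - v < s < v -> D y -> `|H' s y| <= M) ->
  (forall s, - v < s < v -> \int[mu]_(y in D) H' s y = 0) ->
  \int[mu]_(y in D) H 0 y = \int[mu]_(y in D) H 1 y.
Proof.
move=> mD Dfin v1 iH dH H'M int0.
have dF s : 0 <= s <= 1 -> has_derive1 s (fun s => \int[mu]_(y in D) H s y) 0.
  move=> /andP[s0 s1]; have sv : - v < s < v by apply/andP; split; lra.
  have sI : s \in `]- v, v[ by rewrite in_itv.
  have bI (x : R) : `]- v, v[%classic x -> - v < x < v by rewrite /= in_itv.
  (* [M] may be negative if [D] is empty, whereas the dominating function must be nonnegative. *)
  have iM : mu.-integrable D (EFin \o (fun=> Num.max M 0)).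
    apply: measurable_bounded_integrable => //.
    exists (Num.max M 0); split; first exact: num_real.
    move=> x Mx y _; rewrite ger0_norm; first exact: ltW.
    by rewrite le_max lexx orbT.
  have iH' (x : R) : `]- v, v[%classic x -> mu.-integrable D (EFin \o H x).
    by move=> /bI; exact: iH.
  have dH1 (x : R) y : `]- v, v[%classic x -> D y -> derivable (H ^~ y) x 1.
    by move=> /bI xI Dy; have [] := dH x y xI Dy.
  have bH (x : R) y : `]- v, v[%classic x -> D y ->
      `|partial1of2 H x y| <= Num.max M 0.
    move=> /bI xI Dy; rewrite partial1of2E; have [_ ->] := dH x y xI Dy.
    by rewrite le_max H'M.
  have M0 (y : T) : 0 <= Num.max M 0 by rewrite le_max lexx orbT.
  have D1 := @derivable_under_integral _ _ _ mu H D mD s (- v) v sI iH' dH1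
    (fun=> Num.max M 0) M0 iM bH.
  have D2 := @differentiation_under_integral _ _ _ mu H D mD s (- v) v sI iH' dH1
    (fun=> Num.max M 0) M0 iM bH.
  apply: DeriveDef => //; rewrite -derive1E D2 -(int0 s sv).
  apply: eq_Rintegral => y; rewrite inE => Dy.
  by rewrite partial1of2E; have [_ ->] := dH s y sv Dy.
have [c _] := mean_value ltr01 dF.
by rewrite mul0r => /eqP; rewrite subr_eq0 => /eqP.
Qed.

Section ChangeOfVariables.
Context {R : realType}.
Implicit Types p z : R * R.

Lemma mob_scale0 z :
  [/\ mob_re (0, 0) z = z.1, mob_im (0, 0) z = z.2 & mob_j (0, 0) z = 1].
Proof.
by rewrite /mob_re /mob_im /mob_j /mob_c /mob_d /mob_u /mob_v /=; split; field.
Qed.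

Lemma exists_scale p : disc p ->
  exists2 v : R, 1 < v & forall s, - v <= s <= v -> disc (s * p.1, s * p.2).
Proof.
move=> /discP p1; set P := p.1 ^+ 2 + p.2 ^+ 2 in p1.
have P0 : 0 <= P by rewrite addr_ge0 ?sqr_ge0.
(* As [P = |p|^2 < 1], both [v^2 = 2 / (1 + P) > 1] and [v^2 P = 2 P / (1 + P) < 1]. *)
pose v := Num.sqrt (2 / (1 + P)).
have q0 : 0 < 1 + P by rewrite ltr_pwDl.
have v2 : v ^+ 2 = 2 / (1 + P) by rewrite sqr_sqrtr// divr_ge0// ltW.
exists v.
  rewrite -[X in X < _]sqrtr1 ltr_sqrt ?divr_gt0//.
  by rewrite ltr_pdivlMr// mul1r; lra.
move=> s sv; apply/discP => /=; rewrite !exprMn -mulrDr -/P.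
have sv2 : s ^+ 2 <= v ^+ 2.
  by rewrite -[s ^+ 2]real_normK ?num_real// ler_sqr ?nnegrE ?sqrtr_ge0// ler_norml.
apply: (@le_lt_trans _ _ (v ^+ 2 * P)); first exact: ler_wpM2r.
by rewrite v2 mulrAC ltr_pdivrMr// mul1r; lra.
Qed.

(** The field [(mob_q1, mob_q2)] is tangent to the circle, with angular speed [- 2 mob_v p]; this
    removes the flux in the deformation argument. *)
Lemma mob_q_circle p z : circle z ->
  mob_q1 p z = 2 * mob_v p z * z.2 /\ mob_q2 p z = - (2 * mob_v p z * z.1).
Proof.
move=> /circleP zc; split; rewrite /mob_q1 /mob_q2 /mob_v.
  have -> : z.1 ^+ 2 = 1 - z.2 ^+ 2 by rewrite -zc addrK.
  by ring.
have -> : z.2 ^+ 2 = 1 - z.1 ^+ 2 by rewrite -zc addrC addKr.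
by ring.
Qed.


(** Continuity is joint in [s] and [z] because the [s]-derivative of the density must be bounded on
    a compact product to be dominated. *)
Lemma mob_joint_continuous p (s : R) z : mob_d (s * p.1, s * p.2) z != 0 ->
  let C (F : R * R -> R * R -> R) := continuous_at ((s, z) : R * (R * R))
    (fun y => F (y.1 * p.1, y.1 * p.2) y.2) in
  [/\ C mob_u, C mob_v, C mob_d & C mob_re]
  /\ [/\ C mob_im, C mob_j, C mob_dre & C mob_dim]
  /\ [/\ continuous_at ((s, z) : R * (R * R)) (fun y => mob_js p y.1 y.2),
         continuous_at ((s, z) : R * (R * R)) (fun y => mob_q1 p y.2)
       & continuous_at ((s, z) : R * (R * R)) (fun y => mob_q2 p y.2)].
Proof.
move=> d0 C.
have cu : C mob_u by rewrite /C /mob_u /=; cont_tac.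
have cv : C mob_v by rewrite /C /mob_v /=; cont_tac.
have cd : C mob_d by rewrite /C /mob_d /=; rewrite /C in cu cv; cont_tac.
rewrite /C in cu cv cd.
have cre : C mob_re by rewrite /C /mob_re /=; cont_tac.
have cim : C mob_im by rewrite /C /mob_im /=; cont_tac.
have cj : C mob_j by rewrite /C /mob_j /mob_c /=; cont_tac.
have d20 : mob_d (s * p.1, s * p.2) z ^+ 2 != 0 by rewrite expf_neq0.
have cdre : C mob_dre by rewrite /C /mob_dre /mob_c /=; cont_tac.
have cdim : C mob_dim by rewrite /C /mob_dim /mob_c /=; cont_tac.
do ?split => //.
- by rewrite /mob_js /mob_c /=; cont_tac.
- by rewrite /mob_q1; cont_tac.
- by rewrite /mob_q2; cont_tac.
Qed.

Lemma cont_slice (F : R * (R * R) -> R) (s : R) z :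
  continuous_at ((s, z) : R * (R * R)) F -> continuous_at z (fun z => F (s, z)).
Proof.
move=> cF; apply: (@continuous_comp _ _ _ (fun z => (s, z)) F) => //.
by apply: differentiable_continuous; exact: differentiable_pair.
Qed.

Section Disc.
Variables (p : R * R) (G G1 G2 : R * R -> R).
Hypothesis p1 : disc p.
Hypothesis dG : forall z, cdisc z -> pgrad G z (G1 z) (G2 z).
Hypothesis cG1 : cont_cdisc G1.
Hypothesis cG2 : cont_cdisc G2.

Let P (s : R) : R * R := (s * p.1, s * p.2).
Let W (s : R) z : R * R := (mob_re (P s) z, mob_im (P s) z).
Let e1 s z := mob_u (P s) z ^+ 2 - mob_v (P s) z ^+ 2.
Let e2 s z := 2 * (mob_u (P s) z * mob_v (P s) z).
Let r1 s z := (mob_q1 p z * e1 s z + mob_q2 p z * e2 s z) / mob_d (P s) z ^+ 2.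
Let r2 s z := (mob_q2 p z * e1 s z - mob_q1 p z * e2 s z) / mob_d (P s) z ^+ 2.
Let H s z := G (W s z) * mob_j (P s) z ^+ 2.
Let H' s z := (r1 s z * G1 (W s z) + r2 s z * G2 (W s z)) * mob_j (P s) z ^+ 2
  + G (W s z) * (2 * mob_j (P s) z * mob_js p s z).

Let joint_cont (F : R * R -> R) (s : R) z : disc (P s) -> cdisc z -> cont_cdisc F ->
  continuous_at ((s, z) : R * (R * R)) (fun y => F (W y.1 y.2)).
Proof.
move=> ds cz cF; have d0 := mob_d_neq0 ds cz.
have [[_ _ _ c1] [[c2 _ _ _] _]] := mob_joint_continuous d0.
have c3 : continuous_at (mob_re (P s) z, mob_im (P s) z) F.
  by apply: cF; exact: mobius_cdisc.
by rewrite /W; cont_tac.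
Qed.

Let cG : cont_cdisc G. Proof. by move=> z /dG/pgrad_continuous. Qed.

Let joint_cont_H' (s : R) z : disc (P s) -> cdisc z ->
  continuous_at ((s, z) : R * (R * R)) (fun y => H' y.1 y.2).
Proof.
move=> ds cz; have d0 := mob_d_neq0 ds cz.
have [[a1 a2 a3 a4] [[a5 a6 a7 a8] [b1 b2 b3]]] := mob_joint_continuous d0.
have g0 := joint_cont ds cz cG; have g1 := joint_cont ds cz cG1.
have g2 := joint_cont ds cz cG2.
have d20 : mob_d (s * p.1, s * p.2) z ^+ 2 != 0 by rewrite expf_neq0.
by rewrite /H' /r1 /r2 /e1 /e2; cont_tac.
Qed.

(** The [s]-derivative of the map is its [z]-derivative applied to the field [mob_q / mob_c]. The
    pulled-back density therefore satisfies the transport equation [H' = div (mob_q H) / mob_c], and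
    the flux vanishes by tangency. *)
Lemma mob_flow_divergence s : disc (P s) -> int_disc (H' s) = 0.
Proof.
move=> ds.
pose jx z := - mob_j (P s) z * (2 * (mob_u (P s) z * (P s).1 - mob_v (P s) z * (P s).2))
  / mob_d (P s) z.
pose jy z := - mob_j (P s) z * (2 * (mob_u (P s) z * (P s).2 + mob_v (P s) z * (P s).1))
  / mob_d (P s) z.
pose Hx z := (mob_dre (P s) z * G1 (W s z) + mob_dim (P s) z * G2 (W s z))
  * mob_j (P s) z ^+ 2 + G (W s z) * (2 * mob_j (P s) z * jx z).
pose Hy z := (- mob_dim (P s) z * G1 (W s z) + mob_dre (P s) z * G2 (W s z))
  * mob_j (P s) z ^+ 2 + G (W s z) * (2 * mob_j (P s) z * jy z).
pose qx z := - 2 * (p.1 * z.1 + p.2 * z.2).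
pose qy z := 2 * (p.1 * z.2 - p.2 * z.1).
have dH z : cdisc z -> pgrad (H s) z (Hx z) (Hy z).
  move=> cz; have d0 := mob_d_neq0 ds cz.
  have a1 := mob_re_pgrad d0; have a2 := mob_im_pgrad d0; have a3 := mob_j_pgrad d0.
  have a4 := dG (mobius_cdisc ds cz).
  rewrite /H /W; apply: pgrad_eq; first by pgrad_tac.
    by rewrite /Hx /jx /W; ring.
  by rewrite /Hy /jy /W; ring.
have dq1 z : pgrad (mob_q1 p) z (qx z) (qy z).
  by rewrite /mob_q1 /qx /qy; apply: pgrad_eq; [pgrad_tac|cbv beta; ring|cbv beta; ring].
have dq2 z : pgrad (mob_q2 p) z (- qy z) (qx z).
  by rewrite /mob_q2 /qx /qy; apply: pgrad_eq; [pgrad_tac|cbv beta; ring|cbv beta; ring].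
have c0 : mob_c (P s) != 0 by rewrite gt_eqF// mob_c_gt0.
have cont z : cdisc z ->
    [/\ continuous_at z Hx, continuous_at z Hy & continuous_at z (H s)].
  move=> cz; have d0 := mob_d_neq0 ds cz.
  have [[a1 a2 a3 a4] [[a5 a6 a7 a8] _]] := mob_joint_continuous d0.
  have {}a1 := cont_slice a1; have {}a2 := cont_slice a2; have {}a3 := cont_slice a3.
  have {}a6 := cont_slice a6; have {}a7 := cont_slice a7; have {}a8 := cont_slice a8.
  have g0 := cont_slice (joint_cont ds cz cG).
  have g1 := cont_slice (joint_cont ds cz cG1).
  have g2 := cont_slice (joint_cont ds cz cG2).
  split; last exact: pgrad_continuous (dH z cz).
    by rewrite /Hx /jx; cont_tac.
  by rewrite /Hy /jy; cont_tac.
have cqx z : continuous_at z qx by rewrite /qx; cont_tac.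
have cq1 z : continuous_at z (mob_q1 p) := pgrad_continuous (dq1 z).
have cq2 z : continuous_at z (mob_q2 p) := pgrad_continuous (dq2 z).
pose A1 z := qx z * H s z + mob_q1 p z * Hx z.
pose B2 z := qx z * H s z + mob_q2 p z * Hy z.
have cA1 : cont_cdisc A1.
  move=> z cz; have [a1 a2 a3] := cont z cz; have a4 := cqx z; have a5 := cq1 z.
  by rewrite /A1; cont_tac.
have cB2 : cont_cdisc B2.
  move=> z cz; have [a1 a2 a3] := cont z cz; have a4 := cqx z; have a5 := cq2 z.
  by rewrite /B2; cont_tac.
transitivity (int_disc (fun z => (mob_c (P s))^-1 * (A1 z + B2 z))).
  apply: eq_int_disc => z dz; have d0 := mob_d_neq0 ds (disc_cdisc dz).
  rewrite /A1 /B2 /Hx /Hy /H /H' /r1 /r2 /e1 /e2 /mob_js /mob_dre /mob_dim /jx /jy /mob_j.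
  rewrite -/(P s) /=; set g0 := G _; set g1 := G1 _; set g2 := G2 _.
  rewrite /qx /mob_q1 /mob_q2 /mob_c /mob_d /mob_u /mob_v /= in c0 d0 *.
  by field; rewrite d0 c0.
rewrite int_discZ; last first.
  by move=> z cz; have a1 := cA1 z cz; have a2 := cB2 z cz; cont_tac.
have E : int_disc (fun z => A1 z + B2 z)
    = int_circle (fun z => mob_q1 p z * H s z * z.1 + mob_q2 p z * H s z * z.2).
{ apply: (@divergence_disc _ (fun z => mob_q1 p z * H s z) A1
    (fun z => qy z * H s z + mob_q1 p z * Hy z) (fun z => mob_q2 p z * H s z)
    (fun z => - qy z * H s z + mob_q2 p z * Hx z) B2); [| |exact: cA1|exact: cB2].
  - by move=> z cz; have a1 := dH z cz; have a2 := dq1 z; pgrad_tac.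
  - by move=> z cz; have a1 := dH z cz; have a2 := dq2 z; pgrad_tac. }
rewrite E.
have -> : int_circle (fun z => mob_q1 p z * H s z * z.1 + mob_q2 p z * H s z * z.2)
    = int_circle (fun=> 0).
  by apply: eq_int_circle => z zc; have [-> ->] := mob_q_circle p zc; ring.
by rewrite /int_circle Rintegral_cst// mul0r mulr0.
Qed.

(** [H 0] is [G] and [H 1] is its pull-back with Jacobian; the integral is constant in between. *)
Lemma int_disc_mobius :
  int_disc (fun z => G (mobius p z) * mob_j p z ^+ 2) = int_disc G.
Proof.
have [v v1 vP] := exists_scale p1.
have [M HM] : exists M : R, forall y : R * (R * R),
    (`[- v, v] `*` cdisc) y -> `|H' y.1 y.2| <= M.
  apply: compact_continuous_bounded.
    by apply: compact_setX; [exact: segment_compact|exact: compact_cdisc].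
  move=> [s z] [/=]; rewrite in_itv/= => sv cz.
  by apply: joint_cont_H' => //; exact: vP.
have sP s : - v < s < v -> disc (P s).
  by move=> /andP[a b]; apply: vP; rewrite !ltW.
have := @parametric_integral_eq _ _ R
  (@lebesgue_measure R \x @lebesgue_measure R)%E disc H H' v M measurable_disc
  (measure_disc_lty (R := R)) v1.
move=> E; transitivity (int_disc (H 1)).
  apply: eq_int_disc => z _; rewrite /H /W /P !mul1r.
  by case: (p) => a b /=; rewrite mobiusE.
transitivity (int_disc (H 0)); last first.
  apply: eq_int_disc => z _; rewrite /H /W /P !mul0r.
  have [-> -> ->] := mob_scale0 z; rewrite expr1n mulr1; by case: z.
apply/esym/E.
- move=> s sv; apply: integrable_disc => z cz; have ds := sP s sv.
  have d0 := mob_d_neq0 ds cz.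
  have [_ [[_ a6 _ _] _]] := mob_joint_continuous d0.
  have {}a6 := cont_slice a6; have g0 := cont_slice (joint_cont ds cz cG).
  by rewrite /H; cont_tac.
- move=> s z sv dz; have ds := sP s sv; have cz := disc_cdisc dz.
  have d0 := mob_d_neq0 ds cz.
  have a1 := mob_re_scale d0; have a2 := mob_im_scale d0; have a3 := mob_j_scale d0.
  have a4 := dG (mobius_cdisc ds cz).
  change (has_derive1 s (fun s => G (mob_re (s * p.1, s * p.2) z, mob_im (s * p.1, s * p.2) z)
    * mob_j (s * p.1, s * p.2) z ^+ 2) (H' s z)).
  by apply: has_derive1_eq; first by der_tac.
- move=> s z /andP[a b] dz; apply: (HM (s, z)); split; last exact: disc_cdisc.
  by rewrite /= in_itv/= !ltW.
- by move=> s sv; apply: mob_flow_divergence; exact: sP.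
Qed.

End Disc.

Section Circle.
Variables (p : R * R) (G G1 G2 : R * R -> R).
Hypothesis p1 : disc p.
Hypothesis dG : forall z, circle z -> pgrad G z (G1 z) (G2 z).
Hypothesis cG1 : forall z, circle z -> continuous_at z G1.
Hypothesis cG2 : forall z, circle z -> continuous_at z G2.

Let P (s : R) : R * R := (s * p.1, s * p.2).
Let W (s : R) z : R * R := (mob_re (P s) z, mob_im (P s) z).
Let e1 s z := mob_u (P s) z ^+ 2 - mob_v (P s) z ^+ 2.
Let e2 s z := 2 * (mob_u (P s) z * mob_v (P s) z).
Let r1 s z := (mob_q1 p z * e1 s z + mob_q2 p z * e2 s z) / mob_d (P s) z ^+ 2.
Let r2 s z := (mob_q2 p z * e1 s z - mob_q1 p z * e2 s z) / mob_d (P s) z ^+ 2.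
Let H s z := G (W s z) * mob_j (P s) z.
Let H' s z := (r1 s z * G1 (W s z) + r2 s z * G2 (W s z)) * mob_j (P s) z
  + G (W s z) * mob_js p s z.

Let joint_cont (F : R * R -> R) (s : R) z : disc (P s) -> circle z ->
  (forall z, circle z -> continuous_at z F) ->
  continuous_at ((s, z) : R * (R * R)) (fun y => F (W y.1 y.2)).
Proof.
move=> ds cz cF; have d0 := mob_d_neq0 ds (circle_cdisc cz).
have [[_ _ _ c1] [[c2 _ _ _] _]] := mob_joint_continuous d0.
have c3 : continuous_at (mob_re (P s) z, mob_im (P s) z) F.
  by apply: cF; exact: mobius_circle.
by rewrite /W; cont_tac.
Qed.

Let cG z : circle z -> continuous_at z G. Proof. by move=> /dG/pgrad_continuous. Qed.

Let joint_cont_H' (s : R) z : disc (P s) -> circle z ->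
  continuous_at ((s, z) : R * (R * R)) (fun y => H' y.1 y.2).
Proof.
move=> ds cz; have d0 := mob_d_neq0 ds (circle_cdisc cz).
have [[a1 a2 a3 a4] [[a5 a6 a7 a8] [b1 b2 b3]]] := mob_joint_continuous d0.
have g0 := joint_cont ds cz cG; have g1 := joint_cont ds cz cG1.
have g2 := joint_cont ds cz cG2.
have d20 : mob_d (s * p.1, s * p.2) z ^+ 2 != 0 by rewrite expf_neq0.
by rewrite /H' /r1 /r2 /e1 /e2; cont_tac.
Qed.

(** The transport equation on the circle: [L] is the density [H] times the angular speed
    [- 2 mob_v p / mob_c] of the transporting field, and [H'] is its angular derivative. *)
Lemma mob_flow_circle s : disc (P s) -> int_circle (H' s) = 0.
Proof.
move=> ds.
have c0 : mob_c (P s) != 0 by rewrite gt_eqF// mob_c_gt0.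
pose L z := (mob_c (P s))^-1 * (- 2 * mob_v p z) * H s z.
apply: (@int_circle_derive _ _ L).
  move=> t; have zc := circle_ptP t.
  have := cont_slice (joint_cont_H' ds zc); rewrite /circle_pt => c1.
  by change (continuous_at t (fun t : R => H' s (cos t, sin t))); cont_tac.
move=> t; have zc := circle_ptP t; set z := circle_pt t in zc *.
have d0 := mob_d_neq0 ds (circle_cdisc zc).
have a1 := mob_re_pgrad d0; have a2 := mob_im_pgrad d0; have a3 := mob_j_pgrad d0.
have a4 := dG (mobius_circle ds zc).
apply: has_derive1_eq.
  by apply: has_derive1_circle_pt; rewrite -/z /L /H /W /mob_v; pgrad_tac.
cbv beta; rewrite -/z -/(mob_v p z); rewrite /H' /r1 /r2; have [-> ->] := mob_q_circle p zc.
rewrite /W; set g0 := G _; set g1 := G1 _; set g2 := G2 _.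
(* [A + i B] is [conj p z], of modulus [|p|] on the circle. In terms of [A] and [B] the claim
   becomes a rational identity free of the relation [|z| = 1]. *)
pose A := p.1 * z.1 + p.2 * z.2; pose B := mob_v p z.
have PAB : p.1 ^+ 2 + p.2 ^+ 2 = A ^+ 2 + B ^+ 2.
  rewrite -[LHS]mulr1; move/circleP : zc => <-.
  by rewrite /A /B /mob_v; ring.
have uE : mob_u (P s) z = 1 + s * A by rewrite /mob_u /P /A /=; ring.
have vE : mob_v (P s) z = s * B by rewrite /mob_v /P /B /mob_v /=; ring.
have cE : mob_c (P s) = 1 - s ^+ 2 * (A ^+ 2 + B ^+ 2).
  by rewrite -PAB /mob_c /P /=; ring.
have dE : mob_d (P s) z = (1 + s * A) ^+ 2 + (s * B) ^+ 2 by rewrite /mob_d uE vE.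
have jsE : mob_js p s z = (- 2 * s * (A ^+ 2 + B ^+ 2) * mob_d (P s) z
   - mob_c (P s) * (2 * ((1 + s * A) * A + s * B * B))) / mob_d (P s) z ^+ 2.
  by rewrite /mob_js -/(P s) PAB uE vE.
rewrite jsE /mob_dre /mob_dim /e1 /e2 /mob_j uE vE.
rewrite dE cE in d0 c0 *.
have yp : - z.2 * p.1 + z.1 * p.2 = - B by rewrite /B /mob_v; ring.
have xp : z.1 * p.1 + z.2 * p.2 = A by rewrite /A; ring.
clearbody z; rewrite -/B /P /=; clearbody A B g0 g1 g2.
set c := 1 - _ in c0 *; set d := (1 + s * A) ^+ 2 + _ in d0 *.
transitivity (c^-1 * (- 2 * (z.1 * p.1 + z.2 * p.2)) * (g0 * (c / d))
  + c^-1 * (- 2 * B) * (c / d * (c / d ^+ 2)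
      * (g1 * (- z.2 * ((1 + s * A) ^+ 2 - (s * B) ^+ 2) + 2 * z.1 * ((1 + s * A) * (s * B)))
       + g2 * (2 * z.2 * ((1 + s * A) * (s * B)) + z.1 * ((1 + s * A) ^+ 2 - (s * B) ^+ 2)))
    - g0 * (c / d) * (2 * s * ((1 + s * A) * (- z.2 * p.1 + z.1 * p.2)
        + s * B * (z.1 * p.1 + z.2 * p.2))) / d)).
  by clearbody c d; field; rewrite c0 d0.
rewrite yp xp; rewrite /c /d in c0 d0 *.
by field; rewrite c0 d0.
Qed.

Lemma int_circle_mobius :
  int_circle (fun z => G (mobius p z) * mob_j p z) = int_circle G.
Proof.
have [v v1 vP] := exists_scale p1.
have [M HM] : exists M : R, forall y : R * R,
    (`[- v, v] `*` `[0, 2 * pi]) y -> `|H' y.1 (circle_pt y.2)| <= M.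
  apply: compact_continuous_bounded.
    by apply: compact_setX; exact: segment_compact.
  move=> [s t] [/=]; rewrite in_itv/= => sv _.
  have c0 := joint_cont_H' (vP s sv) (circle_ptP t).
  apply: (@continuous_comp _ _ _ (fun y : R * R => (y.1, circle_pt y.2))
    (fun y : R * (R * R) => H' y.1 y.2)) => //.
  have c1 : continuous_at ((s, t) : R * R) (fun y : R * R => cos y.2) by cont_tac.
  have c2 : continuous_at ((s, t) : R * R) (fun y : R * R => sin y.2) by cont_tac.
  have c3 : continuous_at ((s, t) : R * R) (fun y : R * R => y.1) by cont_tac.
  exact: (cvg_pair c3 (cvg_pair c1 c2)).
have sP s : - v < s < v -> disc (P s).
  by move=> /andP[a b]; apply: vP; rewrite !ltW.
have I0 : (@lebesgue_measure R `[0%R, (2 * pi)%R] < +oo)%E.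
  by rewrite lebesgue_measure_itv /=; case: ifP => _; rewrite -?EFinD ltry.
have := @parametric_integral_eq _ _ R (@lebesgue_measure R) `[0%R, (2 * pi)%R]
  (fun s t => H s (circle_pt t)) (fun s t => H' s (circle_pt t)) v M
  (measurable_itv _) I0 v1.
move=> E; transitivity (int_circle (H 1)).
  apply: eq_int_circle => z _; rewrite /H /W /P !mul1r.
  by case: (p) => a b /=; rewrite mobiusE.
transitivity (int_circle (H 0)); last first.
  apply: eq_int_circle => z _; rewrite /H /W /P !mul0r.
  have [-> -> ->] := mob_scale0 z; rewrite mulr1; by case: z.
apply/esym/E.
- move=> s sv; apply: (@integrable_circle _ (H s)) => t; have ds := sP s sv.
  have d0 := mob_d_neq0 ds (circle_cdisc (circle_ptP t)).
  have [_ [[_ a6 _ _] _]] := mob_joint_continuous d0.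
  have {}a6 := cont_slice a6; have g0 := cont_slice (joint_cont ds (circle_ptP t) cG).
  have c1 : continuous_at (cos t, sin t) (H s) by rewrite /H; cont_tac.
  by change (continuous_at t (fun t : R => H s (cos t, sin t))); cont_tac.
- move=> s t sv _; have ds := sP s sv; have zc := circle_ptP t.
  have d0 := mob_d_neq0 ds (circle_cdisc zc).
  have a1 := mob_re_scale d0; have a2 := mob_im_scale d0; have a3 := mob_j_scale d0.
  have a4 := dG (mobius_circle ds zc).
  set z := circle_pt t in a1 a2 a3 a4 zc d0 *.
  change (has_derive1 s (fun s => G (mob_re (s * p.1, s * p.2) z, mob_im (s * p.1, s * p.2) z)
    * mob_j (s * p.1, s * p.2) z) (H' s z)).
  by apply: has_derive1_eq; first by der_tac.
- move=> s t /andP[a b] tI; apply: (HM (s, t)); split => //.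
  by rewrite /= in_itv/= !ltW.
- by move=> s sv; apply: (mob_flow_circle (sP s sv)).
Qed.

End Circle.

End ChangeOfVariables.

(** * The fields on the spherical cap *)

Section CapDerivatives.
Context {R : realType}.
Local Notation space := 'rV[R]_3.

Lemma derive_along_line (F : space -> R) (e X : space) (a : R) :
  has_derive1 0 (fun h : R => F (h *: e + X)) a -> 'D_e F X = a.
Proof.
case=> _ <-; rewrite /derive.
set f := (X in lim (X @ _) = _); set g := (X in _ = lim (X @ _)).
suff -> : f = g by [].
apply/funext => h; rewrite /f /g /=.
by rewrite scale0r add0r addr0 [h *: 1]mulr1.
Qed.

(** A stereographic coordinate of the line through [X] projected to the sphere. As the direction is
    tangent, the normalising factor [n] is 1 to first order and contributes nothing to the
    derivative. *)
Lemma sphere_curve (X0 X1 X2 e0 e1 e2 c d : R) :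
  X0 ^+ 2 + X1 ^+ 2 + X2 ^+ 2 = 1 -> X0 * e0 + X1 * e1 + X2 * e2 = 0 ->
  1 + X2 != 0 ->
  has_derive1 0 (fun h : R =>
    ((Num.sqrt ((h * e0 + X0) ^+ 2 + (h * e1 + X1) ^+ 2 + (h * e2 + X2) ^+ 2))^-1
       * (h * d + c))
    / (1 + (Num.sqrt ((h * e0 + X0) ^+ 2 + (h * e1 + X1) ^+ 2 + (h * e2 + X2) ^+ 2))^-1
       * (h * e2 + X2)))
    ((d * (1 + X2) - c * e2) / (1 + X2) ^+ 2).
Proof.
move=> X1E Xe X20.
pose n (h : R) : R :=
  (Num.sqrt ((h * e0 + X0) ^+ 2 + (h * e1 + X1) ^+ 2 + (h * e2 + X2) ^+ 2))^-1.
have n0 : n 0 = 1 by rewrite /n !mul0r !add0r X1E sqrtr1 invr1.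
have dn : has_derive1 0 n 0.
  rewrite /n; apply: has_derive1_eq; first der_tac.
  - by rewrite !mul0r !add0r X1E sqrtr1 oner_neq0.
  - by rewrite !mul0r !add0r X1E ltr01.
  - rewrite !mul0r !add0r X1E sqrtr1 !mulr1 expr1n divr1.
    rewrite (_ : _ + _ + _ = 2 * (X0 * e0 + X1 * e1 + X2 * e2)); last by ring.
    by rewrite Xe mulr0 mul0r oppr0.
change (has_derive1 0 (fun h : R => (n h * (h * d + c)) / (1 + n h * (h * e2 + X2)))
  ((d * (1 + X2) - c * e2) / (1 + X2) ^+ 2)).
apply: has_derive1_eq; first der_tac.
  by rewrite n0 !mul0r !add0r mul1r.
by cbv beta; rewrite n0; field; rewrite X20.
Qed.

(** The same for the horizontal norm, stationary because the direction is tangent to the rim. *)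
Lemma rim_curve (X0 X1 e0 e1 c d k : R) : 0 < X0 ^+ 2 + X1 ^+ 2 ->
  X0 * e0 + X1 * e1 = 0 ->
  has_derive1 0 (fun h : R =>
    k / Num.sqrt ((h * e0 + X0) ^+ 2 + (h * e1 + X1) ^+ 2) * (h * d + c))
    (k * d / Num.sqrt (X0 ^+ 2 + X1 ^+ 2)).
Proof.
move=> X0p Xe.
have s0 : Num.sqrt (X0 ^+ 2 + X1 ^+ 2) != 0 by rewrite gt_eqF// sqrtr_gt0.
pose n (h : R) : R := (Num.sqrt ((h * e0 + X0) ^+ 2 + (h * e1 + X1) ^+ 2))^-1.
have dn : has_derive1 0 n 0.
  rewrite /n; apply: has_derive1_eq; first der_tac.
  - by rewrite !mul0r !add0r.
  - by rewrite !mul0r !add0r.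
  - rewrite !mul0r !add0r.
    rewrite (_ : 2 * _ * _ + _ = 2 * (X0 * e0 + X1 * e1)); last by ring.
    by rewrite Xe mulr0 !mul0r oppr0 mul0r.
change (has_derive1 0 (fun h : R => k * n h * (h * d + c))
  (k * d / Num.sqrt (X0 ^+ 2 + X1 ^+ 2))).
apply: has_derive1_eq; first der_tac.
by cbv beta; rewrite /n !mul0r !add0r; field.
Qed.

(** The speed of the pulled-back field at the centre: at the pole [xi] has length
    [1 - sigma r = 2 r^2 / (1 + r^2)], and [pi_ r] scales by [1 / (2 r)] there. *)
Definition cap_kappa (r : R) : R := r / (1 + r ^+ 2).
(* The pull-back of [xi r i] to the disc is the conformal field of parameter
   [(cap_kappa r, 0)] or [(0, cap_kappa r)]. *)
Definition eta1 (r : R) (i : 'I_2) : R * R -> R :=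
  if i == 0 then cf1 (cap_kappa r) 0 0 else cf1 0 (cap_kappa r) 0.
Definition eta2 (r : R) (i : 'I_2) : R * R -> R :=
  if i == 0 then cf2 (cap_kappa r) 0 0 else cf2 0 (cap_kappa r) 0.

Definition cap_N (r : R) (z : R * R) : R := 1 + r ^+ 2 * (z.1 ^+ 2 + z.2 ^+ 2).

Lemma cap_N_gt0 r z : 0 < cap_N r z.
Proof. by rewrite ltr_pwDl// mulr_ge0 ?sqr_ge0// addr_ge0 ?sqr_ge0. Qed.

Lemma enorm_sqr (z : R * R) : enorm z ^+ 2 = z.1 ^+ 2 + z.2 ^+ 2.
Proof. by rewrite sqr_sqrtr// addr_ge0 ?sqr_ge0. Qed.

Lemma enorm_scale (r : R) (z : R * R) :
  enorm (r *: z) ^+ 2 = r ^+ 2 * (z.1 ^+ 2 + z.2 ^+ 2).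
Proof. by rewrite enorm_sqr /= /GRing.scale/=; ring. Qed.

Lemma Psi0 (r : R) z : (Psi_ r z) 0 0 = 2 * r * z.1 / cap_N r z.
Proof. by rewrite /Psi_ /Psi !mxE /= enorm_scale -/(cap_N r z) /GRing.scale/=; ring. Qed.

Lemma Psi1 (r : R) z : (Psi_ r z) 0 1 = 2 * r * z.2 / cap_N r z.
Proof. by rewrite /Psi_ /Psi !mxE /= enorm_scale -/(cap_N r z) /GRing.scale/=; ring. Qed.

Lemma Psi2 (r : R) z : (Psi_ r z) 0 2 = (2 - cap_N r z) / cap_N r z.
Proof. by rewrite /Psi_ /Psi !mxE /= enorm_scale /cap_N; ring. Qed.

Lemma xi00 (r : R) (X : space) : (xi r 0 X) 0 0 = 1 - X 0 0 ^+ 2 - sigma r * X 0 2.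
Proof. by rewrite /xi /gradX /cross3 /vec3 /basis3 !mxE /=; ring. Qed.

Lemma xi01 (r : R) (X : space) : (xi r 0 X) 0 1 = - (X 0 0 * X 0 1).
Proof. by rewrite /xi /gradX /cross3 /vec3 /basis3 !mxE /=; ring. Qed.

Lemma xi02 (r : R) (X : space) : (xi r 0 X) 0 2 = - (X 0 0 * X 0 2) + sigma r * X 0 0.
Proof. by rewrite /xi /gradX /cross3 /vec3 /basis3 !mxE /=; ring. Qed.

Lemma xi10 (r : R) (X : space) : (xi r 1 X) 0 0 = - (X 0 1 * X 0 0).
Proof. by rewrite /xi /gradX /cross3 /vec3 /basis3 !mxE /=; ring. Qed.

Lemma xi11 (r : R) (X : space) : (xi r 1 X) 0 1 = 1 - X 0 1 ^+ 2 - sigma r * X 0 2.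
Proof. by rewrite /xi /gradX /cross3 /vec3 /basis3 !mxE /=; ring. Qed.

Lemma xi12 (r : R) (X : space) : (xi r 1 X) 0 2 = - (X 0 1 * X 0 2) + sigma r * X 0 1.
Proof. by rewrite /xi /gradX /cross3 /vec3 /basis3 !mxE /=; ring. Qed.

Lemma I2_cases (i : 'I_2) : i = 0 \/ i = 1.
Proof. by case: i => [[|[|//]] hi]; [left|right]; apply: val_inj. Qed.

Lemma dot3E (X Y : space) :
  dot3 X Y = X 0 0 * Y 0 0 + X 0 1 * Y 0 1 + X 0 2 * Y 0 2.
Proof.
rewrite /dot3 !big_ord_recl big_ord0 addr0 addrA.
by congr (_ * _ + _ * _ + _ * _); congr (_ _ _); apply: val_inj.
Qed.

Lemma sphere_Psi (r : R) z :
  (Psi_ r z) 0 0 ^+ 2 + (Psi_ r z) 0 1 ^+ 2 + (Psi_ r z) 0 2 ^+ 2 = 1.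
Proof.
have N0 : cap_N r z != 0 by rewrite gt_eqF// cap_N_gt0.
by rewrite Psi0 Psi1 Psi2; rewrite /cap_N in N0 *; field.
Qed.

Lemma xi_tangent (r : R) i (X : space) : X 0 0 ^+ 2 + X 0 1 ^+ 2 + X 0 2 ^+ 2 = 1 ->
  X 0 0 * (xi r i X) 0 0 + X 0 1 * (xi r i X) 0 1 + X 0 2 * (xi r i X) 0 2 = 0.
Proof.
move=> X1; have [->|->] := I2_cases i.
  rewrite xi00 xi01 xi02; transitivity
    (X 0 0 * (1 - (X 0 0 ^+ 2 + X 0 1 ^+ 2 + X 0 2 ^+ 2))); first by ring.
  by rewrite X1 subrr mulr0.
rewrite xi10 xi11 xi12; transitivity
  (X 0 1 * (1 - (X 0 0 ^+ 2 + X 0 1 ^+ 2 + X 0 2 ^+ 2))); first by ring.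
by rewrite X1 subrr mulr0.
Qed.

Lemma line_coord (e X : space) (h : R) k :
  (h *: e + X) 0 k = h * e 0 k + X 0 k.
Proof. by rewrite !mxE. Qed.

Lemma pi_proj_sphere (r : R) (V : space) :
  let n := (Num.sqrt (V 0 0 ^+ 2 + V 0 1 ^+ 2 + V 0 2 ^+ 2))^-1 in
  pi_ r (proj_sphere V) = (r^-1 * ((n * V 0 0) / (1 + n * V 0 2)),
                           r^-1 * ((n * V 0 1) / (1 + n * V 0 2))).
Proof. by rewrite /= /pi_ /proj_sphere dot3E !mxE -!expr2. Qed.

Lemma pi_proj_rim (r : R) (V : space) : 0 < r ->
  let q := V 0 0 ^+ 2 + V 0 1 ^+ 2 in
  pi_ r (proj_rim r V) = (1 / Num.sqrt q * V 0 0, 1 / Num.sqrt q * V 0 1).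
Proof.
move=> r0 q; rewrite /pi_ /proj_rim /vec3 !mxE /= -/q.
have r20 : 1 + r ^+ 2 != 0 by rewrite gt_eqF// ltr_pwDl// sqr_ge0.
have rn0 : r != 0 by rewrite gt_eqF.
have -> : 1 + sigma r = 2 / (1 + r ^+ 2) by rewrite /sigma; field.
set s := Num.sqrt q; congr pair; rewrite /GRing.scale/=;
  have [->|sn0] := eqVneq s 0; rewrite ?invr0 ?(mulr0, mul0r)//;
  by field; rewrite ?rn0 ?r20 ?sn0.
Qed.

(** Seen in the disc, the projected line is a curve [(g1, g2)] through [z] with velocity
    [(eta1, eta2)]. It stays near [z], so [w] may be exchanged for its smooth representative
    [w']. *)
Lemma tangent_derive_sphere (w w' : R * R -> R) (a b r : R) (i : 'I_2) (z : R * R) :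
  0 < r -> (\forall y \near z, w' y = w y) -> pgrad w' z a b ->
  tangent_derive proj_sphere (fun X => w (pi_ r X)) (xi r i (Psi_ r z)) (Psi_ r z)
  = eta1 r i z * a + eta2 r i z * b.
Proof.
move=> r0 ww' dw; rewrite /tangent_derive; apply: derive_along_line.
set X := Psi_ r z; set e := xi r i X.
have XE := sphere_Psi r z; have eT := xi_tangent r i XE; rewrite -/X -/e in XE eT.
have N0 : cap_N r z != 0 by rewrite gt_eqF// cap_N_gt0.
have r20 : 1 + r ^+ 2 != 0 by rewrite gt_eqF// ltr_pwDl// sqr_ge0.
have rn0 : r != 0 by rewrite gt_eqF.
have X2E : 1 + X 0 2 = 2 / cap_N r z by rewrite Psi2; field.
have X20 : 1 + X 0 2 != 0 by rewrite X2E mulf_neq0 ?invr_neq0.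
pose n (h : R) := (Num.sqrt ((h * e 0 0 + X 0 0) ^+ 2 + (h * e 0 1 + X 0 1) ^+ 2
  + (h * e 0 2 + X 0 2) ^+ 2))^-1.
pose g1 (h : R) := r^-1 * ((n h * (h * e 0 0 + X 0 0)) / (1 + n h * (h * e 0 2 + X 0 2))).
pose g2 (h : R) := r^-1 * ((n h * (h * e 0 1 + X 0 1)) / (1 + n h * (h * e 0 2 + X 0 2))).
have -> : (fun h : R => ((fun X => w (pi_ r X)) \o proj_sphere) (h *: e + X))
    = (fun h : R => w (g1 h, g2 h)).
  by apply/funext => h; rewrite /= pi_proj_sphere !line_coord.
have n0 : n 0 = 1 by rewrite /n !mul0r !add0r XE sqrtr1 invr1.
have g0 : (g1 0, g2 0) = z.
  rewrite /g1 /g2 n0 !mul1r !mul0r !add0r X2E !Psi0 !Psi1.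
  by case: z @X @e @n @g1 @g2 {dw ww' XE eT X2E X20 n0} N0 => x y X e n g1 g2 /= N0; congr pair; field; rewrite rn0 N0.
have d1 : has_derive1 0 g1 (eta1 r i z).
  rewrite /g1; apply: has_derive1_eq.
    apply: has_derive1M; first exact: has_derive1_cst.
    exact: (sphere_curve _ _ XE eT X20).
  rewrite mul0r add0r X2E /e /eta1.
  have [->|->] := I2_cases i; rewrite /= ?xi00 ?xi02 ?xi10 ?xi12 /X Psi0 ?Psi1 Psi2;
    rewrite /cf1 /cap_kappa /sigma; rewrite /cap_N in N0 *; field;
    by rewrite ?rn0 ?r20 ?N0.
have d2 : has_derive1 0 g2 (eta2 r i z).
  rewrite /g2; apply: has_derive1_eq.
    apply: has_derive1M; first exact: has_derive1_cst.
    exact: (sphere_curve _ _ XE eT X20).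
  rewrite mul0r add0r X2E /e /eta2.
  have [->|->] := I2_cases i; rewrite /= ?xi01 ?xi02 ?xi11 ?xi12 /X ?Psi0 Psi1 Psi2;
    rewrite /cf2 /cap_kappa /sigma; rewrite /cap_N in N0 *; field;
    by rewrite ?rn0 ?r20 ?N0.
have D : has_derive1 0 (fun h : R => w' (g1 h, g2 h)) (eta1 r i z * a + eta2 r i z * b).
  by apply: pgrad_curve d1 d2; rewrite g0.
apply: (near_eq_is_derive _ D).
have cg : continuous_at (0 : R) (fun h : R => (g1 h, g2 h)).
  exact: (cvg_pair (has_derive1_continuous d1) (has_derive1_continuous d2)).
have H : nbhs (g1 0, g2 0) (fun y => w' y = w y) by rewrite g0.
exact: (cg _ H).
Qed.

(** Here the projected curve remains on the unit circle, so agreement of [w] and [w'] on the circle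
    alone is enough. *)
Lemma tangent_derive_rim (w w' : R * R -> R) (a b r : R) (i : 'I_2) (z : R * R) :
  0 < r -> circle z -> (forall z, circle z -> w z = w' z) -> pgrad w' z a b ->
  tangent_derive (proj_rim r) (fun X => w (pi_ r X)) (xi r i (Psi_ r z)) (Psi_ r z)
  = eta1 r i z * a + eta2 r i z * b.
Proof.
move=> r0 /circleP zc ww' dw; rewrite /tangent_derive; apply: derive_along_line.
set X := Psi_ r z; set e := xi r i X.
have r20 : 1 + r ^+ 2 != 0 by rewrite gt_eqF// ltr_pwDl// sqr_ge0.
have rn0 : r != 0 by rewrite gt_eqF.
have NE : cap_N r z = 1 + r ^+ 2 by rewrite /cap_N zc mulr1.
have XE := sphere_Psi r z; have eT := xi_tangent r i XE; rewrite -/X -/e in XE eT.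
have X2E : X 0 2 = sigma r by rewrite Psi2 NE /sigma; field.
pose k := 2 * r / (1 + r ^+ 2).
have k0 : 0 < k by rewrite divr_gt0 ?mulr_gt0// ltr_pwDl// sqr_ge0.
have kn0 : k != 0 by rewrite gt_eqF.
have X0E : X 0 0 = k * z.1 by rewrite Psi0 NE /k; ring.
have X1E : X 0 1 = k * z.2 by rewrite Psi1 NE /k; ring.
have XX : X 0 0 ^+ 2 + X 0 1 ^+ 2 = k ^+ 2.
  by rewrite X0E X1E !exprMn -mulrDr zc mulr1.
(* Tangency of [xi] to the rim: the rotation term was added to cancel the vertical component where
   [X_3 = sigma]. *)
have e2E : e 0 2 = 0.
  by rewrite /e; have [->|->] := I2_cases i; rewrite ?xi02 ?xi12 X2E; ring.
have eT' : X 0 0 * e 0 0 + X 0 1 * e 0 1 = 0 by rewrite e2E mulr0 addr0 in eT.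
have XX0 : 0 < X 0 0 ^+ 2 + X 0 1 ^+ 2 by rewrite XX exprn_gt0.
pose q (h : R) := (h * e 0 0 + X 0 0) ^+ 2 + (h * e 0 1 + X 0 1) ^+ 2.
pose g1 (h : R) := 1 / Num.sqrt (q h) * (h * e 0 0 + X 0 0).
pose g2 (h : R) := 1 / Num.sqrt (q h) * (h * e 0 1 + X 0 1).
have E : (fun h : R => ((fun X => w (pi_ r X)) \o proj_rim r) (h *: e + X))
    = (fun h : R => w (g1 h, g2 h)).
  by apply/funext => h; rewrite /= pi_proj_rim// !line_coord.
have g0 : (g1 0, g2 0) = z.
  rewrite /g1 /g2 /q !mul0r !add0r XX sqrtr_sqr ger0_norm ?(ltW k0)// X0E X1E.
  have -> : 1 / k * (k * z.1) = z.1 by field.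
  have -> : 1 / k * (k * z.2) = z.2 by field.
  by case: (z).
have g1E : has_derive1 0 g1 (eta1 r i z).
  rewrite /g1; apply: has_derive1_eq; first exact: (rim_curve _ _ _ XX0 eT').
  rewrite XX sqrtr_sqr ger0_norm ?(ltW k0)// mul1r /e /eta1.
  have y2 : z.2 ^+ 2 = 1 - z.1 ^+ 2 by rewrite -zc addrC addKr.
  have [->|->] := I2_cases i; rewrite /= ?xi00 ?xi10 ?X2E X0E ?X1E /cf1 ?y2;
    rewrite /cap_kappa /sigma /k; by field; rewrite ?rn0 ?r20.
have g2E : has_derive1 0 g2 (eta2 r i z).
  rewrite /g2; apply: has_derive1_eq; first exact: (rim_curve _ _ _ XX0 eT').
  rewrite XX sqrtr_sqr ger0_norm ?(ltW k0)// mul1r /e /eta2.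
  have y2 : z.1 ^+ 2 = 1 - z.2 ^+ 2 by rewrite -zc addrK.
  have [->|->] := I2_cases i; rewrite /= ?xi01 ?xi11 ?X2E ?X0E X1E /cf2 ?y2;
    rewrite /cap_kappa /sigma /k; by field; rewrite ?rn0 ?r20.
have D : has_derive1 0 (fun h : R => w' (g1 h, g2 h)) (eta1 r i z * a + eta2 r i z * b).
  by apply: pgrad_curve g1E g2E; rewrite g0.
rewrite E; apply: (near_eq_is_derive _ D).
have cq : continuous_at (0 : R) q by rewrite /q; cont_tac.
have q0 : 0 < q 0 by rewrite /q !mul0r !add0r.
have : \forall h \near (0 : R), 0 < q h by exact: (cvgr_gt (q 0) cq).
apply: filterS => h qh; apply/esym/ww'; apply/circleP => /=; rewrite /g1 /g2 !exprMn.
by rewrite expr1n !mul1r -mulrDr -/(q h) exprVn sqr_sqrtr ?ltW// mulVf// gt_eqF.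
Qed.

End CapDerivatives.

(** * From the essential supremum to pointwise bounds *)

Section SupNorm.
Context {R : realType}.
Local Notation leb2 := (@lebesgue_measure R \x @lebesgue_measure R)%E.

Lemma rat_rectangle_gt0 (q : (rat * rat) * (rat * rat)) (z : R * R) :
  rat_rectangle q z -> (0 < leb2 (rat_rectangle q))%E.
Proof.
move=> [/=]; rewrite !in_itv/= => /andP[a1 a2] /andP[b1 b2].
rewrite /rat_rectangle product_measure1E//=; try exact: measurable_itv.
rewrite !lebesgue_measure_itv /= !lte_fin (lt_trans a1 a2) (lt_trans b1 b2).
by rewrite -!EFinD -EFinM lte_fin mulr_gt0// subr_gt0; apply: lt_trans; eassumption.
Qed.

(** A violation on the closed disc moves radially into the open disc by continuity, and from there
    to a whole rational rectangle, which has positive measure. *)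
Lemma Linfty_norm_le (w w' : R * R -> R) (M : R) :
  (forall z, disc z -> w z = w' z) -> cont_cdisc w' ->
  (Linfty_norm w < M%:E)%E -> forall z, cdisc z -> `|w' z| <= M.
Proof.
move=> ww' cw' wM z cz; rewrite leNgt; apply/negP => Mw.
have [y dy My] : exists2 y, disc y & M < `|w' y|.
  pose g (s : R) := w' (s * z.1, s * z.2).
  have cg : continuous_at (1 : R) g.
    have c : continuous_at ((1 * z.1, 1 * z.2) : R * R) w'.
      by rewrite !mul1r; case: (z) cz => a b cz; exact: cw'.
    by rewrite /g; cont_tac.
  have cng : continuous_at (1 : R) (fun s => `|g s|) by exact: cvg_norm.
  have Mg : M < `|g 1| by rewrite /g !mul1r; case: (z) Mw.
  have /nbhs_ballP[e /= e0 eM] : \forall s \near (1 : R), M < `|g s|.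
    exact: (cvgr_gt `|g 1| cng).
  (* Within [e] of 1 and in [[1/2, 1)], so the scaled point lies in the open disc. *)
  pose s := 1 - Num.min (e / 2) 2^-1.
  have m0 : 0 < Num.min (e / 2) 2^-1 by rewrite lt_min divr_gt0//= invr_gt0.
  have m1 : Num.min (e / 2) 2^-1 <= 2^-1 by rewrite ge_min lexx orbT.
  have m2 : Num.min (e / 2) 2^-1 < e.
    by rewrite gt_min ltr_pdivrMr// ltr_pMr// ltr1n.
  have h1 : (2^-1 : R) < 1 by rewrite invf_lt1// ltr1n.
  exists (s * z.1, s * z.2).
    apply/discP; rewrite /= !exprMn -mulrDr.
    apply: (@le_lt_trans _ _ (s ^+ 2)); first by apply: ler_piMr; [exact: sqr_ge0|apply/cdiscP].
    rewrite expr_lt1//; first by rewrite /s ltrBlDr ltrDl.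
    by rewrite /s subr_ge0; lra.
  apply: (eM s); rewrite /ball/= /s opprB addrCA subrr addr0.
  by rewrite gtr0_norm.
have near_y : nbhs y (fun x => disc x /\ M < `|w' x|).
  apply: filterI; first exact: (open_nbhs_nbhs (conj open_disc dy)).
  have cy : continuous_at y (fun x => `|w' x|).
    by have := cw' y (disc_cdisc dy); exact: cvg_norm.
  exact: (cvgr_gt `|w' y| cy).
have [q qy qM] := rat_rectangle_nbhs near_y.
have q0 := rat_rectangle_gt0 qy.
(* The norm of exponent [+oo] unfolds to an essential supremum only when the whole space has
   positive measure. *)
have T0 : (0 < leb2 setT)%E.
  apply: (lt_le_trans q0); apply: le_measure; rewrite ?inE//.
  exact: measurable_rat_rectangle.
move: wM; rewrite /Linfty_norm unlock T0 => /ltW /ess_sup_inf.ess_supP [N [mN N0 sub]].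
have qN : rat_rectangle q `<=` N.
  move=> x qx; apply: sub => /=; have [dx Mx] := qM x qx.
  rewrite patchE mem_set//= ww'// lee_fin => h.
  by move: (lt_le_trans Mx h); rewrite ltxx.
have : (leb2 (rat_rectangle q) <= leb2 N)%E.
  by apply: le_measure; rewrite ?inE//; exact: measurable_rat_rectangle.
by rewrite N0 leNgt q0.
Qed.

End SupNorm.

(** * Curvatures computed from a smooth representative *)

Section CurvatureRegularity.
Context {R : realType}.
Variables (u u' : R * R -> R).
Hypothesis su : smooth_near cdisc u'.
Hypothesis uu' : forall z, cdisc z -> u z = u' z.

Lemma near_disc (P : R * R -> Prop) z : disc z ->
  (forall y, disc y -> P y) -> \forall y \near z, P y.
Proof.
by move=> dz DP; apply: filterS (open_nbhs_nbhs (conj open_disc dz)) => y /DP.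
Qed.

Lemma smooth_near_cont (A : set (R * R)) (w : R * R -> R) z :
  smooth_near A w -> A z -> continuous_at z w.
Proof.
move=> sw Az; exact: (pgrad_continuous (nbhs_singleton (smooth_near_pgrad sw Az))).
Qed.

Lemma gauss_curvE z : disc z ->
  gauss_curv u z = - expR (- (2 * u' z)) * (d1 (d1 u') z + d2 (d2 u') z).
Proof.
move=> dz; rewrite /gauss_curv /laplacian uu'; last exact: disc_cdisc.
have near2 (e e' : R * R) : 'D_e (fun y => 'D_e' u y) z = 'D_e (fun y => 'D_e' u' y) z.
  apply: near_eq_derive; apply: (near_disc dz) => y dy.
  apply: near_eq_derive; apply: (near_disc dy) => x dx.
  by apply: uu'; exact: disc_cdisc.
have e1 : d1 (d1 u) z = d1 (d1 u') z := near2 ((1, 0) : R * R) ((1, 0) : R * R).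
have e2 : d2 (d2 u) z = d2 (d2 u') z := near2 ((0, 1) : R * R) ((0, 1) : R * R).
by rewrite e1 e2.
Qed.

Lemma left_quotient (g : R -> R) (l : R) : has_derive1 1 g l ->
  lim ((g s - g 1) / (s - 1) @[s --> 1^'-]) = l.
Proof.
case=> dg <-; apply/cvg_lim => //.
have -> : (fun s => (g s - g 1) / (s - 1))
    = (fun h : R => h^-1 *: ((g \o shift 1) (h *: 1) - g 1)) \o (fun s => s - 1).
  apply/funext => s /=; rewrite [(s - 1) *: 1]mulr1 subrK.
  by rewrite /GRing.scale/= mulrC.
apply: (@cvg_comp _ _ _ _ _ _ (0^')); last exact: dg.
move=> A /nbhs_ballP [e /= e0 eA].
near=> s.
have s1 : s < 1 by near: s; exact: nbhs_left_lt.
have s2 : 1 - e < s by near: s; apply: nbhs_left_gt; rewrite ltrBlDr ltrDl.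
apply: eA; last by rewrite subr_eq0 lt_eqF.
by rewrite /ball/= sub0r normrN ltr_norml; apply/andP; split; lra.
Unshelve. all: by end_near. Qed.

(** For [s] slightly below 1 the point [s z] is in the closed disc, where [u] and [u'] agree; the
    one-sided quotient thus converges to the radial derivative of [u']. *)
Lemma geod_curvE z : circle z ->
  geod_curv u z = expR (- u' z) * (z.1 * d1 u' z + z.2 * d2 u' z + 1).
Proof.
move=> zc; have cz := circle_cdisc zc.
rewrite /geod_curv uu'//; congr (_ * (_ + _)); rewrite /dnormal.
have dg : has_derive1 (1 : R) (fun s : R => u' (s * z.1, s * z.2))
    (z.1 * d1 u' z + z.2 * d2 u' z).
  have d : pgrad u' ((1 * z.1, 1 * z.2) : R * R) (d1 u' z) (d2 u' z).
    rewrite !mul1r; have := nbhs_singleton (smooth_near_pgrad su cz).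
    by case: (z).
  by apply: has_derive1_eq; [der_tac|cbv beta; ring].
rewrite -(left_quotient dg); congr (lim _).
have E : \forall s \near (1 : R)^'-, (u (s *: z) - u z) / (s - 1)
    = (u' (s * z.1, s * z.2) - u' (1 * z.1, 1 * z.2)) / (s - 1).
  near=> s; rewrite !mul1r -surjective_pairing (uu' cz).
  suff -> : u (s *: z) = u' (s * z.1, s * z.2) by [].
  apply: uu'; apply/cdiscP; rewrite /= /GRing.scale/= !exprMn -mulrDr.
  have s1 : s < 1 by near: s; exact: nbhs_left_lt.
  have s0 : 0 < s by near: s; exact: nbhs_left_gt.
  by move/circleP : zc => ->; rewrite mulr1 expr_le1// ltW.
by rewrite eqEsubset; split; apply: near_eq_cvg => //; near do apply/esym.
Unshelve. all: by end_near. Qed.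

End CurvatureRegularity.

(** * A calculus of continuously differentiable functions *)

Section C1.
Context {R : realType}.
Implicit Types (A : set (R * R)) (w f g : R * R -> R).

(** The gradient is hidden behind an existential: the change of variables needs one to exist, not to
    be written out. *)
Definition C1_on A w : Prop := exists w12 : (R * R -> R) * (R * R -> R),
  [/\ forall z, A z -> pgrad w z (w12.1 z) (w12.2 z),
      forall z, A z -> continuous_at z w12.1
    & forall z, A z -> continuous_at z w12.2].

Lemma C1_cont A w z : C1_on A w -> A z -> continuous_at z w.
Proof. by case=> w12 [dw _ _] /dw /pgrad_continuous. Qed.

Lemma C1_smooth A w : smooth_near A w -> C1_on A w.
Proof.
move=> sw; exists (d1 w, d2 w); split => z Az.
- exact: (nbhs_singleton (smooth_near_pgrad sw Az)).
- exact: (smooth_near_cont (smooth_near_derive _ sw) Az).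
- exact: (smooth_near_cont (smooth_near_derive _ sw) Az).
Qed.

Lemma C1_pgrad A w w1 w2 : (forall z, pgrad w z (w1 z) (w2 z)) ->
  continuous w1 -> continuous w2 -> C1_on A w.
Proof.
by move=> dw c1 c2; exists (w1, w2); split => z _; [exact: dw|exact: c1|exact: c2].
Qed.

Lemma C1_cst A (c : R) : C1_on A (fun=> c).
Proof.
by apply: (@C1_pgrad _ _ (fun=> 0) (fun=> 0)) => z; [exact: pgrad_cst|exact: cont_cst..].
Qed.

Lemma C1_fst A : C1_on A (fun z => z.1).
Proof.
by apply: (@C1_pgrad _ _ (fun=> 1) (fun=> 0)) => z; [exact: pgrad_fst|exact: cont_cst..].
Qed.

Lemma C1_snd A : C1_on A (fun z => z.2).
Proof.
by apply: (@C1_pgrad _ _ (fun=> 0) (fun=> 1)) => z; [exact: pgrad_snd|exact: cont_cst..].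
Qed.

Lemma C1D A f g : C1_on A f -> C1_on A g -> C1_on A (fun z => f z + g z).
Proof.
move=> [[f1 f2] [/= df cf1 cf2]] [[g1 g2] [/= dg cg1 cg2]].
exists (fun z => f1 z + g1 z, fun z => f2 z + g2 z); split => z Az /=.
- exact: pgradD (df z Az) (dg z Az).
- exact: contD (cf1 z Az) (cg1 z Az).
- exact: contD (cf2 z Az) (cg2 z Az).
Qed.

Lemma C1N A f : C1_on A f -> C1_on A (fun z => - f z).
Proof.
move=> [[f1 f2] [/= df cf1 cf2]].
exists (fun z => - f1 z, fun z => - f2 z); split => z Az /=.
- exact: pgradN (df z Az).
- exact: contN (cf1 z Az).
- exact: contN (cf2 z Az).
Qed.

Lemma C1M A f g : C1_on A f -> C1_on A g -> C1_on A (fun z => f z * g z).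
Proof.
move=> Cf Cg; have cf := C1_cont Cf; have cg := C1_cont Cg.
case: Cf Cg => [[f1 f2] [/= df cf1 cf2]] [[g1 g2] [/= dg cg1 cg2]].
exists (fun z => f1 z * g z + f z * g1 z, fun z => f2 z * g z + f z * g2 z).
split => z Az /=.
- exact: pgradM (df z Az) (dg z Az).
- have a1 := cf z Az; have a2 := cg z Az; have a3 := cf1 z Az; have a4 := cg1 z Az.
  by cont_tac.
- have a1 := cf z Az; have a2 := cg z Az; have a3 := cf2 z Az; have a4 := cg2 z Az.
  by cont_tac.
Qed.

Lemma C1X A f : C1_on A f -> C1_on A (fun z => f z ^+ 2).
Proof. by move=> Cf; exact: (C1M Cf Cf). Qed.

Lemma C1_exp A f : C1_on A f -> C1_on A (fun z => expR (f z)).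
Proof.
move=> Cf; have cf := C1_cont Cf; case: Cf => [[f1 f2] [/= df cf1 cf2]].
exists (fun z => f1 z * expR (f z), fun z => f2 z * expR (f z)); split => z Az /=.
- exact: pgrad_exp (df z Az).
- by have a1 := cf z Az; have a3 := cf1 z Az; cont_tac.
- by have a1 := cf z Az; have a3 := cf2 z Az; cont_tac.
Qed.

End C1.

Ltac C1_tac :=
  lazymatch goal with
  | |- C1_on ?A (fun y => @?F y + @?G y) => apply: (@C1D _ A F G); C1_tac
  | |- C1_on ?A (fun y => - @?F y) => apply: (@C1N _ A F); C1_tac
  | |- C1_on ?A (fun y => @?F y * @?G y) => apply: (@C1M _ A F G); C1_tac
  | |- C1_on ?A (fun y => @?F y ^+ 2) => apply: (@C1X _ A F); C1_tac
  | |- C1_on ?A (fun y => expR (@?F y)) => apply: (@C1_exp _ A F); C1_tac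
  | |- C1_on _ _ => first [
        match goal with
        | H : C1_on ?A ?f |- C1_on ?A ?f => exact: H
        | H : C1_on ?A ?f |- C1_on ?A (fun y => ?f y) => exact: H
        end
      | exact: C1_cst | exact: C1_fst | exact: C1_snd | eassumption | idtac]
  end.

(** * Invariance of integrals and push-forward of conformal fields *)

Section MobiusC1.
Context {R : realType}.
Implicit Types (p z : R * R) (G : R * R -> R).

Lemma int_disc_mobius_C1 p G : disc p -> C1_on cdisc G ->
  int_disc (fun z => G (mob_re p z, mob_im p z) * mob_j p z ^+ 2) = int_disc G.
Proof.
move=> dp [[G1 G2] [/= dG c1 c2]]; rewrite -(int_disc_mobius dp dG c1 c2).
by apply: eq_int_disc => z _; rewrite mobiusE.
Qed.

Lemma int_circle_mobius_C1 p G : disc p -> C1_on circle G ->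
  int_circle (fun z => G (mob_re p z, mob_im p z) * mob_j p z) = int_circle G.
Proof.
move=> dp [[G1 G2] [/= dG c1 c2]]; rewrite -(int_circle_mobius dp dG c1 c2).
by apply: eq_int_circle => z _; rewrite mobiusE.
Qed.

Lemma C1_cf1 (A : set (R * R)) a b o : C1_on A (cf1 a b o).
Proof. by rewrite /cf1; C1_tac. Qed.
Lemma C1_cf2 (A : set (R * R)) a b o : C1_on A (cf2 a b o).
Proof. by rewrite /cf2; C1_tac. Qed.
Lemma C1_cf_q (A : set (R * R)) a b : C1_on A (cf_q a b).
Proof. by rewrite /cf_q; C1_tac. Qed.

(* Parameters of the push-forward under [mobius p] of the conformal field of
   parameters [k1], [k2] and [0]. *)
Definition push1 k1 k2 p : R := cf1 k1 k2 0 p / mob_c p.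
Definition push2 k1 k2 p : R := cf2 k1 k2 0 p / mob_c p.
Definition pusho k1 k2 p : R := 4 * (k1 * p.2 - k2 * p.1) / mob_c p.

Lemma mob_push1 k1 k2 p z : mob_c p != 0 -> mob_d p z != 0 ->
  cf1 (push1 k1 k2 p) (push2 k1 k2 p) (pusho k1 k2 p) (mob_re p z, mob_im p z)
  = mob_dre p z * cf1 k1 k2 0 z - mob_dim p z * cf2 k1 k2 0 z.
Proof.
rewrite /push1 /push2 /pusho /cf1 /cf2 /mob_re /mob_im /mob_dre /mob_dim /=.
rewrite /mob_c /mob_d /mob_u /mob_v => c0 d0; by field; rewrite c0 d0.
Qed.

Lemma mob_push2 k1 k2 p z : mob_c p != 0 -> mob_d p z != 0 ->
  cf2 (push1 k1 k2 p) (push2 k1 k2 p) (pusho k1 k2 p) (mob_re p z, mob_im p z)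
  = mob_dim p z * cf1 k1 k2 0 z + mob_dre p z * cf2 k1 k2 0 z.
Proof.
rewrite /push1 /push2 /pusho /cf1 /cf2 /mob_re /mob_im /mob_dre /mob_dim /=.
rewrite /mob_c /mob_d /mob_u /mob_v => c0 d0; by field; rewrite c0 d0.
Qed.

(** Half the Euclidean divergence changes by the derivative of [ln (mob_j p)] along the field. This
    is exactly the term by which [pull] differs from composition, so [e . grad u + q] at the image
    point is the same expression for the pulled-back function. *)
Lemma mob_pushq k1 k2 p z : mob_c p != 0 -> mob_d p z != 0 ->
  cf_q (push1 k1 k2 p) (push2 k1 k2 p) (mob_re p z, mob_im p z)
  = cf_q k1 k2 z
    - (cf1 k1 k2 0 z * (2 * (mob_u p z * p.1 - mob_v p z * p.2))
       + cf2 k1 k2 0 z * (2 * (mob_u p z * p.2 + mob_v p z * p.1))) / mob_d p z.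
Proof.
rewrite /push1 /push2 /cf_q /cf1 /cf2 /mob_re /mob_im /=.
rewrite /mob_c /mob_d /mob_u /mob_v => c0 d0; by field; rewrite c0 d0.
Qed.

End MobiusC1.

(** * The moment identity *)

Section Moments.
Context {R : realType}.
Local Notation plane := (R * R)%type.
Variables (f f' j j' U u : plane -> R) (p : plane) (r al be C : R) (i : 'I_2).
Hypothesis sf : smooth_near cdisc f'.
Hypothesis ff' : forall z, cdisc z -> f z = f' z.
Hypothesis sj : smooth_near circle j'.
Hypothesis jj' : forall z, circle z -> j z = j' z.
Hypothesis su : smooth_near cdisc u.
Hypothesis Uu : forall z, cdisc z -> U z = u z.
Hypothesis dp : disc p.
Hypothesis r0 : 0 < r.
Hypothesis C0 : 0 < C.

Let k1 : R := if i == 0 then cap_kappa r else 0.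
Let k2 : R := if i == 0 then 0 else cap_kappa r.
Let a1 := push1 k1 k2 p.
Let a2 := push2 k1 k2 p.
Let o := pusho k1 k2 p.
Let u1 := d1 u.
Let u2 := d2 u.
Let Phi (z : plane) : plane := (mob_re p z, mob_im p z).
Let Kc z : R := - expR (- (2 * u z)) * (d1 u1 z + d2 u2 z).
Let kc z : R := expR (- u z) * (z.1 * u1 z + z.2 * u2 z + 1).

Definition cap_defect z : R := al * f' z - Kc z.
Definition rim_defect z : R := be * j' z - kc z.
(** [pull] rewritten with the smooth representative and the explicit Jacobian [mob_j ^ 2], so that
    its gradient exists up to the circle. *)
Definition pull_log z : R := u (mob_re p z, mob_im p z) + ln (mob_j p z).
(** This is [v - v_limit] once [C = 2 r / sqrt (ainf f(z0))]; [C] drops out of the gradient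
    [(dist1, dist2)]. *)
Definition pull_dist z : R := pull_log z - ln (C / cap_N r z).
Let jx z := (2 * (mob_u p z * p.1 - mob_v p z * p.2)) / mob_d p z.
Let jy z := (2 * (mob_u p z * p.2 + mob_v p z * p.1)) / mob_d p z.
Definition dist1 z : R := mob_dre p z * u1 (Phi z) + mob_dim p z * u2 (Phi z)
  - jx z + 2 * r ^+ 2 * z.1 / cap_N r z.
Definition dist2 z : R := - mob_dim p z * u1 (Phi z) + mob_dre p z * u2 (Phi z)
  - jy z + 2 * r ^+ 2 * z.2 / cap_N r z.
Definition eta_dist z : R := eta1 r i z * dist1 z + eta2 r i z * dist2 z.

Let eta1E : eta1 r i = cf1 k1 k2 0.
Proof. by rewrite /eta1 /k1 /k2; case: ifP. Qed.
Let eta2E : eta2 r i = cf2 k1 k2 0.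
Proof. by rewrite /eta2 /k1 /k2; case: ifP. Qed.

Let d0 z : cdisc z -> mob_d p z != 0. Proof. exact: mob_d_neq0. Qed.
Let c0 : mob_c p != 0. Proof. by rewrite gt_eqF// mob_c_gt0. Qed.
Let N0 z : cap_N r z != 0. Proof. by rewrite gt_eqF// cap_N_gt0. Qed.

Let du z : cdisc z -> pgrad u z (u1 z) (u2 z).
Proof. by move=> cz; exact: (nbhs_singleton (smooth_near_pgrad su cz)). Qed.

Lemma pull_dist_pgrad z : cdisc z -> pgrad pull_dist z (dist1 z) (dist2 z).
Proof.
move=> cz; have e0 := d0 cz; have e1 := mob_re_pgrad e0; have e2 := mob_im_pgrad e0.
have e3 := mob_j_pgrad e0; have e4 := du (mobius_cdisc dp cz).
have j0 := mob_j_gt0 dp cz; have jn0 : mob_j p z != 0 by rewrite gt_eqF.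
have Np := cap_N_gt0 r z; have Nn := N0 z; have Cn : C != 0 by rewrite gt_eqF.
have e5 : pgrad (cap_N r) z (2 * r ^+ 2 * z.1) (2 * r ^+ 2 * z.2).
  by rewrite /cap_N; apply: pgrad_eq; [pgrad_tac|cbv beta; ring|cbv beta; ring].
have CN : 0 < C / cap_N r z by rewrite divr_gt0.
rewrite /pull_dist /pull_log; apply: pgrad_eq; first by pgrad_tac.
  rewrite /dist1 /jx /Phi; cbv beta; field.
  by rewrite ?e0 ?jn0 ?Nn ?Cn.
rewrite /dist2 /jy /Phi; cbv beta; field.
by rewrite ?e0 ?jn0 ?Nn ?Cn.
Qed.

Lemma cont_comp_mobius (F : plane -> R) z : cdisc z -> (forall y, cdisc y -> continuous_at y F) ->
  continuous_at z (fun z => F (mob_re p z, mob_im p z)).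
Proof.
move=> cz cF; have e0 := d0 cz.
have e1 := pgrad_continuous (mob_re_pgrad e0).
have e2 := pgrad_continuous (mob_im_pgrad e0).
have e3 := cF _ (mobius_cdisc dp cz).
by cont_tac.
Qed.

Lemma cont_comp_mobius_circle (F : plane -> R) z : circle z -> (forall y, circle y -> continuous_at y F) ->
  continuous_at z (fun z => F (mob_re p z, mob_im p z)).
Proof.
move=> cz cF; have e0 := d0 (circle_cdisc cz).
have e1 := pgrad_continuous (mob_re_pgrad e0).
have e2 := pgrad_continuous (mob_im_pgrad e0).
have e3 := cF _ (mobius_circle dp cz).
by cont_tac.
Qed.

Let su1 : smooth_near cdisc u1. Proof. exact: smooth_near_derive. Qed.
Let su2 : smooth_near cdisc u2. Proof. exact: smooth_near_derive. Qed.
Let su11 : smooth_near cdisc (d1 u1). Proof. exact: smooth_near_derive. Qed.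
Let su22 : smooth_near cdisc (d2 u2). Proof. exact: smooth_near_derive. Qed.
Let su12 : smooth_near cdisc (d2 u1). Proof. exact: smooth_near_derive. Qed.

Lemma cont_dist z : cdisc z -> continuous_at z dist1 /\ continuous_at z dist2.
Proof.
move=> cz; have e0 := d0 cz.
have g1 := @cont_comp_mobius u1 z cz (fun y cy => smooth_near_cont su1 cy).
have g2 := @cont_comp_mobius u2 z cz (fun y cy => smooth_near_cont su2 cy).
have e1 : continuous_at z (mob_u p) by rewrite /mob_u; cont_tac.
have e2 : continuous_at z (mob_v p) by rewrite /mob_v; cont_tac.
have e3 := pgrad_continuous (mob_d_pgrad p z).
have e4 : continuous_at z (cap_N r) by rewrite /cap_N; cont_tac.
have e5 := N0 z; have d20 : mob_d p z ^+ 2 != 0 by rewrite expf_neq0.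
have e6 : continuous_at z (mob_dre p) by rewrite /mob_dre; cont_tac.
have e7 : continuous_at z (mob_dim p) by rewrite /mob_dim; cont_tac.
by split; [rewrite /dist1 /jx /Phi|rewrite /dist2 /jy /Phi]; cont_tac.
Qed.

Let C1u : C1_on cdisc u := C1_smooth su.
Let C1u1 : C1_on cdisc u1 := C1_smooth su1.
Let C1u2 : C1_on cdisc u2 := C1_smooth su2.

Let C1sub (w : plane -> R) : C1_on cdisc w -> C1_on circle w.
Proof.
by case=> w12 [a b c]; exists w12; split => z /circle_cdisc; [exact: a|exact: b|exact: c].
Qed.

Lemma cap_defect_C1 : C1_on cdisc cap_defect.
Proof.
have s1 := C1_smooth sf; have s2 := C1_smooth su11; have s3 := C1_smooth su22.
rewrite /cap_defect /Kc; apply: C1D; first exact: C1M (C1_cst _ _) s1.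
by apply: C1N; apply: C1M; [C1_tac|exact: C1D s2 s3].
Qed.

Lemma rim_defect_C1 : C1_on circle rim_defect.
Proof.
have s1 := C1_smooth sj; have s2 := C1sub C1u; have s3 := C1sub C1u1.
have s4 := C1sub C1u2.
by rewrite /rim_defect /kc; C1_tac.
Qed.

Lemma cont_pull_log z : cdisc z -> continuous_at z pull_log.
Proof.
move=> cz; have cu := @cont_comp_mobius u z cz (fun y cy => smooth_near_cont su cy).
have cj := pgrad_continuous (mob_j_pgrad (d0 cz)).
exact: (contD cu (@cont_comp1 _ _ (@ln R) (mob_j p) z cj
  (continuous_ln (mob_j_gt0 dp cz)))).
Qed.

Lemma exp_pull_log z : cdisc z ->
  expR (pull_log z) = expR (u (Phi z)) * mob_j p z
  /\ expR (2 * pull_log z) = expR (2 * u (Phi z)) * mob_j p z ^+ 2.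
Proof.
move=> cz; have j0 := mob_j_gt0 dp cz.
have E : expR (pull_log z) = expR (u (Phi z)) * mob_j p z.
  by rewrite /pull_log expRD lnK.
split=> //; rewrite !expRM_natl E exprMn; ring.
Qed.

Lemma pullE z : cdisc z -> pull U (mobius p) z = pull_log z.
Proof.
move=> cz; have e0 := d0 cz; have j0 := mob_j_gt0 dp cz.
rewrite /pull mobiusE Uu; last exact: mobius_cdisc.
by rewrite mob_jacobian// /pull_log lnXn// mulr2n; congr (_ + _); field.
Qed.

Lemma cap_defectE z : disc z -> al * f z - gauss_curv U z = cap_defect z.
Proof.
move=> dz; rewrite (gauss_curvE Uu dz) ff'; last exact: disc_cdisc.
by [].
Qed.

Lemma rim_defectE z : circle z -> be * j z - geod_curv U z = rim_defect z.
Proof. by move=> zc; rewrite (geod_curvE su Uu zc) jj'. Qed.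

Let kk : 'I_3 := widen_ord (leqnSn 2) i.
Let Xc z : R := (Psi_ r z) 0 kk.

Let XcE z : Xc z = 2 * r * (if i == 0 then z.1 else z.2) / cap_N r z.
Proof.
rewrite /Xc /kk; have [->|->] := I2_cases i; rewrite -?Psi0 -?Psi1 /=;
  by congr (_ _ _); apply: val_inj.
Qed.

(* The conformal Killing identity that makes the limit profile an approximate
   critical point: [X_i + eta . grad v + div eta / 2 = eta . grad (v - v_limit)]. *)
Lemma coordinate_plus_field z : cdisc z ->
  Xc z + (cf1 a1 a2 o (Phi z) * u1 (Phi z) + cf2 a1 a2 o (Phi z) * u2 (Phi z)
     + cf_q a1 a2 (Phi z)) = eta_dist z.
Proof.
move=> cz; have e0 := d0 cz; have Nn := N0 z.
have r20 : 1 + r ^+ 2 != 0 by rewrite gt_eqF// ltr_pwDl// sqr_ge0.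
rewrite /Phi (mob_push1 _ _ c0 e0) (mob_push2 _ _ c0 e0) (mob_pushq _ _ c0 e0).
rewrite /eta_dist eta1E eta2E /dist1 /dist2 /jx /jy /Phi.
set g1 := u1 _; set g2 := u2 _.
(* The identity for the profile alone: [X_i + q = eta . grad (ln cap_N) = - eta . grad v_limit]. *)
have E : Xc z + cf_q k1 k2 z
    = (cf1 k1 k2 0 z * (2 * r ^+ 2 * z.1) + cf2 k1 k2 0 z * (2 * r ^+ 2 * z.2))
      / cap_N r z.
  rewrite XcE /k1 /k2 /cf_q /cf1 /cf2 /cap_kappa; rewrite /cap_N in Nn *.
  by case: ifP => _; field; rewrite r20 Nn.
have -> : Xc z = (cf1 k1 k2 0 z * (2 * r ^+ 2 * z.1) + cf2 k1 k2 0 z * (2 * r ^+ 2 * z.2))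
      / cap_N r z - cf_q k1 k2 z by rewrite -E; ring.
by field; rewrite e0 Nn.
Qed.

Let Df z : R := cf1 a1 a2 o z * d1 f' z + cf2 a1 a2 o z * d2 f' z.
Let Dj z : R := cf1 a1 a2 o z * d1 j' z + cf2 a1 a2 o z * d2 j' z.
Let Dt z : R := cf1 a1 a2 o z * u1 z + cf2 a1 a2 o z * u2 z + cf_q a1 a2 z.

Let cap_moment :
  int_cap r (pull U (mobius p)) (fun X => X 0 kk *
    (al * lift_cap r p f X - lift_cap r p (gauss_curv U) X))
  = int_disc (fun z => Xc z * cap_defect (Phi z) * expR (2 * pull_log z)).
Proof.
apply: eq_int_disc => z dz; have cz := disc_cdisc dz.
have E := cap_defectE (mobius_disc dp dz).
by rewrite (pullE cz) /lift_cap (pi_K _ (lt0r_neq0 r0)) mobiusE E.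
Qed.

Let rim_moment :
  int_rim r (pull U (mobius p)) (fun X => X 0 kk *
    (be * lift_cap r p j X - lift_cap r p (geod_curv U) X))
  = int_circle (fun z => Xc z * rim_defect (Phi z) * expR (pull_log z)).
Proof.
apply: eq_int_circle => z zc; have cz := circle_cdisc zc.
have E := rim_defectE (mobius_circle dp zc).
by rewrite (pullE cz) /lift_cap (pi_K _ (lt0r_neq0 r0)) mobiusE E.
Qed.

Let pgrad_mob (w : plane -> R) w1 w2 z : cdisc z -> pgrad w (Phi z) w1 w2 ->
  pgrad (fun z => w (mob_re p z, mob_im p z)) z
    (mob_dre p z * w1 + mob_dim p z * w2) (- mob_dim p z * w1 + mob_dre p z * w2).
Proof.
move=> cz dw; have e0 := d0 cz; have e1 := mob_re_pgrad e0; have e2 := mob_im_pgrad e0.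
by rewrite /Phi in dw; pgrad_tac.
Qed.

Let cap_derivative :
  int_cap r (pull U (mobius p)) (fun X =>
    tangent_derive proj_sphere (lift_cap r p f) (xi r i X) X)
  = int_disc (fun z => Df (Phi z) * expR (2 * pull_log z)).
Proof.
apply: eq_int_disc => z dz; have cz := disc_cdisc dz; have e0 := d0 cz.
rewrite (pullE cz); congr (_ * _).
have dPhi := mobius_disc dp dz; have cont_comp_mobiusz := disc_cdisc dPhi.
have dfm := pgrad_mob cz (nbhs_singleton (smooth_near_pgrad sf cont_comp_mobiusz)).
have near_eq : \forall y \near z, f' (mob_re p y, mob_im p y) = f (mobius p y).
  apply: (near_disc dz) => y dy.
  by rewrite mobiusE (ff' (disc_cdisc (mobius_disc dp dy))).
rewrite (@tangent_derive_sphere _ (fun z => f (mobius p z)) _ _ _ _ _ z r0 near_eq dfm).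
by rewrite /Df /Phi (mob_push1 _ _ c0 e0) (mob_push2 _ _ c0 e0) eta1E eta2E; ring.
Qed.

Let rim_derivative :
  int_rim r (pull U (mobius p)) (fun X =>
    tangent_derive (proj_rim r) (lift_cap r p j) (xi r i X) X)
  = int_circle (fun z => Dj (Phi z) * expR (pull_log z)).
Proof.
apply: eq_int_circle => z zc; have cz := circle_cdisc zc; have e0 := d0 cz.
rewrite (pullE cz); congr (_ * _).
have Pzc := mobius_circle dp zc.
have djm := pgrad_mob cz (nbhs_singleton (smooth_near_pgrad sj Pzc)).
rewrite (@tangent_derive_rim _ (fun z => j (mobius p z)) _ _ _ _ _ z r0 zc _ djm).
  by rewrite /Dj /Phi (mob_push1 _ _ c0 e0) (mob_push2 _ _ c0 e0) eta1E eta2E; ring.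
by move=> y yc; rewrite mobiusE (jj' (mobius_circle dp yc)).
Qed.

(** Pulling back Kazdan-Warner for [u] and the pushed field gives a relation between the derivative
    integrals and the moments of the defects against [Dt]. Adding the moments against [X_i] turns
    the weight into [eta_dist]. *)
Lemma moment_identity :
  2 * (int_cap r (pull U (mobius p)) (fun X => X 0 kk *
         (al * lift_cap r p f X - lift_cap r p (gauss_curv U) X))
       + int_rim r (pull U (mobius p)) (fun X => X 0 kk *
         (be * lift_cap r p j X - lift_cap r p (geod_curv U) X)))
  = al * int_cap r (pull U (mobius p)) (fun X =>
      tangent_derive proj_sphere (lift_cap r p f) (xi r i X) X)
  + 2 * be * int_rim r (pull U (mobius p)) (fun X =>
      tangent_derive (proj_rim r) (lift_cap r p j) (xi r i X) X)
  + (2 * int_disc (fun z => cap_defect (Phi z) * eta_dist z * expR (2 * pull_log z))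
     + 2 * int_circle (fun z => rim_defect (Phi z) * eta_dist z * expR (pull_log z))).
Proof.
rewrite cap_moment rim_moment cap_derivative rim_derivative.
have KW : int_disc (fun z => (al * Df z + 2 * cap_defect z * Dt z) * expR (2 * u z))
  + int_circle (fun z => (2 * be * Dj z + 2 * rim_defect z * Dt z) * expR (u z)) = 0.
  apply: (@kazdan_warner_disc _ a1 a2 o al be f' _ _ j' _ _ u u1 u2
    (d1 u1) (d2 u1) (d2 u2) Kc kc).
  - by move=> z cz; exact: (nbhs_singleton (smooth_near_pgrad sf cz)).
  - by move=> z cz; exact: (smooth_near_cont (smooth_near_derive _ sf) cz).
  - by move=> z cz; exact: (smooth_near_cont (smooth_near_derive _ sf) cz).
  - by move=> z cz; exact: (nbhs_singleton (smooth_near_pgrad sj cz)).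
  - move=> t; have c := smooth_near_cont (smooth_near_derive ((1, 0) : plane) sj) (circle_ptP t).
    rewrite /circle_pt in c *; change (continuous_at t (fun t : R => d1 j' (cos t, sin t))).
    by cont_tac.
  - move=> t; have c := smooth_near_cont (smooth_near_derive ((0, 1) : plane) sj) (circle_ptP t).
    rewrite /circle_pt in c *; change (continuous_at t (fun t : R => d2 j' (cos t, sin t))).
    by cont_tac.
  - exact: du.
  - by move=> z cz; exact: (nbhs_singleton (smooth_near_pgrad su1 cz)).
  - move=> z cz; rewrite (smooth_near_d12 su cz).
    exact: (nbhs_singleton (smooth_near_pgrad su2 cz)).
  - by move=> z cz; exact: smooth_near_cont su11 cz.
  - by move=> z cz; exact: smooth_near_cont su12 cz.
  - by move=> z cz; exact: smooth_near_cont su22 cz.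
  - move=> z cz; transitivity (- (expR (- (2 * u z)) * expR (2 * u z))
        * (d1 u1 z + d2 u2 z)); first by rewrite /Kc; ring.
    by rewrite -expRD addNr expR0; ring.
  - move=> z cz; transitivity ((expR (- u z) * expR (u z))
        * (z.1 * u1 z + z.2 * u2 z + 1)); first by rewrite /kc; ring.
    by rewrite -expRD addNr expR0; ring.
have C1a : C1_on cdisc (cf1 a1 a2 o) := C1_cf1 _ _ _ _.
have C1b : C1_on cdisc (cf2 a1 a2 o) := C1_cf2 _ _ _ _.
have C1c : C1_on cdisc (cf_q a1 a2) := C1_cf_q _ _ _.
have C1f1 := C1_smooth (smooth_near_derive ((1, 0) : plane) sf).
have C1f2 := C1_smooth (smooth_near_derive ((0, 1) : plane) sf).
have C1j1 := C1_smooth (smooth_near_derive ((1, 0) : plane) sj).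
have C1j2 := C1_smooth (smooth_near_derive ((0, 1) : plane) sj).
have C1Df : C1_on cdisc Df by rewrite /Df; C1_tac.
have C1Dt : C1_on cdisc Dt by rewrite /Dt; C1_tac.
have C1Dj : C1_on circle Dj.
  by have := C1sub C1a; have := C1sub C1b => *; rewrite /Dj; C1_tac.
have C1Dt' := C1sub C1Dt; have C1u' := C1sub C1u.
have C1cap := cap_defect_C1; have C1rim := rim_defect_C1.
have C1P : C1_on cdisc (fun z => (al * Df z + 2 * cap_defect z * Dt z) * expR (2 * u z)).
  by C1_tac.
have C1Q : C1_on circle (fun z => (2 * be * Dj z + 2 * rim_defect z * Dt z) * expR (u z)).
  by C1_tac.
(* Transport from the target disc back to the source, where the moments are defined. *)
rewrite -(int_disc_mobius_C1 dp C1P) -(int_circle_mobius_C1 dp C1Q) in KW.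
have cA z : cdisc z -> continuous_at z (fun z => cap_defect (mob_re p z, mob_im p z)).
  by move=> cz; exact: (cont_comp_mobius cz (fun y cy => C1_cont cap_defect_C1 cy)).
have cB z : circle z -> continuous_at z (fun z => rim_defect (mob_re p z, mob_im p z)).
  by move=> cz; exact: (cont_comp_mobius_circle cz (fun y cy => C1_cont rim_defect_C1 cy)).
have cDf z : cdisc z -> continuous_at z (fun z => Df (mob_re p z, mob_im p z)).
  by move=> cz; exact: (cont_comp_mobius cz (fun y cy => C1_cont C1Df cy)).
have cDt z : cdisc z -> continuous_at z (fun z => Dt (mob_re p z, mob_im p z)).
  by move=> cz; exact: (cont_comp_mobius cz (fun y cy => C1_cont C1Dt cy)).
have cDj z : circle z -> continuous_at z (fun z => Dj (mob_re p z, mob_im p z)).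
  by move=> cz; exact: (cont_comp_mobius_circle cz (fun y cy => C1_cont C1Dj cy)).
have cL := cont_pull_log.
have cX z : continuous_at z Xc.
  have -> : Xc = (fun z => 2 * r * (if i == 0 then z.1 else z.2) / cap_N r z).
    by apply/funext => y; rewrite XcE.
  have n0 := N0 z; have c4 : continuous_at z (cap_N r) by rewrite /cap_N; cont_tac.
  by case: (i == 0); cont_tac.
have ccirc (F : plane -> R) : (forall z, circle z -> continuous_at z F) -> cont_circle F.
  move=> cF t; have c := cF _ (circle_ptP t).
  rewrite /circle_pt in c *; change (continuous_at t (fun t : R => F (cos t, sin t))).
  by cont_tac.
pose I1 := int_disc (fun z => Xc z * cap_defect (Phi z) * expR (2 * pull_log z)).
pose I1' := int_disc (fun z => cap_defect (Phi z) * Dt (Phi z) * expR (2 * pull_log z)).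
pose I2 := int_circle (fun z => Xc z * rim_defect (Phi z) * expR (pull_log z)).
pose I2' := int_circle (fun z => rim_defect (Phi z) * Dt (Phi z) * expR (pull_log z)).
pose I3 := int_disc (fun z => Df (Phi z) * expR (2 * pull_log z)).
pose I4 := int_circle (fun z => Dj (Phi z) * expR (pull_log z)).
have K1 : al * I3 + 2 * I1' + (2 * be * I4 + 2 * I2') = 0.
{ rewrite -[RHS]KW /I3 /I4 /I1' /I2' -!int_discZ -?int_discD -?int_circleZ -?int_circleD.
  - congr (_ + _).
      apply: eq_int_disc => z /disc_cdisc cz.
      by have [_ ->] := exp_pull_log cz; rewrite /Phi; ring.
    apply: eq_int_circle => z /circle_cdisc cz.
    by have [-> _] := exp_pull_log cz; rewrite /Phi; ring.
  all: try (apply: ccirc => z zc; have cz := circle_cdisc zc;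
    have b1 := cB z zc; have b2 := cDt z cz; have b3 := cDj z zc; have b4 := cL z cz;
    by rewrite /Phi; cont_tac).
  all: move=> z cz; have b1 := cA z cz; have b2 := cDt z cz; have b3 := cDf z cz;
    have b4 := cL z cz; by rewrite /Phi; cont_tac. }
have E1 : int_disc (fun z => cap_defect (Phi z) * eta_dist z * expR (2 * pull_log z))
    = I1 + I1'.
{ rewrite -int_discD.
  - apply: eq_int_disc => z /disc_cdisc cz; rewrite -coordinate_plus_field// /Dt; ring.
  all: move=> z cz; have b1 := cA z cz; have b2 := cDt z cz;
    have b3 := cX z; have b4 := cL z cz; by rewrite /Phi; cont_tac. }
have E2 : int_circle (fun z => rim_defect (Phi z) * eta_dist z * expR (pull_log z))
    = I2 + I2'.
{ rewrite -int_circleD.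
  - apply: eq_int_circle => z /circle_cdisc cz; rewrite -coordinate_plus_field// /Dt; ring.
  all: apply: ccirc => z zc; have cz := circle_cdisc zc; have b1 := cB z zc;
    have b2 := cDt z cz; have b3 := cX z; have b4 := cL z cz;
    by rewrite /Phi; cont_tac. }
rewrite E1 E2 -/I1 -/I2 -/I3 -/I4.
by apply/eqP; rewrite -subr_eq0 -[X in _ == X]oppr0 -K1; apply/eqP; ring.
Qed.

End Moments.

(** * Estimate of the error term *)

Lemma norm_le_sqrt {R : realType} (x a b : R) : 0 <= b -> x ^+ 2 <= a * b ->
  `|x| <= Num.sqrt b * Num.sqrt a.
Proof.
by move=> b0 h; rewrite -(sqrtrM _ b0) -sqrtr_sqr; apply: ler_wsqrtr; rewrite mulrC.
Qed.

Section MomentEstimate.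
Context {R : realType}.
Local Notation plane := (R * R)%type.
Variables (f' j' u : plane -> R) (p : plane) (r al be C : R) (i : 'I_2).
Hypothesis sf : smooth_near cdisc f'.
Hypothesis sj : smooth_near circle j'.
Hypothesis su : smooth_near cdisc u.
Hypothesis dp : disc p.
Hypothesis C0 : 0 < C.
Hypothesis dist_le1 : forall z, cdisc z -> `|pull_dist u p r C z| <= 1.

Let V : R := expR 1 * C.
Let c : R := 4 * cap_kappa r ^+ 2.
Let Phi (z : plane) : plane := (mob_re p z, mob_im p z).
Let D1 := dist1 u p r.
Let D2 := dist2 u p r.

Let c_ge0 : 0 <= c. Proof. by rewrite mulr_ge0 ?sqr_ge0. Qed.

(** The distance to the profile contributes at most a factor [e], and the profile [C / cap_N] is at
    most [C]. *)
Lemma pull_log_le z : cdisc z -> expR (pull_log u p z) <= V.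
Proof.
move=> cz; have N1 : 1 <= cap_N r z.
  by rewrite /cap_N lerDl mulr_ge0 ?addr_ge0 ?sqr_ge0.
have N0 := cap_N_gt0 r z; have CN : 0 < C / cap_N r z by rewrite divr_gt0.
have -> : pull_log u p z = pull_dist u p r C z + ln (C / cap_N r z).
  by rewrite /pull_dist subrK.
rewrite expRD lnK// /V ler_pM ?expR_ge0 ?(ltW CN)//.
  by rewrite ler_expR (le_trans (ler_norm _))// dist_le1.
by rewrite ler_pdivrMr// ler_peMr// ltW.
Qed.

(** In complex form the fields are [kappa (1 - w^2)] and [i kappa (1 + w^2)], of modulus at most
    [2 kappa] on the disc. *)
Lemma eta_sqr_le z : cdisc z -> eta1 r i z ^+ 2 + eta2 r i z ^+ 2 <= c.
Proof.
move=> /cdiscP; rewrite /eta1 /eta2 /c; case: z => x y /= h.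
have k0 := sqr_ge0 (cap_kappa r).
have s0 : 0 <= x ^+ 2 by exact: sqr_ge0.
have t0 : 0 <= y ^+ 2 by exact: sqr_ge0.
have m : (x ^+ 2 + y ^+ 2) ^+ 2 <= 1 by rewrite expr_le1// addr_ge0.
have [->|->] := I2_cases i; rewrite /cf1 /cf2 /=.
  suff -> : (cap_kappa r - 0 * y - cap_kappa r * (x ^+ 2 - y ^+ 2) - 2 * 0 * (x * y)) ^+ 2
   + (0 + 0 * x - 2 * cap_kappa r * (x * y) + 0 * (x ^+ 2 - y ^+ 2)) ^+ 2
   = (1 - 2 * (x ^+ 2 - y ^+ 2) + (x ^+ 2 + y ^+ 2) ^+ 2) * cap_kappa r ^+ 2.
    by rewrite ler_wpM2r//; lra.
  by ring.
suff -> : (0 - 0 * y - 0 * (x ^+ 2 - y ^+ 2) - 2 * cap_kappa r * (x * y)) ^+ 2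
   + (cap_kappa r + 0 * x - 2 * 0 * (x * y) + cap_kappa r * (x ^+ 2 - y ^+ 2)) ^+ 2
   = (1 + 2 * (x ^+ 2 - y ^+ 2) + (x ^+ 2 + y ^+ 2) ^+ 2) * cap_kappa r ^+ 2.
  by rewrite ler_wpM2r//; lra.
by ring.
Qed.

Lemma eta_dist_le z : cdisc z ->
  eta_dist u p r i z ^+ 2 <= c * (D1 z ^+ 2 + D2 z ^+ 2).
Proof.
move=> /eta_sqr_le h; rewrite /eta_dist -/D1 -/D2.
apply: (@le_trans _ _ ((eta1 r i z ^+ 2 + eta2 r i z ^+ 2) * (D1 z ^+ 2 + D2 z ^+ 2))).
  rewrite -subr_ge0; set X := (X in 0 <= X).
  suff -> : X = (eta1 r i z * D2 z - eta2 r i z * D1 z) ^+ 2 by exact: sqr_ge0.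
  by rewrite /X; ring.
by rewrite ler_wpM2r// addr_ge0 ?sqr_ge0.
Qed.

(* On the circle the field is tangential, so only the tangential derivative of
   [pull_dist] enters. *)
Lemma eta_dist_circle_le z : circle z ->
  eta_dist u p r i z ^+ 2 <= c * (- z.2 * D1 z + z.1 * D2 z) ^+ 2.
Proof.
move=> zc; have h := eta_sqr_le (circle_cdisc zc).
pose g := if i == 0 then cf_g (cap_kappa r) 0 0 z else cf_g 0 (cap_kappa r) 0 z.
have E1 : eta1 r i z = - z.2 * g by rewrite /eta1 /g; case: ifP => _; exact: cf1_circle.
have E2 : eta2 r i z = z.1 * g by rewrite /eta2 /g; case: ifP => _; exact: cf2_circle.
have gc : g ^+ 2 <= c.
  have -> : g ^+ 2 = eta1 r i z ^+ 2 + eta2 r i z ^+ 2; last by [].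
  rewrite E1 E2; move/circleP: zc => zc.
  by transitivity (g ^+ 2 * (z.1 ^+ 2 + z.2 ^+ 2)); [rewrite zc mulr1|ring].
have -> : eta_dist u p r i z ^+ 2 = g ^+ 2 * (- z.2 * D1 z + z.1 * D2 z) ^+ 2.
  by rewrite /eta_dist E1 E2 -/D1 -/D2; ring.
by rewrite ler_wpM2r// sqr_ge0.
Qed.

Let cont_circle_at (F : plane -> R) :
  (forall z, circle z -> continuous_at z F) -> cont_circle F.
Proof.
move=> cF t; have cz := cF _ (circle_ptP t).
rewrite /circle_pt in cz *; change (continuous_at t (fun t : R => F (cos t, sin t))).
by cont_tac.
Qed.

(** Cauchy-Schwarz with the weight [expR (2 v)] shared equally. The factor with the defect is
    conformally invariant and becomes an integral in [u]; the other is bounded by [V] and the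
    gradient of [pull_dist]. *)
Lemma cap_defect_moment_le :
  `|int_disc (fun z => cap_defect f' u al (Phi z) * eta_dist u p r i z
      * expR (2 * pull_log u p z))|
  <= Num.sqrt (V ^+ 2 * c * int_disc (fun z => D1 z ^+ 2 + D2 z ^+ 2))
     * Num.sqrt (int_disc (fun z => cap_defect f' u al z ^+ 2 * expR (2 * u z))).
Proof.
have CA := cap_defect_C1 al sf su.
have cA z : cdisc z -> continuous_at z (fun z => cap_defect f' u al (mob_re p z, mob_im p z)).
  move=> cz; exact: (cont_comp_mobius dp cz (fun y cy => C1_cont CA cy)).
have cL z : cdisc z -> continuous_at z (pull_log u p) by exact: cont_pull_log.
have cD1 z : cdisc z -> continuous_at z D1 by move=> cz; have [] := cont_dist r su dp cz.
have cD2 z : cdisc z -> continuous_at z D2 by move=> cz; have [] := cont_dist r su dp cz.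
have e1 : C1_on setT (eta1 r i).
  by rewrite /eta1; case: ifP => _; exact: C1_cf1.
have e2 : C1_on setT (eta2 r i).
  by rewrite /eta2; case: ifP => _; exact: C1_cf2.
have cE z : cdisc z -> continuous_at z (eta_dist u p r i).
  move=> cz; have h1 := cD1 z cz; have h2 := cD2 z cz.
  have h3 := @C1_cont _ _ _ z e1 I; have h4 := @C1_cont _ _ _ z e2 I.
  rewrite /D1 in h1; rewrite /D2 in h2.
  by rewrite /eta_dist; cont_tac.
have S0 : 0 <= V ^+ 2 * c * int_disc (fun z => D1 z ^+ 2 + D2 z ^+ 2).
  apply: mulr_ge0; first by rewrite mulr_ge0 ?c_ge0 ?sqr_ge0.
  by apply: int_disc_ge0 => z _; rewrite addr_ge0 ?sqr_ge0.
apply: norm_le_sqrt => //.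
have -> : int_disc (fun z => cap_defect f' u al (Phi z) * eta_dist u p r i z
    * expR (2 * pull_log u p z))
  = int_disc (fun z => (cap_defect f' u al (Phi z) * expR (pull_log u p z))
      * (eta_dist u p r i z * expR (pull_log u p z))).
  by apply: eq_int_disc => z _; rewrite expRM_natl; ring.
have EA : int_disc (fun z => (cap_defect f' u al (Phi z) * expR (pull_log u p z)) ^+ 2)
    = int_disc (fun z => cap_defect f' u al z ^+ 2 * expR (2 * u z)).
  have s1 := C1_smooth su.
  have CG : C1_on cdisc (fun z => cap_defect f' u al z ^+ 2 * expR (2 * u z)) by C1_tac.
  rewrite -(int_disc_mobius_C1 dp CG); apply: eq_int_disc => z /disc_cdisc cz.
  have [E _] := exp_pull_log u dp cz.
  by rewrite E /Phi expRM_natl; ring.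
have cf z : cdisc z -> continuous_at z
    (fun z => cap_defect f' u al (Phi z) * expR (pull_log u p z)).
  by move=> cz; have h1 := cA z cz; have h2 := cL z cz; rewrite /Phi; cont_tac.
have cg z : cdisc z -> continuous_at z
    (fun z => eta_dist u p r i z * expR (pull_log u p z)).
  by move=> cz; have h1 := cE z cz; have h2 := cL z cz; cont_tac.
apply: (le_trans (int_disc_CauchySchwarz cf cg)); rewrite EA ler_wpM2l//.
  by apply: int_disc_ge0 => z _; rewrite mulr_ge0 ?sqr_ge0 ?expR_ge0.
have cS : cont_cdisc (fun z => D1 z ^+ 2 + D2 z ^+ 2).
  by move=> z cz; have h1 := cD1 z cz; have h2 := cD2 z cz; cont_tac.
have cVS : cont_cdisc (fun z => V ^+ 2 * c * (D1 z ^+ 2 + D2 z ^+ 2)).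
  by move=> z cz; have h1 := cD1 z cz; have h2 := cD2 z cz; cont_tac.
have cg2 : cont_cdisc (fun z => (eta_dist u p r i z * expR (pull_log u p z)) ^+ 2).
  by move=> z cz; have h1 := cE z cz; have h2 := cL z cz; cont_tac.
rewrite -(int_discZ _ cS); apply: (le_int_disc cg2 cVS) => z /disc_cdisc cz.
have h1 := eta_dist_le cz; have h2 := pull_log_le cz.
rewrite exprMn mulrC -mulrA ler_pM ?sqr_ge0//.
by rewrite ler_pXn2r ?nnegrE ?expR_ge0// mulr_ge0 ?expR_ge0// ltW.
Qed.

Lemma rim_defect_moment_le :
  `|int_circle (fun z => rim_defect j' u be (Phi z) * eta_dist u p r i z
      * expR (pull_log u p z))|
  <= Num.sqrt (V * c * int_circle (fun z => (- z.2 * D1 z + z.1 * D2 z) ^+ 2))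
     * Num.sqrt (int_circle (fun z => rim_defect j' u be z ^+ 2 * expR (u z))).
Proof.
have CB := rim_defect_C1 be sj su.
have cB z : circle z -> continuous_at z (fun z => rim_defect j' u be (mob_re p z, mob_im p z)).
  move=> cz; exact: (cont_comp_mobius_circle dp cz (fun y cy => C1_cont CB cy)).
have cL z : cdisc z -> continuous_at z (pull_log u p) by exact: cont_pull_log.
have cD1 z : cdisc z -> continuous_at z D1 by move=> cz; have [] := cont_dist r su dp cz.
have cD2 z : cdisc z -> continuous_at z D2 by move=> cz; have [] := cont_dist r su dp cz.
have e1 : C1_on setT (eta1 r i).
  by rewrite /eta1; case: ifP => _; exact: C1_cf1.
have e2 : C1_on setT (eta2 r i).
  by rewrite /eta2; case: ifP => _; exact: C1_cf2.
have cE z : cdisc z -> continuous_at z (eta_dist u p r i).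
  move=> cz; have h1 := cD1 z cz; have h2 := cD2 z cz.
  have h3 := @C1_cont _ _ _ z e1 I; have h4 := @C1_cont _ _ _ z e2 I.
  rewrite /D1 in h1; rewrite /D2 in h2.
  by rewrite /eta_dist; cont_tac.
have V0 : 0 < V by rewrite mulr_gt0 ?expR_gt0.
have S0 : 0 <= V * c * int_circle (fun z => (- z.2 * D1 z + z.1 * D2 z) ^+ 2).
  apply: mulr_ge0; first by rewrite mulr_ge0 ?c_ge0 ?(ltW V0).
  by apply: int_circle_ge0 => z _; exact: sqr_ge0.
apply: norm_le_sqrt => //.
(* On the circle the weight is [expR v], so each factor receives its square root. *)
have half z : expR (2^-1 * pull_log u p z) ^+ 2 = expR (pull_log u p z).
  by rewrite -expRM_natl mulrA divff// mul1r.
have -> : int_circle (fun z => rim_defect j' u be (Phi z) * eta_dist u p r i z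
    * expR (pull_log u p z))
  = int_circle (fun z => (rim_defect j' u be (Phi z) * expR (2^-1 * pull_log u p z))
      * (eta_dist u p r i z * expR (2^-1 * pull_log u p z))).
  by apply: eq_int_circle => z _; rewrite -half; ring.
have EB : int_circle (fun z => (rim_defect j' u be (Phi z) * expR (2^-1 * pull_log u p z)) ^+ 2)
    = int_circle (fun z => rim_defect j' u be z ^+ 2 * expR (u z)).
  have [w12 [a b d]] := C1_smooth su.
  have s1 : C1_on circle u.
    by exists w12; split => z /circle_cdisc; [exact: a|exact: b|exact: d].
  have CG : C1_on circle (fun z => rim_defect j' u be z ^+ 2 * expR (u z)) by C1_tac.
  rewrite -(int_circle_mobius_C1 dp CG); apply: eq_int_circle => z /circle_cdisc cz.
  have [E _] := exp_pull_log u dp cz.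
  by rewrite exprMn half E /Phi; ring.
have cf : cont_circle
    (fun z => rim_defect j' u be (Phi z) * expR (2^-1 * pull_log u p z)).
  apply: cont_circle_at => z zc; have h1 := cB z zc; have h2 := cL z (circle_cdisc zc).
  by rewrite /Phi; cont_tac.
have cg : cont_circle (fun z => eta_dist u p r i z * expR (2^-1 * pull_log u p z)).
  apply: cont_circle_at => z /circle_cdisc cz; have h1 := cE z cz; have h2 := cL z cz.
  by cont_tac.
apply: (le_trans (int_circle_CauchySchwarz cf cg)); rewrite EB ler_wpM2l//.
  by apply: int_circle_ge0 => z _; rewrite mulr_ge0 ?sqr_ge0 ?expR_ge0.
have cS : cont_circle (fun z => (- z.2 * D1 z + z.1 * D2 z) ^+ 2).
  apply: cont_circle_at => z /circle_cdisc cz; have h1 := cD1 z cz; have h2 := cD2 z cz.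
  by cont_tac.
have cVS : cont_circle (fun z => V * c * (- z.2 * D1 z + z.1 * D2 z) ^+ 2).
  apply: cont_circle_at => z /circle_cdisc cz; have h1 := cD1 z cz; have h2 := cD2 z cz.
  by cont_tac.
have cg2 : cont_circle (fun z => (eta_dist u p r i z * expR (2^-1 * pull_log u p z)) ^+ 2).
  apply: cont_circle_at => z /circle_cdisc cz; have h1 := cE z cz; have h2 := cL z cz.
  by cont_tac.
rewrite -(int_circleZ _ cS); apply: (le_int_circle cg2 cVS) => z zc.
have h1 := eta_dist_circle_le zc; have h2 := pull_log_le (circle_cdisc zc).
by rewrite exprMn half mulrC -mulrA ler_pM ?sqr_ge0 ?expR_ge0.
Qed.

End MomentEstimate.

(** * The [L^2] norms of derivatives inside the Sobolev norms *)

Section NormBounds.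
Context {R : realType}.
Implicit Types (w a b : R * R -> R).
Local Notation leb2 := (@lebesgue_measure R \x @lebesgue_measure R)%E.

(** Both the zeroth-order term and the fractional double integral are nonnegative and are dropped;
    finiteness of the norm makes the passage to real numbers legitimate. *)
Lemma int_disc_le_H32 w (w' : R * R -> R) a b : (forall z, disc z -> w z = w' z) ->
  (forall z, disc z -> d1 w z = a z) -> (forall z, disc z -> d2 w z = b z) ->
  cont_cdisc w' -> cont_cdisc a -> cont_cdisc b ->
  (H32_sqnorm w < +oo)%E ->
  int_disc (fun z => a z ^+ 2 + b z ^+ 2) <= fine (H32_sqnorm w).
Proof.
move=> ww' wa wb cw ca cb fin.
have cab : cont_cdisc (fun z => a z ^+ 2 + b z ^+ 2).
  by move=> z cz; have h1 := ca z cz; have h2 := cb z cz; cont_tac.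
have cwab : cont_cdisc (fun z => w' z ^+ 2 + a z ^+ 2 + b z ^+ 2).
  move=> z cz; have h1 := ca z cz; have h2 := cb z cz; have h3 := cw z cz.
  by cont_tac.
have I1 := integrable_disc cab; have I2 := integrable_disc cwab.
have H : ((int_disc (fun z => w' z ^+ 2 + a z ^+ 2 + b z ^+ 2))%:E <= H32_sqnorm w)%E.
  rewrite /int_disc /Rintegral fineK; last first.
    by apply: (integrable_fin_num _ I2); exact: measurable_disc.
  rewrite /H32_sqnorm; set J := (X in (_ <= _ + X)%E).
  have J0 : (0 <= J)%E.
    apply: integral_ge0 => x _; apply: integral_ge0 => y _.
    rewrite lee_fin divr_ge0//; first by rewrite addr_ge0 ?sqr_ge0.
    by rewrite exprn_ge0// sqrtr_ge0.
  apply: le_trans (leeDl _ J0); rewrite le_eqVlt; apply/orP; left; apply/eqP.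
  by apply: eq_integral => z; rewrite inE /= => dz; rewrite ww'// wa// wb.
have fn : H32_sqnorm w \is a fin_num.
  rewrite ge0_fin_numE//; apply: le_trans H; rewrite lee_fin.
  by apply: int_disc_ge0 => z _; rewrite !addr_ge0 ?sqr_ge0.
apply: (@le_trans _ _ (int_disc (fun z => w' z ^+ 2 + a z ^+ 2 + b z ^+ 2))).
  by apply: (le_int_disc cab cwab) => z _; rewrite -addrA lerDr sqr_ge0.
by rewrite -lee_fin (fineK fn).
Qed.

Lemma int_circle_le_H1 w (w' : R * R -> R) a b : (forall z, circle z -> w z = w' z) ->
  (forall z, circle z -> pgrad w' z (a z) (b z)) ->
  cont_circle (fun z => - z.2 * a z + z.1 * b z) ->
  (H1_circle_sqnorm w < +oo)%E ->
  int_circle (fun z => (- z.2 * a z + z.1 * b z) ^+ 2) <= fine (H1_circle_sqnorm w).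
Proof.
move=> ww' dw cab fin.
have cc : cont_circle w'.
  by move=> t; exact: has_derive1_continuous (has_derive1_circle_pt (dw _ (circle_ptP t))).
have c1 : cont_circle (fun z => (- z.2 * a z + z.1 * b z) ^+ 2).
  move=> t; have h := cab t; rewrite /prop_for in h *.
  exact: (@contX _ _ (fun t : R => - (circle_pt t).2 * a (circle_pt t)
    + (circle_pt t).1 * b (circle_pt t)) t h).
have c2 : cont_circle (fun z => w' z ^+ 2 + (- z.2 * a z + z.1 * b z) ^+ 2).
  move=> t; have h := c1 t; have h' := cc t.
  apply: (@contD _ _ (fun t => w' (circle_pt t) ^+ 2) _ t _ h).
  exact: (@contX _ _ (fun t => w' (circle_pt t)) t h').
have I2 := integrable_circle c2.
have H : ((int_circle (fun z => w' z ^+ 2 + (- z.2 * a z + z.1 * b z) ^+ 2))%:E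
    = H1_circle_sqnorm w)%E.
  rewrite /int_circle /Rintegral fineK; last exact: integrable_fin_num.
  apply: eq_integral => t _ /=; rewrite ww'; last exact: circle_ptP.
  have -> : w \o circle_pt = (fun t => w' (circle_pt t)).
    by apply/funext => s /=; rewrite ww'//; exact: circle_ptP.
  have [_ E] := has_derive1_circle_pt (dw _ (circle_ptP t)).
  by rewrite derive1E E.
rewrite -H /= ; apply: (le_int_circle c1 c2) => z _.
by rewrite lerDr sqr_ge0.
Qed.

End NormBounds.
(** The estimate at one fixed time with explicit constants. Convergence enters only through a sup
    norm below 1 and two finite norms, conditions that hold eventually along the sequence. *)
Lemma moment_error_le {R : realType} (f f' j j' U u : R * R -> R) (p : R * R)
    (r al be C : R) (i : 'I_2) :
  smooth_near cdisc f' -> (forall z, cdisc z -> f z = f' z) ->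
  smooth_near circle j' -> (forall z, circle z -> j z = j' z) ->
  smooth_near cdisc u -> (forall z, cdisc z -> U z = u z) ->
  disc p -> 0 < r -> 0 < C ->
  let w z := pull U (mobius p) z - ln (C / (1 + r ^+ 2 * enorm z ^+ 2)) in
  let v := pull U (mobius p) in
  let kk : 'I_3 := widen_ord (leqnSn 2) i in
  let c := 4 * cap_kappa r ^+ 2 in
  (Linfty_norm w < 1%:E)%E -> (H32_sqnorm w < +oo)%E ->
  (H1_circle_sqnorm w < +oo)%E ->
  `|2 * (int_cap r v (fun X => X 0 kk *
           (al * lift_cap r p f X - lift_cap r p (gauss_curv U) X))
         + int_rim r v (fun X => X 0 kk *
           (be * lift_cap r p j X - lift_cap r p (geod_curv U) X)))
    - (al * int_cap r v (fun X =>
          tangent_derive proj_sphere (lift_cap r p f) (xi r i X) X)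
       + 2 * be * int_rim r v (fun X =>
          tangent_derive (proj_rim r) (lift_cap r p j) (xi r i X) X))|
  <= 2 * (Num.sqrt ((expR 1 * C) ^+ 2 * c * fine (H32_sqnorm w))
          + Num.sqrt (expR 1 * C * c * fine (H1_circle_sqnorm w)))
     * Num.sqrt (int_disc (fun z => (al * f z - gauss_curv U z) ^+ 2 * expR (2 * U z))
                 + int_circle (fun z => (be * j z - geod_curv U z) ^+ 2 * expR (U z))).
Proof.
move=> sf ff' sj jj' su Uu dp r0 C0 w v kk c wM w32 w1.
have wE z : cdisc z -> w z = pull_dist u p r C z.
  by move=> cz; rewrite /w enorm_sqr (pullE Uu dp cz).
have dP z : cdisc z -> pgrad (pull_dist u p r C) z (dist1 u p r z) (dist2 u p r z).
  by move=> cz; exact: (pull_dist_pgrad r su dp C0 cz).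
have cw : cont_cdisc (pull_dist u p r C).
  by move=> z cz; exact: pgrad_continuous (dP z cz).
have le1 z : cdisc z -> `|pull_dist u p r C z| <= 1.
  by move=> cz; apply: (Linfty_norm_le (fun z dz => wE z (disc_cdisc dz)) cw wM).
have cD1 : cont_cdisc (dist1 u p r) by move=> z cz; have [] := cont_dist r su dp cz.
have cD2 : cont_cdisc (dist2 u p r) by move=> z cz; have [] := cont_dist r su dp cz.
have near_w z : disc z -> \forall y \near z, w y = pull_dist u p r C y.
  by move=> dz; apply: (near_disc dz) => y dy; exact: wE (disc_cdisc dy).
have S1 : int_disc (fun z => dist1 u p r z ^+ 2 + dist2 u p r z ^+ 2)
    <= fine (H32_sqnorm w).
  apply: (int_disc_le_H32 _ _ _ cw cD1 cD2 w32) => z dz.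
  - exact: wE (disc_cdisc dz).
  - rewrite -(pgrad_d1 (dP z (disc_cdisc dz))); apply: near_eq_derive; exact: near_w.
  - rewrite -(pgrad_d2 (dP z (disc_cdisc dz))); apply: near_eq_derive; exact: near_w.
have cT : cont_circle (fun z => - z.2 * dist1 u p r z + z.1 * dist2 u p r z).
  apply: cont_cdisc_circle => z cz; have h1 := cD1 z cz; have h2 := cD2 z cz.
  by cont_tac.
have S2 : int_circle (fun z => (- z.2 * dist1 u p r z + z.1 * dist2 u p r z) ^+ 2)
    <= fine (H1_circle_sqnorm w).
  apply: (int_circle_le_H1 (w' := pull_dist u p r C) _ _ cT w1) => z zc.
    exact: wE (circle_cdisc zc).
  exact: dP (circle_cdisc zc).
rewrite (moment_identity al be i sf ff' sj jj' su Uu dp r0).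
rewrite [X in `|X|]addrC addrA addNr add0r.
set F1 := (X in _ * Num.sqrt (X + _)); set F2 := (X in _ * Num.sqrt (_ + X)).
have F10 : 0 <= F1.
  by apply: int_disc_ge0 => z _; rewrite mulr_ge0 ?sqr_ge0 ?expR_ge0.
have F20 : 0 <= F2.
  by apply: int_circle_ge0 => z _; rewrite mulr_ge0 ?sqr_ge0 ?expR_ge0.
have E1 : int_disc (fun z => cap_defect f' u al z ^+ 2 * expR (2 * u z)) = F1.
  apply: eq_int_disc => z dz; rewrite (cap_defectE al ff' Uu dz).
  by rewrite Uu//; exact: disc_cdisc.
have E2 : int_circle (fun z => rim_defect j' u be z ^+ 2 * expR (u z)) = F2.
  apply: eq_int_circle => z zc; rewrite (rim_defectE be jj' su Uu zc).
  by rewrite Uu//; exact: circle_cdisc.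
have M1 := cap_defect_moment_le al i sf su dp C0 le1.
have M2 := rim_defect_moment_le be i sj su dp C0 le1.
rewrite E1 in M1; rewrite E2 in M2.
have c0 : 0 <= c by rewrite mulr_ge0 ?sqr_ge0.
have V0 : 0 <= expR 1 * C by rewrite mulr_ge0 ?expR_ge0// ltW.
apply: (le_trans (ler_normD _ _)); rewrite !normrM ger0_norm// -mulrDr -[X in _ <= X]mulrA.
(* Each of [F1] and [F2] is enlarged to their sum, so that a common square root factors out. *)
apply: ler_wpM2l => //; rewrite mulrDl; apply: lerD.
  apply: (le_trans M1); apply: ler_pM; rewrite ?sqrtr_ge0//; apply: ler_wsqrtr.
    by apply: ler_wpM2l => //; rewrite mulr_ge0 ?sqr_ge0.
  by rewrite lerDl.
apply: (le_trans M2); apply: ler_pM; rewrite ?sqrtr_ge0//; apply: ler_wsqrtr.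
  by apply: ler_wpM2l => //; rewrite mulr_ge0.
by rewrite lerDr.
Qed.

(** * Passage to the limit along the sequence *)

Lemma cap_radius_gt0 {R : realType} (f j : R * R -> R) z : 0 < f z -> 0 < j z ->
  0 < cap_radius f j z.
Proof.
move=> f0 j0; rewrite /cap_radius subr_gt0.
have sf : 0 < Num.sqrt (f z) by rewrite sqrtr_gt0.
(* With [q = j / sqrt f] the claim is [q < sqrt (1 + q^2)]. *)
have q0 : 0 <= j z / Num.sqrt (f z) by rewrite divr_ge0 ?ltW.
have -> : j z ^+ 2 / f z = (j z / Num.sqrt (f z)) ^+ 2.
  by rewrite expr_div_n sqr_sqrtr// ltW.
rewrite -[X in X < _](ger0_norm q0) -sqrtr_sqr ltr_sqrt ?ltrDr//.
by rewrite ltr_wpDr ?sqr_ge0.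
Qed.

Lemma ereal_cvg0_lt1 {R : realType} (x : nat -> \bar R) :
  x l @[l --> \oo] --> 0%E -> \forall l \near \oo, (x l < 1%:E)%E.
Proof.
move=> x0; have fin := cvg_is_fine x0; move/fine_cvg: x0 => fx.
have lt1 := cvgr_lt (0 : R) fx 1 ltr01.
by apply: filterS2 fin (lt1 _) => l fl h; rewrite -(fineK fl) lte_fin.
Qed.

Lemma sqrt_scale_cvg0 {R : realType} (c : R) (x : nat -> \bar R) :
  x l @[l --> \oo] --> 0%E -> Num.sqrt (c * fine (x l)) @[l --> \oo] --> (0 : R).
Proof.
move=> /fine_cvg x0; rewrite -[X in _ --> X]sqrtr0 -[X in _ --> Num.sqrt X](mulr0 c).
apply: (@continuous_cvg _ _ _ _ _ (fun l => c * fine (x l)) (@Num.sqrt R) (c * 0)).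
  exact: sqrt_continuous.
by apply: cvgM; [exact: cvg_cst|exact: x0].
Qed.

Theorem lemma5p8 (R : realType) (f j : R * R -> R)
  (f_smooth : smooth_on cdisc f) (f_gt0 : forall z, cdisc z -> 0 < f z)
  (j_smooth : smooth_on circle j) (j_gt0 : forall z, circle z -> 0 < j z)
  (j_harmonic : harmonic_extension j)
  (no_solution : ~ exists w : R * R -> R, solves_prescribed f j w)
  (u : R -> R * R -> R) (rho : R -> R)
  (flow : curvature_flow f j u rho)
  (z0 : R * R) (z0_circle : circle z0)
  (p : R -> R * R)
  (p_disc : forall t : R, 0 <= t -> disc (p t))
  (p_balanced : forall t : R, 0 <= t ->
     balanced (cap_radius f j z0) (pull (u t) (mobius (p t))))
  (tl : nat -> R)
  (conc : concentrates f j u rho p z0 tl) :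
  forall i : 'I_2,
  exists2 eps : nat -> R, eps l @[l --> \oo] --> 0 &
    \forall l \near \oo,
      2 * Xi f j u rho p (cap_radius f j z0) (tl l) i
      = alpha f u rho (tl l) * int_xi_df f u p (cap_radius f j z0) (tl l) i
        + 2 * beta j u rho (tl l) * int_xi_dj j u p (cap_radius f j z0) (tl l) i
        + eps l * Num.sqrt (defect f j u rho (tl l)).
Proof.
move=> i; have [f' sf ff'] := smooth_on_near f_smooth.
have [j' sj jj'] := smooth_on_near j_smooth.
have [[_ _ u_smooth] _ _ _ _] := flow.
have [u' su' uu'] := smooth_on_near u_smooth.
have [tlo _ _ [ainf [binf [a0 b0 ab _ [w32 w1 winf]]]]] := conc.
pose r := cap_radius f j z0.
have fz0 := f_gt0 _ (circle_cdisc z0_circle); have jz0 := j_gt0 _ z0_circle.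
have r0 : 0 < r by exact: cap_radius_gt0.
pose C := 2 * r / Num.sqrt (ainf * f z0).
have C0 : 0 < C by rewrite divr_gt0 ?mulr_gt0// sqrtr_gt0 mulr_gt0.
pose w l z := pull (u (tl l)) (mobius (p (tl l))) z - v_limit r ainf (f z0) z.
pose c := 4 * cap_kappa r ^+ 2.
pose bnd l := 2 * (Num.sqrt ((expR 1 * C) ^+ 2 * c * fine (H32_sqnorm (w l)))
  + Num.sqrt (expR 1 * C * c * fine (H1_circle_sqnorm (w l)))).
have bnd0 : bnd l @[l --> \oo] --> 0.
  rewrite -(mulr0 2); apply: cvgM; first exact: cvg_cst.
  by rewrite -(addr0 0); apply: cvgD; exact: sqrt_scale_cvg0.
pose F l := defect f j u rho (tl l).
pose df l := 2 * Xi f j u rho p r (tl l) i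
  - (alpha f u rho (tl l) * int_xi_df f u p r (tl l) i
     + 2 * beta j u rho (tl l) * int_xi_dj j u p r (tl l) i).
have main : \forall l \near \oo, `|df l| <= bnd l * Num.sqrt (F l).
  (* Joint smoothness of the flow up to the boundary holds at positive times only. *)
  have tpos : \forall l \near \oo, 0 < tl l by have /cvgryPgt := tlo; exact.
  have ev1 : \forall l \near \oo, (Linfty_norm (w l) < 1%:E)%E.
    exact: ereal_cvg0_lt1 winf.
  have ev2 : \forall l \near \oo, (H32_sqnorm (w l) < +oo)%E.
    by apply: filterS (ereal_cvg0_lt1 w32) => l h; exact: lt_trans h (ltry 1).
  have ev3 : \forall l \near \oo, (H1_circle_sqnorm (w l) < +oo)%E.
    by apply: filterS (ereal_cvg0_lt1 w1) => l h; exact: lt_trans h (ltry 1).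
  near=> l; have t0 : 0 < tl l by near: l.
  have su := smooth_near_slice su' t0.
  have Uu z : cdisc z -> u (tl l) z = u' (tl l, z).
    by move=> cz; exact: (uu' (tl l, z) (conj t0 cz)).
  have h1 : (Linfty_norm (w l) < 1%:E)%E by near: l.
  have h2 : (H32_sqnorm (w l) < +oo)%E by near: l.
  have h3 : (H1_circle_sqnorm (w l) < +oo)%E by near: l.
  have := @moment_error_le R f f' j j' (u (tl l)) (fun z => u' (tl l, z)) (p (tl l))
    r (alpha f u rho (tl l)) (beta j u rho (tl l)) C i sf ff' sj jj' su Uu
    (p_disc _ (ltW t0)) r0 C0 h1 h2 h3.
  move=> /le_trans; apply; apply: ler_wpM2l.
    by rewrite mulr_ge0 ?addr_ge0 ?sqrtr_ge0.
  (* The two curvature integrals are the defect less the square of [derive1 rho]. *)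
  by apply: ler_wsqrtr; rewrite /F /defect lerDl sqr_ge0.
(* Where the defect vanishes this quotient is 0 by the convention on division, and [main] forces
   [df l = 0], so the identity still holds. *)
exists (fun l => df l / Num.sqrt (F l)).
  apply/norm_cvg0P/(@squeeze_cvgr _ _ _ _ (fun=> 0) bnd); last exact: bnd0.
    apply: filterS main => l h; rewrite normr_ge0 /= normrM normfV (ger0_norm (sqrtr_ge0 _)).
    have [->|n0] := eqVneq (Num.sqrt (F l)) 0.
      by rewrite invr0 mulr0 mulr_ge0 ?addr_ge0 ?sqrtr_ge0.
    by rewrite ler_pdivrMr// lt_def n0 sqrtr_ge0.
  exact: cvg_cst.
apply: filterS main => l h.
have -> : df l / Num.sqrt (F l) * Num.sqrt (F l) = df l.
  have [e0|n0] := eqVneq (Num.sqrt (F l)) 0; last by rewrite divfK.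
  by move: h; rewrite e0 !mulr0 normr_le0 => /eqP.
by rewrite /df addrC subrK.
Unshelve. all: by end_near.
Qed.
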